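(* Let $L=L_{-1}\oplus L_0\oplus\cdots\oplus L_{k}$ be a graded Lie subalgebra of $\mathit{Vect}_*(E)$, where $L_p=L\cap \mathit{Vect}_p(E)$. Then $L$ is maximal in $\mathit{Vect}_*(E)$ if and only if all of the following conditions hold: (1) $L_{-1}=\mathit{Vect}_{-1}(E)$; (2) $L$ is irreducible, i.e. the representation of $L_0$ on $L_{-1}$ by $\mathrm{ad}$ is irreducible; (3) $L_{1}\neq 0$; (4) when $\mathbb{K}=\mathbb{R}$, the representation of $L_0$ on $L_{-1}$ by $\mathrm{ad}$ admits no complex structure.
   Context: $\mathbb{K}$ is $\mathbb{R}$ or $\mathbb{C}$, and $E$ is an $n$-dimensional vector space over $\mathbb{K}$, with $n\geq 1$. $\mathit{Vect}_*(E)$ denotes the $\mathbb{K}$-Lie algebra of polynomial vector fields on $E$, i.e. of polynomial maps $E\to E$ (holomorphic, i.e. complex polynomial, when $\mathbb{K}=\mathbb{C}$), with the Lie bracket given, in a basis $(e_j)$ with coordinates $x^j$ and $\partial_j = d/dx^j$, by $[X,Y]=\sum_{j,k}(X^j\partial_jY^k-Y^j\partial_jX^k)e_k$ for $X=\sum_j X^je_j$, $Y=\sum_j Y^je_j$. For $p\ge -1$, $\mathit{Vect}_p(E)$ is the space of vector fields whose coefficients are homogeneous polynomials of degree $p+1$, so that $\mathit{Vect}_*(E)=\bigoplus_{p\ge -1}\mathit{Vect}_p(E)$; in particular $\mathit{Vect}_{-1}(E)$ is the space of constant vector fields. Write $\mathrm{ad}(X)Y=[X,Y]$. Subalgebras are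 $\mathbb{K}$-linear Lie subalgebras. A subalgebra $L$ is graded if it is the direct sum of the subspaces $L_p=L\cap\mathit{Vect}_p(E)$. A subalgebra $L$ of $\mathit{Vect}_*(E)$ is maximal if, for every subalgebra $L'$ of $\mathit{Vect}_*(E)$ with $L\subset L'$, one has $L'=L$ or $L'=\mathit{Vect}_*(E)$. A complex structure of the representation of $L_0$ on the real vector space $L_{-1}$ is an $\mathbb{R}$-linear map $J:L_{-1}\to L_{-1}$ with $J^2=-\mathrm{id}$ and $[x_0,Jx_{-1}]=J[x_0,x_{-1}]$ for all $x_0\in L_0$, $x_{-1}\in L_{-1}$. *)

(* Defs.v *)
From HB Require Import structures.
From mathcomp Require Import all_boot all_order all_algebra.
From mathcomp Require Import complex.
From mathcomp Require Import boolp classical_sets functions reals.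
From mathcomp Require Import mpoly.

Set Implicit Arguments.
Unset Strict Implicit.
Unset Printing Implicit Defensive.

Import Order.TTheory GRing.Theory Num.Theory.

Local Open Scope classical_set_scope.
Local Open Scope ring_scope.

Variant scalar_kind := RealScalars | ComplexScalars.

Definition scalars (R : realType) (s : scalar_kind) : fieldType :=
  match s with RealScalars => R | ComplexScalars => R[i] end.

Section VectorFields.
Variables (K : fieldType) (E : vectType K) (n : nat) (e : n.-tuple E).
Implicit Types (P Q : {ffun 'I_n -> {mpoly K[n]}}) (X Y : E -> E).
Implicit Types (V W L : set (E -> E)).

(* The polynomial map sum_j X^j e_j whose j-th component, as a polynomial in
   the coordinates x^1, ..., x^n relative to e, is P j. *)
Definition vfield_of P : E -> E :=
  fun v => \sum_(j < n) (P j).@[fun i => coord e i v] *: e`_j.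

(* Does not depend on the choice of the basis e. *)
Definition Vect : set (E -> E) := [set X | exists P, X = vfield_of P].

(* Homogeneous fields with coefficients of degree p + 1; meant for p >= -1. *)
Definition Vect_deg (p : int) : set (E -> E) :=
  [set X | exists2 P : {ffun 'I_n -> {mpoly K[n]}}, (forall j, P j \is (absz (p + 1)).-homog)
                    & X = vfield_of P].

(* When e is a basis and K is infinite, X in Vect determines its coefficients,
   so that no actual choice is made here; the value is 0 outside Vect. *)
Definition coefs X : {ffun 'I_n -> {mpoly K[n]}} :=
  xget 0 [set P | X = vfield_of P].

Definition bracket X Y : E -> E :=
  vfield_of [ffun k => \sum_(j < n) (coefs X j * (coefs Y k)^`M(j)
                                     - coefs Y j * (coefs X k)^`M(j))].

Definition is_subspace W : Prop :=
  W 0 /\ (forall (a : K) X Y, W X -> W Y -> W (a *: X + Y)).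

Definition is_subalgebra L : Prop :=
  [/\ L `<=` Vect, is_subspace L
    & forall X Y, L X -> L Y -> L (bracket X Y)].

Definition is_maximal L : Prop :=
  forall L', is_subalgebra L' -> L `<=` L' -> L' = L \/ L' = Vect.

Definition component L (p : int) : set (E -> E) := L `&` Vect_deg p.

(* L = L_{-1} + L_0 + ... + L_k, for k >= -1, the summand of index d being
   L_{d-1}. The sum is direct because the spaces Vect_p are independent. *)
Definition is_graded_upto L (k : int) : Prop :=
  L = [set X | exists2 Y : nat -> E -> E,
         (forall d, (d < absz (k + 2)%R)%N -> component L (d%:Z - 1) (Y d))
         & X = \sum_(d < absz (k + 2)%R) Y d].

Definition is_irreducible_rep L0 V : Prop :=
  V <> [set 0] /\
  forall W, is_subspace W -> W `<=` V ->
    (forall X Y, L0 X -> W Y -> W (bracket X Y)) ->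
    W = [set 0] \/ W = V.

(* J is only constrained on V. Linearity is over K: this is the notion of
   complex structure only when K is the field of real numbers. *)
Definition is_complex_structure L0 V (J : (E -> E) -> (E -> E)) : Prop :=
  [/\ forall X, V X -> V (J X),
      forall (a : K) X Y, V X -> V Y -> J (a *: X + Y) = a *: J X + J Y,
      forall X, V X -> J (J X) = - X
    & forall X Y, L0 X -> V Y -> bracket X (J Y) = J (bracket X Y)].

End VectorFields.

(* Main.v *)
(* Let V be the space of constant fields. Over an algebraically closed field, let
   L satisfy (1)-(3) and let W be a subalgebra containing L.
   - The Killing form of a graded W of bounded degree, with Cartan's criterion and
     Engel's theorem, shows that such a W lies in J = V + [V, L_1] + L_1 (theorem
     of Kobayashi and Nagano) and contains the Euler field. Taking W = L, the Euler
     field lies in L; hence every W is graded, and W = L if W is bounded.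
   - An unbounded W contains, for each d, a field x |-> (x xi)^d w with xi, w <> 0.
     Hence its linear part is an irreducible Lie algebra containing the scalars
     and a matrix of rank one. If it is not gl(V), it preserves a nonzero bilinear
     form up to scalars, [V, L_1] preserves the form, and this contradicts the
     presence of the Euler field in J. With gl(V), the torus and the fields above
     give all the x_i^d d_k with i <> k, and a field of nonzero divergence in
     L_1 gives the remaining ones.
   Over the reals, L and W are complexified: in the absence of a complex structure
   the complexification of L is still irreducible.
   Conversely, if a condition fails, L is strictly contained in a proper subalgebra:
   the fields tangent to L_-1; the fields whose derivatives along U
   lie in U, for an invariant subspace U; the projective algebra; the fields
   which are holomorphic for a complex structure. *)

Require Import Defs.
From HB Require Import structures.
From mathcomp Require Import all_boot all_order all_algebra.
From mathcomp Require Import complex ring zify.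
From mathcomp Require Import boolp classical_sets functions reals.
From mathcomp Require Import mpoly spectral.

Set Implicit Arguments.
Unset Strict Implicit.
Unset Printing Implicit Defensive.

Import Order.TTheory GRing.Theory Num.Theory.

Local Open Scope classical_set_scope.
Local Open Scope ring_scope.

(** * Subspaces and generalized eigenvectors *)

(** Over the complex numbers the irreducible linear Lie algebras of infinite type are gl, sl, sp and
    csp, the sum of sp and the scalars. This classification is avoided: in an irreducible algebra a
    rank one matrix which is not nilpotent generates everything, and one of square zero is completed
    to an sl(2)-triple, whose gradation leaves only gl and the algebras inside csp. The scalars
    exclude sl and sp. One device is used twice against what remains. As the Euler field lies in J,
    the identity matrix is a combination of linear fields [v, X] with X quadratic in L; a linear
    condition shared by all of these, zero trace or invariance of a form, would hold for the
    identity. The Euler field is not given as an element of L. It normalizes every graded algebra,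
    hence defines a linear form through the Killing form, and the element representing this form
    differs from it by a constant field only. Algebraic closure enters through the conjugation of
    eigenvalues in Cartan's criterion and through a common eigenvector of commuting matrices. *)

Section Subspaces.
Variables (K : fieldType) (U : lmodType K).
Implicit Types (S G : U -> Prop) (x y : U).

Definition subsp S := S 0 /\ forall (a : K) x y, S x -> S y -> S (a *: x + y).

(** As an intersection of subspaces, the span carries its own induction principle: a linear property
    of a spanned element follows by applying the membership to that property. *)
Definition spn G x := forall S, subsp S -> (forall y, G y -> S y) -> S x.

Section Closure.
Variable S : U -> Prop.
Hypothesis hS : subsp S.

Lemma subsp0 : S 0. Proof. by case: hS. Qed.

Lemma subspD x y : S x -> S y -> S (x + y).
Proof. by case: hS => _ h hx hy; have := h 1 x y hx hy; rewrite scale1r. Qed.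

Lemma subspZ a x : S x -> S (a *: x).
Proof. by case: hS => h0 h hx; have := h a x 0 hx h0; rewrite addr0. Qed.

Lemma subspN x : S x -> S (- x).
Proof. by move=> hx; rewrite -scaleN1r; apply: subspZ. Qed.

Lemma subspB x y : S x -> S y -> S (x - y).
Proof. by move=> hx hy; apply: subspD => //; apply: subspN. Qed.

Lemma subsp_sum (I : Type) (r : seq I) (P : pred I) (F : I -> U) :
  (forall i, P i -> S (F i)) -> S (\sum_(i <- r | P i) F i).
Proof. by move=> h; elim/big_ind: _ => //; [exact: subsp0 | exact: subspD]. Qed.

Lemma subsp_sum_seq (I : eqType) (r : seq I) (F : I -> U) :
  (forall i, i \in r -> S (F i)) -> S (\sum_(i <- r) F i).
Proof. by move=> h; rewrite big_seq; apply: subsp_sum. Qed.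

Lemma subspZE a x : a != 0 -> S (a *: x) -> S x.
Proof.
by move=> a0 hx; rewrite -(scale1r x) -(mulVf a0) -scalerA; apply: subspZ.
Qed.

End Closure.

Lemma spn_subsp G : subsp (spn G).
Proof.
split=> [S hS _|a x y hx hy S hS hG]; first exact: subsp0.
by apply: hS.2; [apply: hx|apply: hy].
Qed.

Lemma spn_sub G x : G x -> spn G x.
Proof. by move=> hx S _; apply. Qed.

Section GeneralizedEigenvectors.
Variables (T : {linear U -> U}) (S : U -> Prop).
Hypotheses (hS : subsp S) (hT : forall x, S x -> S (T x)).

Let D a x := T x - a *: x.

Let D_is_linear a : linear (D a).
Proof.
move=> c x y; rewrite /D linearP !scalerDr scalerN !scalerA (mulrC a c).
by rewrite opprD addrACA.
Qed.

Let DC a b x : D a (D b x) = D b (D a x).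
Proof.
have E c d : D c (D d x) = T (T x) - (c + d) *: T x + (c * d) *: x.
  rewrite /D linearB linearZ /= scalerBr scalerA scalerDl opprB opprD.
  by rewrite -!addrA; congr (_ + _); rewrite [RHS]addrC -addrA.
by rewrite !E addrC [b + a]addrC [b * a]mulrC addrC.
Qed.

Let iterDC a b k x : iter k (D a) (D b x) = D b (iter k (D a) x).
Proof. by elim: k x => //= k IH x; rewrite IH DC. Qed.

Let iterDD a b k l x : iter k (D a) (iter l (D b) x) = iter l (D b) (iter k (D a) x).
Proof. by elim: l x => //= l IH x; rewrite iterDC IH. Qed.

Let iterD0 a k : iter k (D a) 0 = 0.
Proof. by elim: k => //= k ->; rewrite /D linear0 scaler0 subr0. Qed.

Let iterD_sum a k (r : seq K) (z : K -> U) :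
  iter k (D a) (\sum_(b <- r) z b) = \sum_(b <- r) iter k (D a) (z b).
Proof.
elim: r => [|b r IH]; first by rewrite !big_nil iterD0.
rewrite !big_cons -{}IH; elim: k => //= k ->.
by rewrite -[in LHS](scale1r (iter _ _ _)) D_is_linear scale1r.
Qed.

Let S_D a x : S x -> S (D a x).
Proof. by move=> hx; apply: subspB => //; [exact: hT | exact: subspZ]. Qed.

(** Both [D a x] and [D b x] satisfy the hypotheses with a smaller sum of exponents, and their
    difference is [(b - a) *: x]. *)
Let S_coprime a b k l x :
  a != b -> S (iter k (D a) x) -> iter l (D b) x = 0 -> S x.
Proof.
move=> ab; have [N] := ubnP (k + l); elim: N k l x => // N IH [|k] [|l] x //=.
  by move=> _ _ ->; exact: subsp0.
rewrite ltnS addSn addnS => hN hk hl.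
have h1 : S (D a x).
  apply: (IH k l.+1) => //; first by rewrite addnS.
    by rewrite iterDC.
  by rewrite /= iterDC DC hl /D linear0 scaler0 subr0.
have h2 : S (D b x).
  apply: (IH k.+1 l) => //.
    by rewrite /= iterDC DC; apply: S_D.
  by rewrite iterDC.
apply: (@subspZE S hS (b - a)); first by rewrite subr_eq0 eq_sym.
rewrite scalerBl; have := subspB hS h1 h2; rewrite /D opprB.
by rewrite addrC addrA subrK.
Qed.

(** The operator [(T - a)^k] removes the summand of [a]; induction treats the images of the other
    summands, and [S_coprime] recovers these summands from their images. *)
Lemma geigen_comp k (r : seq K) (z : K -> U) : uniq r ->
  (forall a, a \in r -> iter k (fun x => T x - a *: x) (z a) = 0) ->
  S (\sum_(a <- r) z a) -> forall a, a \in r -> S (z a).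
Proof.
elim: r z => // a r IH z /= /andP[ar ur] hz hs.
have h b : b \in r -> S (z b).
  move=> br; apply: (@S_coprime a b k k).
  - by apply: contraNneq ar => ->.
  - apply: (IH (fun b => iter k (D a) (z b))) => // [c cr|].
      by rewrite -/(D c) iterDD hz ?iterD0 // inE cr orbT.
    rewrite -iterD_sum; suff <- : iter k (D a) (\sum_(b <- a :: r) z b)
       = iter k (D a) (\sum_(b0 <- r) z b0).
      by elim: (k) => //= k' ; exact: S_D.
    by rewrite !iterD_sum big_cons hz ?mem_head // add0r.
  - by apply: hz; rewrite inE br orbT.
move=> b; rewrite inE => /predU1P[->|]; last exact: h.
rewrite -(addrK (\sum_(c <- r) z c) (z a)); apply: subspB => //.
  by rewrite big_cons in hs.
by apply: subsp_sum_seq.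
Qed.

Lemma sum_by_value (I : Type) (r : seq I) (lam : I -> K) (z : I -> U) :
  \sum_(i <- r) z i =
  \sum_(a <- undup (map lam r)) \sum_(i <- r | lam i == a) z i.
Proof.
have h i : lam i \in map lam r ->
    \sum_(a <- undup (map lam r) | lam i == a) z i = z i.
  move=> hi; rewrite -big_filter (_ : [seq a <- _ | _] = [:: lam i]) ?big_seq1 //.
  rewrite (eq_filter (a2 := pred1 (lam i))); last by move=> a; rewrite /= eq_sym.
  by rewrite filter_pred1_uniq ?undup_uniq // mem_undup.
rewrite (exchange_big_dep xpredT) //=.
suff gen s : {subset map lam s <= map lam r} -> \sum_(i <- s) z i =
    \sum_(i <- s) \sum_(a <- undup (map lam r) | lam i == a) z i by exact: gen.
elim: s => [|i s IH] hs; first by rewrite !big_nil.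
rewrite !big_cons h ?hs ?mem_head // IH // => a ha; apply: hs.
by rewrite inE ha orbT.
Qed.

(** The values [lam i] may repeat, so the sum is grouped by value before [geigen_comp] applies.
    Conjugation as [c] serves Cartan's criterion; indicator functions as [c] extract the part of a
    given degree or torus weight. *)
Lemma geigen_reweight k (I : eqType) (r : seq I) (lam : I -> K) (z : I -> U)
    (c : K -> K) :
  (forall i, i \in r -> iter k (fun x => T x - lam i *: x) (z i) = 0) ->
  S (\sum_(i <- r) z i) -> S (\sum_(i <- r) c (lam i) *: z i).
Proof.
move=> hz hs; rewrite (sum_by_value _ lam).
rewrite (sum_by_value _ lam) in hs; apply: subsp_sum_seq => // a ha.
have -> : \sum_(i <- r | lam i == a) c (lam i) *: z i =
   c a *: \sum_(i <- r | lam i == a) z i.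
  by rewrite scaler_sumr; apply: eq_bigr => i /eqP ->.
apply: subspZ => //.
apply: (geigen_comp (k := k)) hs a ha; first exact: undup_uniq.
move=> a _; have h : {morph iter k (D a) : x y / x + y}.
  elim: (k) => // j IHj x y /=; rewrite IHj.
  by rewrite -[in LHS](scale1r (iter _ _ x)) D_is_linear scale1r.
rewrite -/(D a) (big_morph _ h (iterD0 a k)) big_seq_cond big1 // => i.
by move=> /andP[ir /eqP <-]; exact: hz.
Qed.

End GeneralizedEigenvectors.
End Subspaces.

(** * Cartan's criterion and Engel's theorem *)

Lemma mulmx_row_eq (K : fieldType) m p (A B : 'M[K]_(m, p)) :
  (forall x : 'rV_m, x *m A = x *m B) -> A = B.
Proof. by move=> h; apply/row_matrixP => i; rewrite !rowE. Qed.

Section MatrixSubspaces.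
Variable K : fieldType.

(** The rows of [B] are an independent family in [S] of greatest length; a vector of [S] outside
    their span would extend it. *)
Lemma subsp_rowspace m (S : 'rV[K]_m -> Prop) : subsp S ->
  exists r (B : 'M[K]_(r, m)), row_free B /\ forall v, S v <-> (v <= B)%MS.
Proof.
move=> hS.
pose P r := `[< exists B : 'M[K]_(r, m), row_free B /\ forall v : 'rV_m, (v <= B)%MS -> S v >].
have P0 : exists r, P r.
  exists 0%N; apply/asboolP; exists 0; split; first by rewrite /row_free mxrank0.
  by move=> v /submx0null ->; exact: subsp0.
have Pm r : P r -> (r <= m)%N.
  by move=> /asboolP[B [/eqP fB _]]; move: (rank_leq_col B); rewrite fB.
case: (ex_maxnP P0 Pm) => r /asboolP[B [fB hB]] hmax.
exists r, B; split=> // v; split=> [hv|]; last exact: hB.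
apply: contrapT => /negP nv.
suff /hmax : P r.+1 by rewrite ltnn.
apply/asboolP; rewrite -addn1; exists (col_mx B v); split.
  rewrite -row_leq_rank -addsmxE.
  have v0 : v != 0 by apply: contraNneq nv => ->; rewrite sub0mx.
  have hcap : \rank (B :&: v)%MS = 0%N.
    apply/eqP; rewrite mxrank_eq0; apply: contraNT nv => h.
    apply: submx_trans (capmxSl B v).
    rewrite -(geq_leqif (mxrank_leqif_sup (capmxSr B v))).
    by rewrite rank_rV v0 lt0n mxrank_eq0.
  by have := mxrank_sum_cap B v; rewrite hcap addn0 (eqP fB) rank_rV v0 => ->.
move=> w; rewrite -addsmxE => /sub_addsmxP[[a b] /= ->].
apply: subspD => //; first by apply: hB; rewrite submxMl.
by rewrite [b]mx11_scalar mul_scalar_mx; apply: subspZ.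
Qed.

End MatrixSubspaces.

Section CartanTrick.

(** These are the Chinese remainder idempotents for the moduli [('X - a%:P) ^+ N], glued from a
    Bezout identity at each new root. Evaluated at a matrix killed by the product, [p a] becomes the
    projection onto a generalized eigenspace. *)
Lemma crt_idempotents (K : fieldType) (s : seq K) N : s != [::] -> uniq s ->
  exists p : K -> {poly K}, \sum_(a <- s) p a = 1 /\
    forall a, a \in s ->
      \prod_(b <- s) ('X - b%:P) ^+ N %| ('X - a%:P) ^+ N * p a.
Proof.
elim: s => // a [|c s] IH _ us.
  exists (fun=> 1); rewrite big_seq1; split=> // b; rewrite inE => /eqP ->.
  by rewrite mulr1 big_seq1.
have /andP[anr ur] := us; have [p [p1 pdvd]] := IH isT ur.
set Q := \prod_(b <- c :: s) _ in pdvd.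
have : coprimep (('X - a%:P) ^+ N) Q.
  rewrite /Q big_seq; elim/big_ind: _ => [|f g hf hg|b hb].
  - exact: coprimep1.
  - by rewrite coprimepMr hf.
  - apply: coprimep_expl; apply: coprimep_expr.
    rewrite coprimep_XsubC rootE hornerXsubC subr_eq0.
    by apply: contraNneq anr => <-.
move=> /Bezout_eq1_coprimepP[[u v] /= uv].
exists (fun b => if b == a then v * Q else u * ('X - a%:P) ^+ N * p b); split.
  rewrite big_cons eqxx; under eq_big_seq => b hb.
    rewrite ifN; last by apply: contraNneq anr => <-.
    over.
  by rewrite -mulr_sumr p1 mulr1 addrC.
move=> b; rewrite big_cons -/Q inE => /orP[/eqP ->|hb].
  by rewrite eqxx mulrCA mulrC dvdp_mulIr.
rewrite ifN; last by apply: contraNneq anr => <-.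
rewrite -(mulrA u) mulrCA (mulrCA _ _ (p b)) mulrCA.
by apply: dvdp_mul => //; apply: dvdp_mull; apply: pdvd.
Qed.

Lemma horner_mx_trig_diag (K : fieldType) n (T : 'M[K]_n.+1) (p : {poly K}) :
  is_trig_mx T -> is_trig_mx (horner_mx T p) /\ forall i, horner_mx T p i i = p.[T i i].
Proof.
move=> /is_trig_mxP hT; elim/poly_ind: p => [|p c [/is_trig_mxP h1 h2]].
  by rewrite rmorph0; split=> [|i]; rewrite ?mx0_is_trig // mxE horner0.
rewrite rmorphD rmorphM /= horner_mx_X horner_mx_C; split.
  apply/is_trig_mxP => i j ij; rewrite !mxE big1 ?add0r => [|l _].
    by rewrite -val_eqE /= ltn_eqF.
  by case: (ltnP i l) => il; [rewrite h1 ?mul0r | rewrite hT ?mulr0 // (leq_ltn_trans il)].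
move=> i; rewrite !mxE eqxx mulr1n hornerMXaddC -h2; congr (_ + _).
rewrite (bigD1 i) //= big1 ?addr0 // => l li.
by case: (ltngtP i l) li => [il|il|/val_inj ->]; rewrite ?eqxx // => _;
  [rewrite h1 ?mul0r | rewrite hT ?mulr0].
Qed.

(** The operator [ad A - (a - b)] is left multiplication by [A - a] minus right multiplication by
    [A - b]. These two commute, so that the exponents of nilpotency add. *)
Lemma iter_ad_nilp (K : fieldType) n (A X : 'M[K]_n.+1) (a b : K) k l :
  (A - a%:M) ^+ k * X = 0 -> X * (A - b%:M) ^+ l = 0 ->
  iter (k + l) (fun m => (mulmx A \- mulmxr A) m - (a - b) *: m) X = 0.
Proof.
have [N] := ubnP (k + l); elim: N k l X => // N IH [|k] [|l] X hN.
- by rewrite expr0 mul1r.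
- rewrite expr0 mul1r => -> _; elim: (_ + _)%N => //= j ->.
  by rewrite !mulmx0 !mul0mx scaler0 !subr0.
- rewrite expr0 mulr1 => _ ->; elim: (_ + _)%N => //= j ->.
  by rewrite !mulmx0 !mul0mx scaler0 !subr0.
move=> h1 h2; rewrite addSn iterSr.
set D := (X in iter _ X _).
have DD : {morph iter (k + l.+1) D : x y / x - y}.
  elim: (k + l.+1)%N => // j IHj x y /=; rewrite IHj /D /=.
  rewrite mulmxBr mulmxBl scalerBr.
  by apply/matrixP => i j'; rewrite !mxE; ring.
rewrite [X in iter _ _ X](_ : _ = (A - a%:M) * X - X * (A - b%:M)); last first.
  rewrite /= mulrBl mulrBr -!mulmxE mul_scalar_mx mul_mx_scalar.
  by rewrite scalerBl; apply/matrixP => i j'; rewrite !mxE; ring.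
rewrite DD IH ?sub0r; first last.
- by rewrite -mulrA h2 mulr0.
- by rewrite mulrA -exprSr.
- by rewrite addSn ltnS in hN.
rewrite -addSnnS IH ?oppr0 //.
- by rewrite addnS ltnS in hN.
- by rewrite mulrA h1 mul0r.
- by rewrite -mulrA -exprS.
Qed.

(* Sb is the sum of the conj(l) p_l(A), with p_l(A) the projection onto the
   generalized eigenspace of l, so that tr(A Sb) is a sum of squared moduli. It
   acts on the generalized ad(A)-eigenspaces through scalars, and g contains the
   components of its elements along these. *)
Lemma cartan_trick (K : numClosedFieldType) n (A : 'M[K]_n.+1) : exists Sb : 'M[K]_n.+1,
  (forall g : 'M[K]_n.+1 -> Prop, subsp g ->
     (forall m, g m -> g (A *m m - m *m A)) -> forall m, g m -> g (Sb *m m - m *m Sb))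
  /\ (\tr (A *m Sb) = 0 -> A ^+ n.+1 = 0).
Proof.
have [P /unitarymx_unit Pun] := Schur A (ltn0Sn n).
rewrite /similar_to /= conjumx //.
set T := _ *m _ *m _ => Ttrig.
have hT p : horner_mx T p = P *m horner_mx A p *m invmx P by rewrite /T horner_mx_uconj.
have hA p : horner_mx T p = 0 -> horner_mx A p = 0.
  rewrite hT => /(congr1 (fun M => invmx P *m M *m P)).
  by rewrite mulmx0 mul0mx -!mulmxA mulVmx // mulmx1 mulKmx.
pose s := undup [seq T i i | i <- enum 'I_n.+1].
have sT i : T i i \in s by rewrite mem_undup; apply/mapP; exists i; rewrite ?mem_enum.
have us : uniq s by exact: undup_uniq.
have s0 : s != [::] by apply: contraTneq (sT ord0) => ->.
have [p [p1 pdvd]] := crt_idempotents n.+1 s0 us.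
pose pi a := horner_mx A (p a).
have pi1 : \sum_(a <- s) pi a = 1 by rewrite -[1](rmorph1 (horner_mx A)) -p1 rmorph_sum.
have char0 : horner_mx A (\prod_(b <- s) ('X - b%:P) ^+ n.+1) = 0.
  apply: hA; have := Cayley_Hamilton T; rewrite char_poly_trig //.
  move=> h; suff /dvdpP[q ->] : \prod_(i < n.+1) ('X - (T i i)%:P) %|
     \prod_(b <- s) ('X - b%:P) ^+ n.+1 by rewrite rmorphM /= h mulr0.
  rewrite prodrXl -[n.+1 in X in _ %| X]card_ord -prodr_const.
  elim/big_rec2: _ => // i f g _ h'; apply: dvdp_mul => //.
  by rewrite (bigD1_seq (T i i)) //= dvdp_mulIl.
have piA a : a \in s -> (A - a%:M) ^+ n.+1 * pi a = 0.
  move=> /pdvd /dvdpP[q hq]; rewrite -(horner_mx_C A) -{1}(horner_mx_X A) -rmorphB.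
  by rewrite -rmorphXn -rmorphM /= hq rmorphM /= char0 mulr0.
have Api a : a \in s -> pi a * (A - a%:M) ^+ n.+1 = 0.
  move=> /pdvd /dvdpP[q hq]; rewrite -(horner_mx_C A) -{1}(horner_mx_X A) -rmorphB.
  by rewrite -rmorphXn -rmorphM /= mulrC hq rmorphM /= char0 mulr0.
exists (\sum_(a <- s) a^* *: pi a); split=> [g hg gA m gm|].
  pose r := [seq (a, b) | a <- s, b <- s].
  pose z (ab : K * K) := pi ab.1 *m m *m pi ab.2.
  have mE : m = \sum_(ab <- r) z ab.
    rewrite big_allpairs /z /=; under eq_bigr do rewrite -mulmx_sumr pi1 mulmx1.
    by rewrite -mulmx_suml pi1 mul1mx.
  rewrite [X in g X](_ : _ = \sum_(ab <- r) (ab.1 - ab.2)^* *: z ab); last first.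
    rewrite big_allpairs /z /=; under [RHS]eq_bigr do
      (under eq_bigr do rewrite rmorphB scalerBl; rewrite sumrB).
    rewrite sumrB; congr (_ - _).
      rewrite mulmx_suml; apply: eq_bigr => a _.
      by rewrite -scaler_sumr -mulmx_sumr pi1 mulmx1 -scalemxAl.
    rewrite exchange_big mulmx_sumr; apply: eq_bigr => b _ /=.
    by rewrite -scaler_sumr -mulmx_suml -mulmx_suml pi1 mul1mx -scalemxAr.
  rewrite mE in gm.
  have := @geigen_reweight _ _ (mulmx A \- mulmxr A) g hg gA (n.+1 + n.+1) _ r
    (fun ab => ab.1 - ab.2) z (fun c => c^*) _ gm; apply.
  move=> [a b] /allpairsP[[a' b'] /= [ha hb [-> ->]]].
  have -> : z (a', b') = pi a' * m * pi b' by [].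
  have h := @iter_ad_nilp K n A (pi a' * m * pi b') a' b' n.+1 n.+1.
  rewrite /=; refine (h _ _); clear h.
    by rewrite !mulrA piA ?mul0r.
  by rewrite -(mulrA (_ * m)) (Api b') ?mulr0.
set Sb := (\sum_(a <- s) _).
have -> : \tr (A *m Sb) = \sum_i `|T i i| ^+ 2.
  (* [Sb] is [q] evaluated at [A], and [q] interpolates the conjugation at the eigenvalues: [p a]
     vanishes at the others, hence equals 1 at [a] by the partition of unity. The trace is then read
     off the triangular form [T]. *)
  pose q := \sum_(a <- s) a^* *: p a.
  have p0 i a : a \in s -> a != T i i -> (p a).[T i i] = 0.
    move=> ha ai; have /dvdpP[f hf] := pdvd a ha.
    have /eqP : (('X - a%:P) ^+ n.+1 * p a).[T i i] = 0.
      rewrite hf (bigD1_seq (T i i)) //= !hornerM horner_exp hornerXsubC subrr.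
      by rewrite expr0n mul0r mulr0.
    rewrite hornerM mulf_eq0 horner_exp hornerXsubC expf_eq0 subr_eq0 eq_sym.
    by rewrite (negPf ai) andbF => /eqP.
  have qT i : q.[T i i] = (T i i)^*.
    have := congr1 (fun f => f.[T i i]) p1.
    rewrite hornerC !horner_sum (bigD1_seq (T i i)) //= big_seq_cond.
    rewrite big1 => [|a /andP[ha ai]]; last exact: p0.
    rewrite addr0 => h; rewrite (bigD1_seq (T i i)) //= hornerZ h mulr1.
    rewrite big_seq_cond big1 ?addr0 // => a /andP[ha ai].
    by rewrite hornerZ p0 ?mulr0.
  have SbE : Sb = horner_mx A q.
    by rewrite /Sb /q rmorph_sum; apply: eq_bigr => a _; rewrite [RHS]horner_mxZ.
  rewrite SbE -{1}(horner_mx_X A) mulmxE -rmorphM /=.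
  rewrite -[RHS](_ : \tr (horner_mx T ('X * q)) = _); last first.
    rewrite /mxtrace; apply: eq_bigr => i _.
    by rewrite (horner_mx_trig_diag _ Ttrig).2 hornerM hornerX qT normCK.
  by rewrite hT mxtrace_mulC mulKmx.
move=> h0; have T0 i : T i i = 0.
  have /eqP := h0; rewrite psumr_eq0 => [/allP /(_ i)|j _]; last exact: exprn_ge0.
  by rewrite mem_index_enum => /(_ isT) /=; rewrite expf_eq0 normr_eq0 => /andP[_ /eqP].
have := Cayley_Hamilton T; rewrite char_poly_trig //.
rewrite (eq_bigr (fun=> 'X)) => [|i _]; last by rewrite T0 subr0.
by rewrite prodr_const card_ord => /hA; rewrite rmorphXn /= horner_mx_X.
Qed.

End CartanTrick.

(** For [c = [r, m]] one has tr(c Sb) = tr(r [m, Sb]), which vanishes because [[m, Sb]] stays in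
    [g]. The condition is linear in [c], so it passes to [A], and then tr(A Sb) = 0 forces the
    nilpotency. *)
Lemma cartan_nilpotent (K : numClosedFieldType) n (g R : 'M[K]_n.+1 -> Prop) :
  subsp g -> (forall a b, g a -> g b -> g (a *m b - b *m a)) ->
  (forall r, R r -> g r) -> (forall r b, R r -> g b -> \tr (r *m b) = 0) ->
  forall A, spn (fun c => exists r m, [/\ R r, g m & c = r *m m - m *m r]) A ->
  A ^+ n.+1 = 0.
Proof.
move=> hg gbr Rg trRg A hA.
have gA : g A by apply: hA => // c [r [m [hr hm ->]]]; apply: gbr => //; exact: Rg.
have [Sb [hSb]] := cartan_trick A; apply.
apply: (hA (fun c => \tr (c *m Sb) = 0)).
  split=> [|c x y hx hy]; first by rewrite mul0mx linear0.
  by rewrite mulmxDl -scalemxAl linearD linearZ /= hx hy mulr0 addr0.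
move=> c [r [m [hr hm ->]]].
have h := hSb g hg (fun m gm => gbr A m gA gm) m hm.
rewrite mulmxBl linearB /= -!mulmxA [X in _ - X]mxtrace_mulC -!mulmxA.
by rewrite -linearB -mulmxBr /= -opprB mulmxN linearN /= trRg ?oppr0.
Qed.

Section Engel.
Variables (K : fieldType) (n : nat).
Implicit Types (s : 'M[K]_n.+1 -> Prop) (v : 'rV[K]_n.+1) (t : seq 'M[K]_n.+1).

Let mprod t : 'M[K]_n.+1 := foldr mulmx 1%:M t.
Let inside s t := forall a : 'M[K]_n.+1, a \in t -> s a.
Let nilprod s k := forall t, size t = k -> inside s t -> mprod t = 0.
(* Engel's theorem is proved on the filtration of the row space by the vectors
   killed by all products of i elements of s. *)
Let kill s i v := forall t, size t = i -> inside s t -> v *m mprod t = 0.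

Let mulprod_cons m (v : 'M[K]_(m, n.+1)) (a : 'M[K]_n.+1) t : v *m mprod (a :: t) = v *m a *m mprod t.
Proof. by rewrite mulmxA. Qed.

Let mulprod_cat m (v : 'M[K]_(m, n.+1)) t u : v *m mprod (t ++ u) =
  v *m mprod t *m mprod u.
Proof. by rewrite -mulmxA; congr (_ *m _); elim: t => [|a t IH] /=; rewrite ?mul1mx // IH mulmxA. Qed.

Let prod_rcons t (a : 'M[K]_n.+1) : mprod (rcons t a) = (mprod t) *m a.
Proof. by elim: t => [|b t IH] /=; rewrite ?mulmx1 ?mul1mx // IH mulmxA. Qed.

Let inside_cons s a t : inside s (a :: t) <-> s a /\ inside s t.
Proof.
split=> [h|[ha h] b]; last by rewrite inE => /predU1P[->|/h].
by split=> [|b hb]; apply: h; rewrite inE ?eqxx ?hb ?orbT.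
Qed.

Let kill0 s v : kill s 0 v -> v = 0.
Proof. by move=> /(_ [::] erefl); rewrite mulmx1; apply. Qed.

Let killD s i u v : kill s i u -> kill s i v -> kill s i (u + v).
Proof. by move=> hu hv t st it; rewrite mulmxDl hu ?hv ?addr0. Qed.

Let killZ s i c v : kill s i v -> kill s i (c *: v).
Proof. by move=> hv t st it; rewrite -scalemxAl hv ?scaler0. Qed.

Let kill_mul s i v a : s a -> kill s i.+1 v -> kill s i (v *m a).
Proof.
move=> sa hv t st it; have := hv (a :: t); rewrite mulprod_cons.
by apply; rewrite /= ?st //; apply/inside_cons.
Qed.

Let killS s i v : kill s i v -> kill s i.+1 v.
Proof.
move=> hv t; case/lastP: t => // t a; rewrite size_rcons => -[st] it.
rewrite prod_rcons mulmxA hv ?mul0mx // => b bt.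
by apply: it; rewrite mem_rcons inE bt orbT.
Qed.

Let kill_nilprod s k v : nilprod s k -> kill s k v.
Proof. by move=> h t st it; rewrite h ?mulmx0. Qed.

Let kill_common s k v : v != 0 -> kill s k v ->
  exists2 w : 'rV_n.+1, w != 0 & forall a, s a -> w *m a = 0.
Proof.
elim: k v => [|k IH] v v0 hv; first by move/kill0: hv v0 => ->; rewrite eqxx.
have [h|/existsNP[a /not_implyP[sa /eqP va]]] := pselect (forall a, s a -> v *m a = 0).
  by exists v.
by apply: (IH (v *m a)) => //; apply: kill_mul.
Qed.

Section Extend.
Variables (s : 'M[K]_n.+1 -> Prop) (x : 'M[K]_n.+1) (k M : nat).
Hypotheses (sx : forall a, s a -> s (x *m a - a *m x)).
Hypotheses (hk : nilprod s k) (xM : x ^+ M = 0).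

Let s' (m : 'M[K]_n.+1) := exists c, s (m - c *: x).

(** Moving [x] to the right past a letter of [s] costs a commutator, which lies in [s] again. *)
Let kill_x i v : kill s i v -> kill s i (v *m x).
Proof.
elim: i v => [|i IH] v hv; first by rewrite (kill0 hv) mul0mx => t _ _; rewrite mul0mx.
move=> [//|a t] [st] /inside_cons[sa it]; rewrite mulprod_cons.
rewrite -(mulmxA v) -(subrK (a *m x) (x *m a)) mulmxDr mulmxDl.
rewrite (kill_mul (sx sa) hv) // add0r mulmxA.
by apply: (IH (v *m a)); first exact: kill_mul.
Qed.

Let kill_s' i v m : s' m -> kill s i v -> kill s i (v *m m).
Proof.
move=> [c sm] hv; rewrite -(subrK (c *: x) m) mulmxDr -scalemxAr; apply: killD.
  case: i hv => [/kill0 ->|i hv]; first by rewrite mul0mx => t _ _; rewrite mul0mx.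
  by apply: killS; apply: kill_mul.
by apply: killZ; apply: kill_x.
Qed.

(** Elements of [s] act by zero on the quotient of consecutive steps of the filtration; a word in
    [s'] therefore acts there as a multiple of a power of [x]. *)
Let kill_word i v t : inside s' t -> kill s i.+1 v ->
  exists c, kill s i (v *m mprod t - c *: (v *m x ^+ size t)).
Proof.
elim: t v => [|m t IH] v it hv.
  by exists 1; rewrite expr0 scale1r subrr => t _ _; rewrite mul0mx.
have /inside_cons[[c sm] it'] := it.
have [d hd] := IH (v *m x) it' (kill_x hv).
exists (c * d); rewrite mulprod_cons /= exprS -mulmxE mulmxA.
have -> : v *m m = v *m (m - c *: x) + c *: (v *m x).
  by rewrite mulmxBr -scalemxAr subrK.
rewrite mulmxDl -addrA; apply: killD.
  have := kill_mul sm hv; move: (v *m _) => u.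
  elim: t it' {hd it IH} u => [|b t IH] /= it' u hu; first by rewrite mulmx1.
  have /inside_cons[sb it''] := it'.
  rewrite mulprod_cons; apply: IH => //; exact: kill_s'.
by rewrite -scalemxAl -scalerA -scalerBr; apply: killZ.
Qed.

(** Since [x ^+ M = 0], each block of [M] letters lowers the filtration by one step. *)
Lemma nilprod_extend : nilprod (fun m => exists c, s (m - c *: x)) (k * M).
Proof.
rewrite -/s'; suff h i v t : kill s i v -> size t = (i * M)%N -> inside s' t -> v *m mprod t = 0.
  move=> t st it; apply/row_matrixP => i; rewrite row0 rowE.
  exact: (h k _ t (kill_nilprod _ hk)).
elim: i v t => [|i IH] v t hv st it; first by rewrite (kill0 hv) mul0mx.
rewrite -(cat_take_drop M t) mulprod_cat.
have sz : size (take M t) = M by rewrite size_takel // st mulSn leq_addr.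
apply: IH; last by move=> a /mem_drop; exact: it.
  have [c] := @kill_word i v (take M t) (fun a ha => it a (mem_take ha)) hv.
  by rewrite sz xM mulmx0 scaler0 subr0.
by rewrite size_drop st mulSn addKn.
Qed.

End Extend.

(** Iterated commutators of [x] with elements of [s] vanish in the end. Before that, some commutator
    lies outside [s] while all of its brackets with [s] lie inside. *)
Lemma normalizer_step (s : 'M[K]_n.+1 -> Prop) (h : 'M[K]_n.+1 -> Prop) k (x : 'M[K]_n.+1) :
  (forall t, size t = k -> inside s t -> mprod t = 0) ->
  subsp s -> (forall a, s a -> h a) -> (forall a b, h a -> h b -> h (a *m b - b *m a)) ->
  h x -> ~ s x ->
  exists y, [/\ h y, ~ s y & forall a, s a -> s (y *m a - a *m y)].
Proof.
move=> hk hs sh hbr hx sx; apply: contrapT => /forallNP hN.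
(* A [j]-fold commutator expands into products having [j] letters of [s] distributed on both sides
   of [x]. With [k + k] letters in all, one side has at least [k] of them and vanishes. *)
pose Z j (y : 'M[K]_n.+1) := forall t u, (k + k <= size t + size u + j)%N ->
  inside s t -> inside s u -> mprod t *m y *m mprod u = 0.
have long t : (k <= size t)%N -> inside s t -> mprod t = 0.
  move=> kt it; rewrite -(mul1mx (mprod _)) -(cat_take_drop k t) mulprod_cat mul1mx hk ?mul0mx ?size_takel //.
  by move=> a /mem_take; exact: it.
have Z0 : Z 0%N x.
  move=> t u; rewrite addn0 => tu it iu; case: (leqP k (size t)) => kt.
    by rewrite long // !mul0mx.
  rewrite (long u) ?mulmx0 //; rewrite -(leq_add2l k); apply: leq_trans tu _.
  by rewrite leq_add2r ltnW.
have ZS j y a : s a -> Z j y -> Z j.+1 (y *m a - a *m y).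
  move=> sa hZ t u tu it iu; rewrite mulmxBr mulmxBl.
  have -> : mprod t *m (y *m a) *m mprod u =
     mprod t *m y *m mprod (a :: u).
    by rewrite mulprod_cons !mulmxA.
  have -> : mprod t *m (a *m y) *m mprod u =
     mprod (rcons t a) *m y *m mprod u.
    by rewrite prod_rcons !mulmxA.
  rewrite !hZ ?subrr //.
  - by rewrite size_rcons !addSn -addnS.
  - by move=> b; rewrite mem_rcons inE => /predU1P[->|/it].
  - by rewrite /= addnS addSn -addnS.
  - by apply/inside_cons.
have : forall j, exists y, [/\ h y, ~ s y & Z j y].
  elim=> [|j [y [hy sy Zy]]]; first by exists x.
  have : ~ forall a, s a -> s (y *m a - a *m y) by move=> H; apply: (hN y).
  move=> /existsNP[a /not_implyP[sa nsa]]; exists (y *m a - a *m y); split=> //.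
    by apply: hbr => //; exact: sh.
  exact: ZS.
move=> /(_ (k + k)%N)[y [_ sy /(_ [::] [::])]]; rewrite mul1mx mulmx1.
move=> y0; apply: sy; rewrite y0 //; exact: subsp0.
Qed.

(** A subalgebra [s] of greatest dimension among those in [h] with vanishing long products is all of
    [h]: an element given by [normalizer_step] would enlarge it. A vector killed by [s] is then the
    last nonzero one along a chain of products. *)
Theorem engel (h : 'M[K]_n.+1 -> Prop) :
  subsp h -> (forall a b, h a -> h b -> h (a *m b - b *m a)) ->
  (forall a, h a -> exists k, a ^+ k = 0) ->
  exists2 v : 'rV[K]_n.+1, v != 0 & forall a, h a -> v *m a = 0.
Proof.
move=> hh hbr hnil.
pose Q r := `[< exists (s : 'M[K]_n.+1 -> Prop) k (B : 'M[K]_(r, n.+1 * n.+1)),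
  [/\ subsp s, forall a, s a -> h a, forall a b, s a -> s b -> s (a *m b - b *m a),
      forall t, size t = k -> inside s t -> mprod t = 0 &
      row_free B /\ forall m, s m <-> (mxvec m <= B)%MS] >].
have Q0 : exists r, Q r.
  exists 0%N; apply/asboolP; exists (fun m => m = 0), 1%N, 0; split=> //.
  - by split=> // a x y -> ->; rewrite scaler0 addr0.
  - by move=> a ->; exact: subsp0.
  - by move=> a b -> ->; rewrite mul0mx subrr.
  - move=> [|a [|]] // _ it; rewrite /= mulmx1; exact/it/mem_head.
  split; first by rewrite /row_free mxrank0.
  by move=> m; split=> [->|/submx0null /eqP]; rewrite ?linear0 ?sub0mx // mxvec_eq0 => /eqP.
have Qb r : Q r -> (r <= n.+1 * n.+1)%N.
  by move=> /asboolP[s [k [B [_ _ _ _ [/eqP fB _]]]]]; move: (rank_leq_col B); rewrite fB.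
case: (ex_maxnP Q0 Qb) => r /asboolP[s [k [B [hs sh sbr hk [fB hB]]]]] hmax.
have [v0 v00] : exists v : 'rV[K]_n.+1, v != 0.
  exists (const_mx 1); apply/negP => /eqP /matrixP /(_ 0 0) /eqP.
  by rewrite !mxE oner_eq0.
have [v vn0 hv] := kill_common v00 (kill_nilprod v0 hk).
have [hsub|/existsNP[x /not_implyP[hx sx]]] := pselect (forall a, h a -> s a).
  by exists v => // a /hsub; exact: hv.
have [y [hy sy ysn]] := normalizer_step hk hs sh hbr hx sx.
have [M yM] := hnil y hy.
have hk' := nilprod_extend ysn hk yM.
pose s' m := exists c, s (m - c *: y).
have hs' : subsp s'.
  split=> [|c a b [ca ha] [cb hb]]; first by exists 0; rewrite scale0r subr0; apply: subsp0.
  exists (c * ca + cb); have := subspD hs (subspZ hs c ha) hb.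
  by rewrite scalerBr scalerA scalerDl opprD addrACA.
have ss' a : s a -> s' a by move=> sa; exists 0; rewrite scale0r subr0.
have sy' : s' y by exists 1; rewrite scale1r subrr; apply: subsp0.
have hs'v : subsp (fun w => s' (vec_mx w)).
  split=> [|c a b ha hb]; rewrite ?linear0 ?linearP; first exact: subsp0.
  by apply: hs'.2.
have [r' [B' [fB' hB']]] := subsp_rowspace hs'v.
have hB'' m : s' m <-> (mxvec m <= B')%MS by rewrite -hB' mxvecK.
have /hmax : Q r'.
  apply/asboolP; exists s', (k * M)%N, B'; split=> //.
  - move=> a [c /sh ha]; rewrite -(subrK (c *: y) a).
    by apply: subspD => //; apply: subspZ.
  - move=> a b [c sa] [d sb]; apply: ss'.
    have -> : a *m b - b *m a = ((a - c *: y) *m (b - d *: y) - (b - d *: y) *m (a - c *: y))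
        + c *: (y *m (b - d *: y) - (b - d *: y) *m y)
        - d *: (y *m (a - c *: y) - (a - c *: y) *m y).
      rewrite !mulmxBr !mulmxBl -!scalemxAr -!scalemxAl !scalerBr !scalerA (mulrC d c).
      by apply/matrixP => i j; rewrite !mxE; ring.
    apply: subspB => //; last by apply: subspZ => //; apply: ysn.
    by apply: subspD => //; [exact: sbr | apply: subspZ => //; apply: ysn].
have : (\rank B < \rank B')%N.
  apply: rank_ltmx; rewrite ltmxE; apply/andP; split.
    apply/row_subP => i; rewrite -[row i B]vec_mxK -hB''; apply: ss'.
    by apply/hB; rewrite vec_mxK row_sub.
  apply/negP => h1; apply: sy; apply/hB; apply: submx_trans h1.
  by rewrite -hB''.
by rewrite (eqP fB) (eqP fB') ltnNge => /negP.
Qed.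

End Engel.

(** * Irreducible Lie algebras of matrices containing a rank one matrix *)

Section RankOne.
Variables (K : numFieldType) (n' : nat).
Local Notation n := n'.+1.
Implicit Types (x y a b u w : 'rV[K]_n) (al be ga xi eta : 'cV[K]_n) (A B : 'M[K]_n).

(** Row vectors are points and column vectors are linear forms; [op al x] is the endomorphism
    sending [y] to [dot y al *: x]. *)
Definition op al x : 'M[K]_n := al *m x.
Definition dot x al : K := (x *m al) 0 0.

Lemma opE al x i j : op al x i j = al i 0 * x 0 j.
Proof. by rewrite mxE big_ord1. Qed.

Lemma opDl al be x : op (al + be) x = op al x + op be x.
Proof. exact: mulmxDl. Qed.
Lemma opDr al x y : op al (x + y) = op al x + op al y.
Proof. exact: mulmxDr. Qed.
Lemma opZl c al x : op (c *: al) x = c *: op al x.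
Proof. by rewrite /op -scalemxAl. Qed.
Lemma opZr c al x : op al (c *: x) = c *: op al x.
Proof. by rewrite /op -scalemxAr. Qed.
Lemma opNl al x : op (- al) x = - op al x.
Proof. exact: mulNmx. Qed.
Lemma opNr al x : op al (- x) = - op al x.
Proof. exact: mulmxN. Qed.
Lemma op0l x : op 0 x = 0. Proof. exact: mul0mx. Qed.
Lemma op0r al : op al 0 = 0. Proof. exact: mulmx0. Qed.

Lemma dotDl x y al : dot (x + y) al = dot x al + dot y al.
Proof. by rewrite /dot mulmxDl mxE. Qed.
Lemma dotDr x al be : dot x (al + be) = dot x al + dot x be.
Proof. by rewrite /dot mulmxDr mxE. Qed.
Lemma dotZl c x al : dot (c *: x) al = c * dot x al.
Proof. by rewrite /dot -scalemxAl mxE. Qed.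
Lemma dotZr c x al : dot x (c *: al) = c * dot x al.
Proof. by rewrite /dot -scalemxAr mxE. Qed.
Lemma dotNl x al : dot (- x) al = - dot x al.
Proof. by rewrite /dot mulNmx mxE. Qed.
Lemma dotNr x al : dot x (- al) = - dot x al.
Proof. by rewrite /dot mulmxN mxE. Qed.
Lemma dot0l al : dot 0 al = 0. Proof. by rewrite /dot mul0mx mxE. Qed.
Lemma dot0r x : dot x 0 = 0. Proof. by rewrite /dot mulmx0 mxE. Qed.
Lemma dotA x A al : dot (x *m A) al = dot x (A *m al).
Proof. by rewrite /dot mulmxA. Qed.
Lemma dot_tr x al : dot al^T x^T = dot x al.
Proof. by rewrite /dot -trmx_mul mxE. Qed.
Lemma op_tr al x : (op al x)^T = op x^T al^T.
Proof. exact: trmx_mul. Qed.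

Lemma op_op al x be y : op al x *m op be y = dot x be *: op al y.
Proof.
rewrite /op mulmxA -(mulmxA al) [x *m be]mx11_scalar mul_mx_scalar.
by rewrite -scalemxAl.
Qed.
Lemma row_op x al y : x *m op al y = dot x al *: y.
Proof. by rewrite /op mulmxA [x *m al]mx11_scalar mul_scalar_mx. Qed.
Lemma op_col al y be : op al y *m be = dot y be *: al.
Proof. by rewrite /op -mulmxA [y *m be]mx11_scalar mul_mx_scalar. Qed.
Lemma op_mx al x A : op al x *m A = op al (x *m A).
Proof. by rewrite /op mulmxA. Qed.
Lemma mx_op A al x : A *m op al x = op (A *m al) x.
Proof. by rewrite /op mulmxA. Qed.

Lemma dot_neq0 x : x != 0 -> exists al, dot x al != 0.
Proof.
move=> /rV0Pn[i hi]; exists (delta_mx i 0).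
by rewrite /dot -colE mxE.
Qed.

Lemma dot_neq0r al : al != 0 -> exists x, dot x al != 0.
Proof.
move=> al0; have [|be] := @dot_neq0 al^T; first by rewrite trmx_eq0.
by exists be^T; rewrite -dot_tr trmxK.
Qed.

Lemma mx_sum_op A B : A *m B = \sum_i op (col i A) (row i B).
Proof.
apply/matrixP => i j; rewrite summxE mxE; apply: eq_bigr => k _.
by rewrite opE !mxE.
Qed.

Definition mxirr (M : 'M[K]_n -> Prop) := forall U : 'rV[K]_n -> Prop,
  subsp U -> (forall A v, M A -> U v -> U (v *m A)) ->
  (exists2 v, U v & v != 0) -> forall v, U v.

Definition mxlie (M : 'M[K]_n -> Prop) :=
  subsp M /\ forall A B, M A -> M B -> M (A *m B - B *m A).

Definition mxtr_set (M : 'M[K]_n -> Prop) := fun A : 'M[K]_n => M A^T.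

Lemma mxlie_tr M : mxlie M -> mxlie (mxtr_set M).
Proof.
move=> [hM hbr]; split; first split=> [|a x y]; rewrite /mxtr_set ?linear0 ?linearP.
- exact: subsp0.
- exact: hM.2.
- move=> A B hA hB; rewrite linearB /= !trmx_mul -opprB; apply: subspN => //.
  exact: hbr.
Qed.

(** The orthogonal of a subspace stable under the transposes is stable under [M]. It is not
    everything, because the subspace contains [v != 0]; so it is zero, and the subspace is full. *)
Lemma mxirr_tr M : mxirr M -> mxirr (mxtr_set M).
Proof.
move=> irrM U hU UM [v Uv v0].
have [r [B [fB hB]]] := subsp_rowspace hU.
have UM' A x : M A -> U x -> U (x *m A^T) by move=> hA; apply: UM; rewrite /mxtr_set trmxK.
pose W x := x *m B^T = 0.
have hW : subsp W.
  by split=> [|a x y hx hy]; rewrite /W ?mul0mx // mulmxDl -scalemxAl hx hy scaler0 addr0.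
have WM A x : M A -> W x -> W (x *m A).
  move=> hA hx; rewrite /W; have /submxP[D hD] : (B *m A^T <= B)%MS.
    apply/row_subP => i; rewrite row_mul; apply/hB; apply: UM' => //.
    by apply/hB; exact: row_sub.
  rewrite -mulmxA -[A]trmxK -trmx_mul hD trmx_mul mulmxA hx mul0mx //.
have : kermx B^T == 0.
  apply: contraT => /rowV0Pn[x /sub_kermxP hx x0].
  have hall := irrM W hW WM (ex_intro2 _ _ x hx x0).
  have B0 : B^T = 0.
    by apply/row_matrixP => i; rewrite rowE row0; exact: hall.
  move: Uv => /hB; rewrite -[B]trmxK B0 trmx0 => /submx0null v0'.
  by rewrite v0' eqxx in v0.
rewrite kermx_eq0 => h x; apply/hB; apply: submx_full.
by rewrite /row_full -mxrank_tr.
Qed.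

Section Irreducible.
Variable M : 'M[K]_n -> Prop.
Hypotheses (hM : mxlie M) (irrM : mxirr M).

(** The vectors killed by [I] form an [M]-stable subspace because [I] is an ideal, and Engel's
    theorem makes it nonzero. *)
Lemma nil_ideal_eq0 (I : 'M[K]_n -> Prop) : subsp I -> (forall A, I A -> M A) ->
  (forall A B, I A -> M B -> I (A *m B - B *m A)) ->
  (forall A, I A -> exists k, A ^+ k = 0) -> forall A, I A -> A = 0.
Proof.
move=> hI IM Iid Inil.
have [v v0 hv] := engel hI (fun A B hA hB => Iid A B hA (IM B hB)) Inil.
pose U x := forall A, I A -> x *m A = 0.
have hU : subsp U.
  split=> [A _|a x y hx hy A IA]; first by rewrite mul0mx.
  by rewrite mulmxDl -scalemxAl hx ?hy // scaler0 addr0.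
have UM A x : M A -> U x -> U (x *m A).
  move=> hA hx B IB; have := hx _ (Iid _ _ IB hA).
  by rewrite mulmxBr !mulmxA (hx B) // mul0mx sub0r => /eqP; rewrite oppr_eq0 => /eqP.
have h := irrM hU UM (ex_intro2 _ _ v hv v0).
move=> A IA; apply/row_matrixP => i; rewrite rowE row0; exact: h.
Qed.

(** The [x] with [op xi x] in [M] are shown to form an [M]-stable subspace. For the idempotent
    [p = op xi w], ad p has eigenvalues 1, 0, -1 and its square plus or minus itself is twice a
    projection, so that [M] contains the three components of each of its elements. *)
Lemma rank_one_idem_row xi w x : M (op xi w) -> dot w xi = 1 -> M (op xi x).
Proof.
have [sM bM] := hM.
move=> Mp wxi; move: x; apply: irrM.
- split=> [|c a b ha hb]; first by rewrite op0r; exact: subsp0.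
  by rewrite opDr opZr; apply: sM.2.
- move=> A x hA hx.
  have M1 := bM _ _ Mp hA; have M2 := bM _ _ Mp M1.
  have two : (2 : K) != 0 by rewrite pnatr_eq0.
  have e1 : M (op xi (w *m A) - dot (w *m A) xi *: op xi w).
    apply: (subspZE sM two).
    suff -> : 2 *: (op xi (w *m A) - dot (w *m A) xi *: op xi w) =
      (op xi w *m (op xi w *m A - A *m op xi w) - (op xi w *m A - A *m op xi w) *m op xi w) +
      (op xi w *m A - A *m op xi w) by exact: subspD.
    rewrite !mulmxBr !mulmxBl !(op_op, row_op, op_col, op_mx, mx_op) ?(opZl, opZr) !dotA !wxi.
    rewrite !scale1r; apply/matrixP => i j; rewrite !mxE; ring.
  have e2 : M (op (A *m xi) w - dot (w *m A) xi *: op xi w).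
    apply: (subspZE sM two).
    suff -> : 2 *: (op (A *m xi) w - dot (w *m A) xi *: op xi w) =
      (op xi w *m (op xi w *m A - A *m op xi w) - (op xi w *m A - A *m op xi w) *m op xi w) -
      (op xi w *m A - A *m op xi w) by exact: subspB.
    rewrite !mulmxBr !mulmxBl !(op_op, row_op, op_col, op_mx, mx_op) ?(opZl, opZr) !dotA !wxi.
    rewrite !scale1r; apply/matrixP => i j; rewrite !mxE; ring.
  (* The component of [A] commuting with the idempotent. Its bracket with [op xi a], where [a] is
     killed by [xi], produces [op xi (a *m A)] up to terms already in [M]. *)
  pose A0 := A - (op xi (w *m A) - dot (w *m A) xi *: op xi w)
     - (op (A *m xi) w - dot (w *m A) xi *: op xi w).
  have MA0 : M A0 by do 2!apply: subspB => //.
  pose a := x - dot x xi *: w.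
  have Ma : M (op xi a).
    by rewrite /a opDr opNr opZr; apply: subspB => //; apply: subspZ.
  have axi : dot a xi = 0 by rewrite /a dotDl dotNl dotZl wxi mulr1 subrr.
  have xE : x = a + dot x xi *: w by rewrite /a subrK.
  move: a axi xE Ma => a axi xE Ma.
  have e3 := bM _ _ Ma MA0.
  have e3' : op xi a *m A0 - A0 *m op xi a =
     op xi (a *m A) - dot (a *m A) xi *: op xi w - dot (w *m A) xi *: op xi a.
    rewrite /A0 !mulmxBr !mulmxBl -!scalemxAr -!scalemxAl.
    rewrite !(op_op, row_op, op_col, op_mx, mx_op) ?(opZl, opZr) !dotA !wxi !axi.
    by apply/matrixP => i j; rewrite !mxE; ring.
  rewrite e3' in e3.
  have -> : op xi (x *m A) = (op xi (a *m A) - dot (a *m A) xi *: op xi w - dot (w *m A) xi *: op xi a)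
     + dot (a *m A) xi *: op xi w + dot (w *m A) xi *: op xi a
     + dot x xi *: (op xi (w *m A) - dot (w *m A) xi *: op xi w)
     + (dot x xi * dot (w *m A) xi) *: op xi w.
    rewrite {1}xE mulmxDl -scalemxAl opDr opZr.
    by apply/matrixP => i j; rewrite !mxE; ring.
  by do !apply: subspD => //; apply: subspZ.
- exists w => //; apply: contraTneq (oner_neq0 K) => w0.
  by rewrite -wxi w0 dot0l eqxx.
Qed.

End Irreducible.

(** Transposition turns [rank_one_idem_row] into the same statement for columns; the brackets of
    both families yield every matrix of rank one. *)
Lemma rank_one_idem_full M xi w : mxlie M -> mxirr M ->
  M (op xi w) -> dot w xi != 0 -> forall A, M A.
Proof.
move=> hM irrM; have [sM bM] := hM.
wlog wxi : w / dot w xi = 1 => [H|].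
  move=> Mp d0; apply: (H ((dot w xi)^-1 *: w)).
  - by rewrite dotZl mulVf.
  - by rewrite opZr; apply: subspZ.
  - by rewrite dotZl mulVf ?oner_neq0.
move=> Mp _.
have Mr x : M (op xi x) by apply: (@rank_one_idem_row M hM irrM xi w).
have Ml al : M (op al w).
  have := @rank_one_idem_row _ (mxlie_tr hM) (mxirr_tr irrM) w^T xi^T al^T.
  by rewrite /mxtr_set !op_tr !trmxK dot_tr; apply.
have Mo al x : M (op al x).
  rewrite (_ : op al x = (op al w *m op xi x - op xi x *m op al w) + dot x al *: op xi w).
    by apply: subspD => //; [apply: bM | apply: subspZ].
  by rewrite !op_op wxi scale1r subrK.
by move=> A; rewrite -[A]mulmx1 mx_sum_op; apply: subsp_sum.
Qed.

End RankOne.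

(** * Rank one matrices of square zero and invariant alternating forms *)

Section Transvections.
Variables (K : numFieldType) (n' : nat).
Local Notation n := n'.+1.
Implicit Types (x y a b : 'rV[K]_n) (al be ga : 'cV[K]_n) (A B : 'M[K]_n).

Section Weights.
Variables (M : 'M[K]_n -> Prop) (w u : 'rV[K]_n) (xi eta : 'cV[K]_n).
Hypotheses (hM : mxlie M) (irrM : mxirr M) (M1 : M 1%:M).
Hypotheses (wxi : dot w xi = 0) (weta : dot w eta = 1) (uxi : dot u xi = 1)
  (ueta : dot u eta = 0).

(* H = op eta w - op xi u is semisimple with eigenvalues 1, 0, -1; mid projects
   onto its kernel, and wt2, wt1, wt0, wtN1, wtN2 are the components of a matrix
   along the eigenspaces of ad H. *)
Definition mid : 'M[K]_n := locked (1%:M - op eta w - op xi u).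

Lemma mid_xi : mid *m xi = 0.
Proof. by rewrite /mid -lock !mulmxBl mul1mx !op_col wxi uxi scale0r scale1r subr0 subrr. Qed.
Lemma mid_eta : mid *m eta = 0.
Proof. by rewrite /mid -lock !mulmxBl mul1mx !op_col weta ueta scale0r scale1r subrr subr0. Qed.
Lemma w_mid : w *m mid = 0.
Proof. by rewrite /mid -lock !mulmxBr mulmx1 !row_op weta wxi scale0r scale1r subrr subr0. Qed.
Lemma u_mid : u *m mid = 0.
Proof. by rewrite /mid -lock !mulmxBr mulmx1 !row_op ueta uxi scale0r scale1r subr0 subrr. Qed.
Lemma row_mid x : x *m mid = x - dot x eta *: w - dot x xi *: u.
Proof. by rewrite /mid -lock !mulmxBr mulmx1 !row_op. Qed.
Lemma col_mid al : mid *m al = al - dot w al *: eta - dot u al *: xi.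
Proof. by rewrite /mid -lock !mulmxBl mul1mx !op_col. Qed.
Lemma dot_mid_xi x : dot (x *m mid) xi = 0.
Proof. by rewrite dotA mid_xi dot0r. Qed.
Lemma dot_mid_eta x : dot (x *m mid) eta = 0.
Proof. by rewrite dotA mid_eta dot0r. Qed.
Lemma dot_w_mid al : dot w (mid *m al) = 0.
Proof. by rewrite -dotA w_mid dot0l. Qed.
Lemma dot_u_mid al : dot u (mid *m al) = 0.
Proof. by rewrite -dotA u_mid dot0l. Qed.

Definition wt1 A := op eta (w *m A *m mid) + op (mid *m (A *m xi)) u.
Definition wtN1 A := op xi (u *m A *m mid) + op (mid *m (A *m eta)) w.
Definition wt2 A := dot w (A *m xi) *: op eta u.
Definition wtN2 A := dot u (A *m eta) *: op xi w.
Definition wt0 A := A - wt1 A - wtN1 A - wt2 A - wtN2 A.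

Lemma weight_components A : M (op eta w - op xi u) -> M A ->
  [/\ M (wt2 A), M (wt1 A), M (wt0 A), M (wtN1 A) & M (wtN2 A)].
Proof.
set H := op eta w - op xi u; move=> elt hA.
pose r : seq K := [:: 2; 1; 0; -1; -2].
pose z (c : K) := if c == 2 then wt2 A else if c == 1 then wt1 A else
  if c == 0 then wt0 A else if c == -1 then wtN1 A else wtN2 A.
have d21 : (2 == 1 :> K) = false by rewrite (eqr_nat K 2 1).
have d20 : (2 == 0 :> K) = false by rewrite pnatr_eq0.
have d10 : (1 == 0 :> K) = false by rewrite oner_eq0.
have pn (c d : K) : 0 < c -> 0 < d -> (c == - d) = false.
  by move=> hc hd; rewrite gt_eqF // (lt_trans _ hc) // oppr_lt0.
have [d2N1 d2N2 d1N1 d1N2] : [/\ (2 == -1 :> K) = false, (2 == -2 :> K) = false,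
   (1 == -1 :> K) = false & (1 == -2 :> K) = false].
  by split; apply: pn; rewrite ?ltr01 ?ltr0n.
have d0N1 : (0 == -1 :> K) = false by rewrite eq_sym oppr_eq0 oner_eq0.
have d0N2 : (0 == -2 :> K) = false by rewrite eq_sym oppr_eq0 pnatr_eq0.
have dN12 : (-1 == -2 :> K) = false by rewrite eqr_opp (eqr_nat K 1 2).
have ur : uniq r.
  by rewrite /= !inE d21 d20 d10 d2N1 d2N2 d1N1 d1N2 d0N1 d0N2 dN12.
have zE : [/\ z 2 = wt2 A, z 1 = wt1 A, z 0 = wt0 A, z (-1) = wtN1 A & z (-2) = wtN2 A].
  rewrite /z !eqxx (eq_sym 1 2) (eq_sym 0 2) (eq_sym 0 1) (eq_sym (-1) 2).
  rewrite (eq_sym (-1) 1) (eq_sym (-1) 0) (eq_sym (-2) 2) (eq_sym (-2) 1).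
  rewrite (eq_sym (-2) 0) (eq_sym (-2) (-1)).
  by rewrite d21 d20 d10 d2N1 d2N2 d1N1 d1N2 d0N1 d0N2 dN12.
have hz c : c \in r -> iter 1 (fun B => (mulmx H \- mulmxr H) B - c *: B) (z c) = 0.
  have [z2 z1 z0 zN1 zN2] := zE.
  have simp := (mulmxBl, mulmxBr, mulmxDl, mulmxDr, op_op, op_mx, mx_op, row_op, op_col,
     dot_mid_xi, dot_mid_eta, dot_w_mid, dot_u_mid, wxi, weta, uxi, ueta, scale0r, scale1r,
     opZl, opZr, op0l, op0r, opDl, opDr, opNl, opNr, sub0r, subr0, add0r, addr0).
  have e2 : H *m wt2 A - wt2 A *m H = 2 *: wt2 A.
    rewrite /wt2 /H -scalemxAr -scalemxAl !simp.
    by apply/matrixP => i j; rewrite !mxE; ring.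
  have e1 : H *m wt1 A - wt1 A *m H = wt1 A.
    rewrite /wt1 /H !simp.
    by apply/matrixP => i j; rewrite !mxE; ring.
  have eN1 : H *m wtN1 A - wtN1 A *m H = - wtN1 A.
    rewrite /wtN1 /H !simp.
    by apply/matrixP => i j; rewrite !mxE; ring.
  have eN2 : H *m wtN2 A - wtN2 A *m H = -2 *: wtN2 A.
    rewrite /wtN2 /H -scalemxAr -scalemxAl !simp.
    by apply/matrixP => i j; rewrite !mxE; ring.
  have e0 : H *m wt0 A - wt0 A *m H = 0.
    have -> : H *m wt0 A - wt0 A *m H = (H *m A - A *m H) - (H *m wt1 A - wt1 A *m H)
      - (H *m wtN1 A - wtN1 A *m H) - (H *m wt2 A - wt2 A *m H) - (H *m wtN2 A - wtN2 A *m H).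
      rewrite /wt0 !mulmxBr !mulmxBl.
      by apply/matrixP => i j; rewrite [LHS]mxE [RHS]mxE; do 6!rewrite ?[in LHS]mxE ?[in RHS]mxE; ring.
    rewrite e1 e2 eN1 eN2 /wt1 /wt2 /wtN1 /wtN2 /H !row_mid !col_mid.
    rewrite !dotA mulmxBl mulmxBr !op_mx !mx_op.
    rewrite !(opDl, opDr, opNl, opNr, opZl, opZr).
    by apply/matrixP => i j; rewrite !mxE; ring.
  rewrite !inE => /or4P[/eqP ->|/eqP ->|/eqP ->|/orP[/eqP ->|/eqP ->]] /=.
  - by rewrite z2 e2 subrr.
  - by rewrite z1 e1 scale1r subrr.
  - by rewrite z0 e0 scale0r subrr.
  - by rewrite zN1 eN1 scaleN1r opprK addNr.
  - by rewrite zN2 eN2 subrr.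
have MH : forall B, M B -> M ((mulmx H \- mulmxr H) B).
  by move=> B hB; exact: hM.2.
have hs : M (\sum_(c <- r) z c).
  have [z2 z1 z0 zN1 zN2] := zE.
  rewrite /r !big_cons big_nil z2 z1 z0 zN1 zN2 (_ : _ + _ = A) //.
  rewrite /wt0; move: (wt2 A) (wt1 A) (wtN1 A) (wtN2 A) => B C D E.
  by apply/matrixP => i j; rewrite !mxE; ring.
have h := geigen_comp hM.1 MH ur hz hs.
have [<- <- <- <- <-] := zE.
by split; apply: h; rewrite !inE eqxx ?orbT.
Qed.

Hypotheses (MT : M (op xi w)) (MT' : M (op eta u)).

Lemma weight_elt : M (op eta w - op xi u).
Proof.
have := hM.2 _ _ MT' MT; rewrite !op_op uxi weta !scale1r; exact.
Qed.

Lemma wt0E A : wt0 A = dot w (A *m eta) *: op eta w + dot u (A *m xi) *: op xi u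
  + mid *m A *m mid.
Proof.
have e : A *m mid = A - op (A *m eta) w - op (A *m xi) u.
  by rewrite /mid -lock !mulmxBr mulmx1 !mx_op.
have e' B : mid *m B = B - op eta (w *m B) - op xi (u *m B).
  by rewrite /mid -lock !mulmxBl mul1mx !op_mx.
rewrite -mulmxA e' {1}e !mulmxA /wt0 /wt1 /wtN1 /wt2 /wtN2 !col_mid.
rewrite !(opDl, opDr, opNl, opNr, opZl, opZr).
by apply/matrixP => i j; rewrite !mxE; ring.
Qed.

(* The part of M of weight -1: either it contains a vector with one component
   zero, which makes M full, or it is the graph of a bijection al <-> a, and this
   bijection is the matrix of an alternating form. *)
Definition Nrel al a := [/\ dot w al = 0, dot u al = 0, dot a xi = 0, dot a eta = 0
  & M (op al w + op xi a)].

Let simp := (mulmxBl, mulmxBr, mulmxDl, mulmxDr, op_op, op_mx, mx_op, row_op, op_col,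
  dot_mid_xi, dot_mid_eta, dot_w_mid, dot_u_mid, wxi, weta, uxi, ueta, scale0r, scale1r,
  opZl, opZr, op0l, op0r, opDl, opDr, opNl, opNr, sub0r, subr0, add0r, addr0).

Lemma Nrel_wtN1 A : M A -> Nrel (mid *m (A *m eta)) (u *m A *m mid).
Proof.
move=> /(weight_components weight_elt)[_ _ _ h _].
by split; rewrite ?(dot_w_mid, dot_u_mid, dot_mid_xi, dot_mid_eta) // addrC.
Qed.

Lemma Nrel_wt1 A : M A -> Nrel (mid *m (A *m xi)) (- (w *m A *m mid)).
Proof.
move=> /(weight_components weight_elt)[_ h _ _ _].
split; rewrite ?dotNl ?(dot_w_mid, dot_u_mid, dot_mid_xi, dot_mid_eta) ?oppr0 //.
have := hM.2 _ _ h MT; congr M.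
by rewrite /wt1 !simp.
Qed.

(** Bracketing with [op eta u], which has weight 2, carries weight -1 to weight 1. *)
Lemma Nrel_neg al a : Nrel al a -> M (op al u - op eta a).
Proof.
move=> [h1 h2 h3 h4 h]; have := hM.2 _ _ h MT'; congr M.
by rewrite !simp h2 h4 !simp.
Qed.

Lemma Nrel_lin c al a be b : Nrel al a -> Nrel be b -> Nrel (c *: al + be) (c *: a + b).
Proof.
move=> [a1 a2 a3 a4 ha] [b1 b2 b3 b4 hb].
split; rewrite ?(dotDl, dotDr) ?(dotZl, dotZr) ?a1 ?a2 ?a3 ?a4 ?b1 ?b2 ?b3 ?b4 ?mulr0 ?addr0 //.
have := hM.1.2 c _ _ ha hb; congr M.
by rewrite !simp; apply/matrixP => i j; rewrite !mxE; ring.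
Qed.

Lemma Nrel0 : Nrel 0 0.
Proof. by split; rewrite ?dot0r ?dot0l // op0l op0r addr0; apply: subsp0 hM.1. Qed.

Lemma Nrel_mid al a : Nrel al a -> mid *m al = al /\ a *m mid = a.
Proof.
by move=> [h1 h2 h3 h4 _]; rewrite col_mid row_mid h1 h2 h3 h4 !scale0r !subr0.
Qed.

Lemma Nrel_wt0 al a A : Nrel al a -> M A ->
  Nrel (dot w (A *m eta) *: al - mid *m (A *m al)) (a *m A *m mid - dot u (A *m xi) *: a).
Proof.
move=> N /(weight_components weight_elt)[_ _ h0 _ _]; have [emid amid] := Nrel_mid N.
have [a1 a2 a3 a4 ha] := N.
split; rewrite ?(dotDl, dotDr) ?(dotNl, dotNr) ?(dotZl, dotZr)
  ?(dot_w_mid, dot_u_mid, dot_mid_xi, dot_mid_eta) ?a1 ?a2 ?a3 ?a4 ?mulr0 ?subr0 //.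
have := hM.2 _ _ ha h0; congr M.
have -> : (op al w + op xi a) *m wt0 A - wt0 A *m (op al w + op xi a) =
   op al (w *m wt0 A) + op xi (a *m wt0 A) - op (wt0 A *m al) w - op (wt0 A *m xi) a.
  by rewrite (mulmxDl (op al w)) (mulmxDr (wt0 A)) !op_mx !mx_op opprD addrA.
have -> : w *m wt0 A = dot w (A *m eta) *: w.
  rewrite /wt0 /wt1 /wtN1 /wt2 /wtN2 !mulmxBr !mulmxDr -!scalemxAr !simp.
  rewrite row_mid -!dotA.
  by apply/matrixP => i j; rewrite !mxE; ring.
have -> : wt0 A *m xi = dot u (A *m xi) *: xi.
  rewrite /wt0 /wt1 /wtN1 /wt2 /wtN2 !mulmxBl !mulmxDl -!scalemxAl !simp.
  rewrite col_mid.
  by apply/matrixP => i j; rewrite !mxE; ring.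
have -> : a *m wt0 A = a *m A *m mid.
  rewrite /wt0 /wt1 /wtN1 /wt2 /wtN2 !mulmxBr !mulmxDr -!scalemxAr !simp a3 a4 !simp.
  rewrite row_mid -!(dotA a mid) amid !dotA.
  by apply/matrixP => i j; rewrite !mxE; ring.
have -> : wt0 A *m al = mid *m (A *m al).
  rewrite /wt0 /wt1 /wtN1 /wt2 /wtN2 !mulmxBl !mulmxDl -!scalemxAl !simp a1 a2 !simp.
  rewrite col_mid !dotA emid.
  by apply/matrixP => i j; rewrite !mxE; ring.
by rewrite !simp; apply/matrixP => i j; rewrite !mxE; ring.
Qed.

(** The vectors whose middle part occurs in the relation form an [M]-stable subspace containing [w].
    Along [w], [u] and the middle part of [x], the middle part of [x *m A] is supplied by the
    components of [A] of weight 1, -1 and 0. *)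
Lemma Nrel_row x : exists al, Nrel al (x *m mid).
Proof.
move: x; apply: irrM.
- split=> [|c x y [al hx] [be hy]]; first by exists 0; rewrite mul0mx; exact: Nrel0.
  by exists (c *: al + be); rewrite mulmxDl -scalemxAl; apply: Nrel_lin.
- move=> A x hA [al hx].
  have N1 := Nrel_wt1 hA; have N2 := Nrel_wtN1 hA; have N3 := Nrel_wt0 hx hA.
  have := Nrel_lin (- dot x eta) N1 (Nrel_lin (dot x xi) N2 (Nrel_lin (dot u (A *m xi)) hx N3)).
  set be := (X in Nrel X _) => hbe; exists be; move: hbe; congr Nrel.
  have xE : x = x *m mid + dot x eta *: w + dot x xi *: u.
    by rewrite row_mid; apply/matrixP => i j; rewrite !mxE; ring.
  rewrite [in RHS]xE !mulmxDl -!scalemxAl; apply/matrixP => i j; rewrite !mxE; ring.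
- exists w; first by exists 0; rewrite w_mid; exact: Nrel0.
  by apply: contraTneq (oner_neq0 K) => w0; rewrite -weta w0 dot0l eqxx.
Qed.

Lemma full_of_xi_u : M (op xi u) -> forall A, M A.
Proof. by move=> h; apply: rank_one_idem_full h _; rewrite ?uxi ?oner_neq0. Qed.

(** With [H = op eta w - op xi u], the matrix [1 - (mid - c *: op xi u) - H] is
    [(c + 2) *: op xi u], a multiple of an idempotent of rank one. *)
Lemma full_of_mid c : c + 2 != 0 -> M (mid - c *: op xi u) -> forall A, M A.
Proof.
move=> c2 h; apply: full_of_xi_u; have sM := hM.1.
apply: (@subspZE _ _ M sM (c + 2)) => //.
have := subspB sM (subspB sM M1 h) weight_elt; congr M.
by rewrite /mid -lock; apply/matrixP => i j; rewrite !mxE; ring.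
Qed.

Section Full.
Hypothesis Nrel_col : forall be, exists a, Nrel (mid *m be) a.

Lemma full_of_row a : a != 0 -> Nrel 0 a -> forall A, M A.
Proof.
have sM := hM.1.
have G b al' a' : Nrel 0 b -> Nrel al' a' -> M (op al' b - dot b al' *: op xi u).
  move=> [_ _ b3 b4]; rewrite op0l add0r => hb N'; have [a1 a2 a3 a4 _] := N'.
  have := hM.2 _ _ (Nrel_neg N') hb; congr M.
  rewrite !simp a3 !simp b4 !simp.
  by apply/matrixP => i j; rewrite !mxE; ring.
move=> a0 Na; have [_ _ a3 a4] := Na; rewrite op0l add0r => Ma.
have [be hbe] := dot_neq0 a0.
pose ga := (dot a be)^-1 *: (mid *m be).
have [_ amid] := Nrel_mid Na.
have aga : dot a ga = 1 by rewrite dotZr -dotA amid mulVf.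
have step al' a' ga' c : Nrel al' a' -> Nrel ga' c ->
    M (dot a al' *: op xi c - dot a ga' *: op al' w).
  move=> N' N''; have [p1 p2 p3 p4 hp] := N''; have [q1 q2 q3 q4 hq] := N'.
  have h1 := hM.2 _ _ hp (G _ _ _ Na N').
  have := subspB sM h1 (subspZ sM (dot c al') Ma); congr M.
  rewrite !mulmxBr !mulmxBl -!scalemxAr -!scalemxAl !simp q1 p2 p3 a3 !simp scaler0.
  by apply/matrixP => i j; rewrite !mxE; ring.
have [c Nc] : exists c, Nrel ga c.
  have [c hc] := Nrel_col be; exists ((dot a be)^-1 *: c).
  by have := Nrel_lin (dot a be)^-1 hc Nrel0; rewrite !addr0.
(* The relation gives [op ga w + op xi c], and [step] gives [op xi c - op ga w], since
   [dot a ga = 1]; the difference isolates [op ga w]. *)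
have Mga : M (op ga w).
  apply: (@subspZE _ _ M sM 2); first by rewrite pnatr_eq0.
  have [_ _ _ _ hc] := Nc.
  have := subspB sM hc (step _ _ _ _ Nc Nc); rewrite aga; congr M.
  by apply/matrixP => i j; rewrite !mxE; ring.
have Mal be' : M (op (mid *m be') w).
  have [a' Na'] := Nrel_col be'.
  have h := step _ _ _ _ (Nrel_lin (- dot a (mid *m be')) Nc Na') Nc.
  have := subspB sM (subspZ sM (dot a (mid *m be')) Mga) h; congr M.
  rewrite aga dotDr dotZr aga !simp.
  by apply/matrixP => i j; rewrite !mxE; ring.
have N0 x : Nrel 0 (x *m mid).
  have [al Nal] := Nrel_row x; have [h1 h2 h3 h4 h] := Nal.
  split; rewrite ?dot0r // op0l add0r.
  have [e _] := Nrel_mid Nal.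
  by rewrite -(addKr (op al w) (op xi _)); apply: subspD => //; apply: subspN => //; rewrite -e.
(* Each summand is an instance of [G]. Their sum is [mid - \tr mid *: op xi u], and the trace of
   [mid] is [n - 2], so that the constant [c + 2] of [full_of_mid] is [n]. *)
have : M (\sum_i (op (mid *m col i 1%:M) (row i 1%:M *m mid) -
    dot (row i 1%:M *m mid) (mid *m col i 1%:M) *: op xi u)).
  apply: subsp_sum => // i _; have [a' Na'] := Nrel_col (col i 1%:M).
  exact: G Na'.
rewrite sumrB.
have mid2 : mid *m mid = mid.
  rewrite {2}/mid -lock !mulmxBr !mx_op mid_xi mid_eta !op0l mulmx1.
  by rewrite !subr0.
have -> : \sum_i op (mid *m col i 1%:M) (row i 1%:M *m mid) = mid.
  rewrite -[RHS]mid2 mx_sum_op; apply: eq_bigr => i _.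
  by rewrite -row_mul mul1mx [col i 1%:M]colE mulmxA mulmx1 -colE.
rewrite -scaler_suml; apply: full_of_mid.
have -> : \sum_i dot (row i 1%:M *m mid) (mid *m col i 1%:M) = \tr mid.
  apply: eq_bigr => i _; rewrite dotA mulmxA mid2 -dotA -row_mul mul1mx.
  by rewrite /dot colE mul1mx -colE !mxE.
rewrite /mid -lock !raddfB /= mxtrace1 /op !(mxtrace_mulC _ w) !(mxtrace_mulC _ u).
by rewrite !trace_mx11 -/(dot _ _) -/(dot _ _) weta uxi (_ : _ + 2 = n%:R) ?pnatr_eq0 //; ring.
Qed.

End Full.
End Weights.

Section Dichotomy.
Variables (M : 'M[K]_n -> Prop) (w u : 'rV[K]_n) (xi eta : 'cV[K]_n).
Hypotheses (hM : mxlie M) (irrM : mxirr M) (M1 : M 1%:M).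
Hypotheses (wxi : dot w xi = 0) (weta : dot w eta = 1) (uxi : dot u xi = 1)
  (ueta : dot u eta = 0).
Hypotheses (MT : M (op xi w)) (MT' : M (op eta u)).

Local Notation midp := mid.
Local Notation Nrelp := Nrel.
Local Notation mid := (midp w u xi eta).
Local Notation Nrel := (Nrelp M w u xi eta).

Lemma mid_tr : midp xi^T eta^T w^T u^T = mid^T.
Proof. by rewrite /midp -!lock !linearB /= trmx1 !op_tr addrAC. Qed.

(** Transposition exchanges [w, u] with [xi, eta] and the two components of the relation, so that
    each result on [a] yields one on [al]. *)
Lemma Nrel_tr al a : Nrelp (mxtr_set M) xi^T eta^T w^T u^T a^T al^T <-> Nrel al a.
Proof.
rewrite /Nrelp !dot_tr /mxtr_set linearD /= !op_tr !trmxK addrC.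
by split=> -[].
Qed.

Let trwxi : dot xi^T w^T = 0. Proof. by rewrite dot_tr. Qed.
Let trweta : dot xi^T u^T = 1. Proof. by rewrite dot_tr. Qed.
Let truxi : dot eta^T w^T = 1. Proof. by rewrite dot_tr. Qed.
Let trueta : dot eta^T u^T = 0. Proof. by rewrite dot_tr. Qed.
Let trMT : mxtr_set M (op w^T xi^T). Proof. by rewrite /mxtr_set op_tr !trmxK. Qed.
Let trMT' : mxtr_set M (op u^T eta^T). Proof. by rewrite /mxtr_set op_tr !trmxK. Qed.
Let trM1 : mxtr_set M 1%:M. Proof. by rewrite /mxtr_set trmx1. Qed.

Lemma Nrel_col be : exists a, Nrel (mid *m be) a.
Proof.
have [al hal] := Nrel_row (mxlie_tr hM) (mxirr_tr irrM) trwxi trweta truxi trueta trMT trMT' be^T.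
exists al^T; apply/Nrel_tr; move: hal.
by rewrite mid_tr -trmx_mul trmxK.
Qed.

Lemma full_of_col al : al != 0 -> Nrel al 0 -> forall A, M A.
Proof.
move=> al0 /Nrel_tr; rewrite trmx0 => hal A; rewrite -[A]trmxK.
apply: (full_of_row (mxlie_tr hM) (mxirr_tr irrM) trM1 trwxi trweta truxi trueta trMT trMT'
  _ _ hal A^T); last by rewrite trmx_eq0.
move=> be; have [a' ha'] := Nrel_row hM irrM wxi weta uxi ueta MT MT' be^T.
exists a'^T; rewrite -[_ *m be]trmxK; apply/Nrel_tr.
by rewrite trmx_mul mid_tr trmxK.
Qed.

Section Graph.
Hypotheses (inj1 : forall al, Nrel al 0 -> al = 0) (inj2 : forall a, Nrel 0 a -> a = 0).

Let sM := hM.1.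
Let nlin c al a be b : Nrel al a -> Nrel be b -> Nrel (c *: al + be) (c *: a + b).
Proof. exact: Nrel_lin. Qed.

Lemma Nrel_inj al be a : Nrel al a -> Nrel be a -> al = be.
Proof.
move=> h1 h2; apply/eqP; rewrite -subr_eq0; apply/eqP; apply: inj1.
by have := nlin (-1) h2 h1; rewrite !scaleN1r addNr addrC.
Qed.

(** Let [X = op al w + op xi a] and let D be its image of weight 1. The double bracket [X, [X, D]]
    is 3 times [dot a al] times [op al w - op xi a]; were [dot a al] nonzero, both terms of [X]
    would lie in [M], and [inj1] would give [al = 0]. *)
Lemma Nrel_diag al a : Nrel al a -> dot a al = 0.
Proof.
move=> N; have [h1 h2 h3 h4 h] := N; apply: contrapT => /eqP d0.
have hneg := Nrel_neg hM weta uxi MT' N.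
have := hM.2 _ _ h (hM.2 _ _ h hneg).
set D := op al u - op eta a.
have -> : (op al w + op xi a) *m D - D *m (op al w + op xi a) =
   dot a al *: op xi u + dot a al *: op eta w - 2 *: op al a.
  rewrite /D !(mulmxDl, mulmxDr, mulmxBl, mulmxBr, mulmxN, mulNmx) !op_op ?wxi ?weta ?uxi ?ueta ?h1 ?h2 ?h3 ?h4.
  by rewrite !scale0r !scale1r; apply/matrixP => i j; rewrite !mxE; ring.
rewrite !(mulmxDl, mulmxDr, mulmxBl, mulmxBr, mulmxN, mulNmx) -!scalemxAr -!scalemxAl !op_op.
rewrite ?wxi ?weta ?uxi ?ueta ?h1 ?h2 ?h3 ?h4 !scale0r !scale1r.
move=> hD.
have : M ((6 * dot a al) *: op al w).
  have := subspD sM hD (subspZ sM (3 * dot a al) h); congr M.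
  by apply/matrixP => i j; rewrite !mxE; ring.
move=> /(subspZE sM (_ : 6 * dot a al != 0)) h6.
have al0 : al = 0.
  apply: inj1; split; rewrite ?dot0l // op0r addr0; apply: h6.
  by rewrite mulf_neq0 ?pnatr_eq0.
by rewrite al0 dot0r eqxx in d0.
Qed.

Lemma graph_form : mid != 0 -> exists om : 'rV[K]_n -> 'rV[K]_n -> K,
  [/\ forall c x y z, om (c *: x + y) z = c * om x z + om y z,
      forall c x y z, om z (c *: x + y) = c * om z x + om z y,
      exists x y, om x y != 0 &
      forall F : 'rV[K]_n -> 'M[K]_n, (forall v, M (F v)) ->
        (forall x y, x *m F y = y *m F x) ->
        forall v x y, om (x *m F v) y + om x (y *m F v) = 0].
Proof.
move=> mid0.
have [phi hphi] := choice (Nrel_row hM irrM wxi weta uxi ueta MT MT').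
have phiE al a : Nrel al a -> phi a = al.
  move=> N; have [_ amid] := Nrel_mid N.
  by apply: Nrel_inj N; rewrite -{2}amid; exact: hphi.
have phi_lin c x y : phi (c *: x + y) = c *: phi x + phi y.
  by apply: Nrel_inj (hphi _) _; rewrite mulmxDl -scalemxAl; apply: nlin.
have phi_w : phi w = 0.
  by apply: inj1; have := hphi w; rewrite w_mid.
have phi_u : phi u = 0.
  by apply: inj1; have := hphi u; rewrite u_mid.
have phi_dot x : [/\ dot w (phi x) = 0, dot u (phi x) = 0 & mid *m phi x = phi x].
  by have [? ? _ _ _] := hphi x; have [? _] := Nrel_mid (hphi x).
have dphi x y : dot y (phi x) = dot (y *m mid) (phi x).
  by have [_ _ h] := phi_dot x; rewrite dotA h.
have phi_alt x : dot x (phi x) = 0 by rewrite dphi; exact: Nrel_diag.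
have phiD x y : phi (x + y) = phi x + phi y by have := phi_lin 1 x y; rewrite !scale1r.
have phi_anti x y : dot y (phi x) = - dot x (phi y).
  have := phi_alt (x + y); rewrite phiD dotDl !dotDr !phi_alt add0r addr0.
  by move=> h; apply/eqP; rewrite -addr_eq0 addrC; apply/eqP.
(* The orthogonal sum of a hyperbolic plane spanned by [w] and [u] and of the form given on the
   middle part by the bijection of the graph. *)
pose om x y := dot x eta * dot y xi - dot x xi * dot y eta + dot y (phi x).
have omE x y : om x y = dot x eta * dot y xi - dot x xi * dot y eta + dot y (phi x) by [].
have om_l c x y z : om (c *: x + y) z = c * om x z + om y z.
  by rewrite /om phi_lin !(dotDl, dotDr, dotZl, dotZr); ring.
have om_r c x y z : om z (c *: x + y) = c * om z x + om z y.
  by rewrite /om !(dotDl, dotDr, dotZl, dotZr); ring.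
have om_anti x y : om y x = - om x y by rewrite /om phi_anti; ring.
have om_wu : om w u = 1.
  by rewrite /om weta uxi wxi ueta phi_w dot0r; ring.
have om_w x : om w x = dot x xi by rewrite /om weta wxi phi_w dot0r; ring.
have om_u x : om u x = - dot x eta by rewrite /om uxi ueta phi_u dot0r; ring.
pose inv A mu := forall x y, om (x *m A) y + om x (y *m A) = mu * om x y.
have om0 x : om 0 x = 0.
  by rewrite -(scale0r (0 : 'rV_n)) -[_ *: _]addr0 om_l mul0r add0r;
    have := om_l (-1) 0 0 x; rewrite scaler0 addr0 mulN1r addNr.
have omZ c x y : om (c *: x) y = c * om x y by rewrite -[c *: x]addr0 om_l om0 addr0.
have omZr c x y : om x (c *: y) = c * om x y by rewrite om_anti omZ om_anti; ring.
have omD x y z : om (x + y) z = om x z + om y z.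
  by have := om_l 1 x y z; rewrite scale1r mul1r.
have omDr x y z : om z (x + y) = om z x + om z y.
  by have := om_r 1 x y z; rewrite scale1r mul1r.
have invD A B la mu : inv A la -> inv B mu -> inv (A + B) (la + mu).
  by move=> hA hB x y; rewrite !mulmxDr omD omDr mulrDl -hA -hB; ring.
have om_a al a x : Nrel al a -> om a x = dot x al.
  move=> N; rewrite /om (phiE _ _ N); have [_ _ h3 h4 _] := N.
  by rewrite h3 h4; ring.
have inv_T c : inv (c *: op xi w) 0.
  move=> x y; rewrite -!scalemxAr !row_op !omZ !omZr (om_anti w x) !om_w; ring.
have inv_T' c : inv (c *: op eta u) 0.
  move=> x y; rewrite -!scalemxAr !row_op !omZ !omZr (om_anti u x) !om_u; ring.
have inv_N al a : Nrel al a -> inv (op al w + op xi a) 0.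
  move=> N x y; rewrite !mulmxDr !row_op !(omD, omDr) !(omZ, omZr).
  rewrite (om_anti w x) (om_anti a x) !om_w !(om_a _ _ _ N); ring.
have inv_N' al a : Nrel al a -> inv (op al u - op eta a) 0.
  move=> N x y; rewrite !mulmxBr !row_op -!scaleNr !(omD, omDr) !(omZ, omZr).
  rewrite (om_anti u x) (om_anti a x) !om_u !(om_a _ _ _ N); ring.
have inv_0 A : M A -> inv (wt0 w u xi eta A) (dot w (A *m eta) + dot u (A *m xi)).
  move=> hA x y; rewrite wt0E //.
  set la := dot w _; set nu := dot u _.
  have hx z : z *m (la *: op eta w + nu *: op xi u + mid *m A *m mid) =
     (dot z eta * la) *: w + (dot z xi * nu) *: u + z *m mid *m A *m mid.
    by rewrite !mulmxDr -!scalemxAr !row_op !scalerA !mulmxA (mulrC la) (mulrC nu).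
  rewrite !hx !(omD, omDr) !(omZ, omZr) (om_anti w x) (om_anti u x) !om_w !om_u.
  have := Nrel_wt0 hM wxi weta uxi ueta MT MT' (hphi x) hA; rewrite -/la -/nu => hN.
  have := om_a _ _ y hN; rewrite omD -scaleNr omZ (om_a _ _ _ (hphi x)).
  rewrite dotDr dotZr dotNr => h1.
  have h2 : om x (y *m mid *m A *m mid) = dot y (mid *m (A *m phi x)).
    rewrite /om dot_mid_xi ?dot_mid_eta // !mulr0 subrr add0r !dotA.
    by have [_ _ ->] := phi_dot x.
  have h3 : om (x *m mid *m A *m mid) y =
      (la + nu) * dot y (phi x) - dot y (mid *m (A *m phi x)).
    by apply: (addIr (- nu * dot y (phi x))); rewrite h1; ring.
  rewrite h2 h3 omE; ring.
have inv_all A : M A -> exists mu, inv A mu.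
  move=> hA; exists (dot w (A *m eta) + dot u (A *m xi)).
  have N1 := Nrel_wt1 hM wxi weta uxi ueta MT MT' hA.
  have N2 := Nrel_wtN1 hM wxi weta uxi ueta MT MT' hA.
  have h := invD _ _ _ _ (inv_0 A hA) (invD _ _ _ _ (inv_N' _ _ N1) (invD _ _ _ _ (inv_N _ _ N2)
     (invD _ _ _ _ (inv_T (dot u (A *m eta))) (inv_T' (dot w (A *m xi)))))).
  move: h; rewrite !addr0; congr (inv _ _).
  rewrite /wt0 /wt1 /wtN1 /wt2 /wtN2 opNr opprK.
  by apply/matrixP => i j; rewrite !mxE; ring.
exists om; split=> //; first by exists w, u; rewrite om_wu oner_neq0.
move=> F MF Fsym.
have [mu hmu] := choice (fun v => inv_all (F v) (MF v)).
(* The symmetry of [F] and the antisymmetry of [om] make the six terms of the three similitude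
   relations cancel in pairs. *)
have cyc v x y : mu v * om x y + mu x * om y v + mu y * om v x = 0.
  rewrite -!hmu (om_anti (y *m F v) x) (om_anti (v *m F x) y) (om_anti (x *m F y) v).
  by rewrite (Fsym x v) (Fsym y v) (Fsym y x); ring.
have mu_mid x : mu (x *m mid) = 0.
  have := cyc (x *m mid) w u; rewrite om_wu om_u (om_anti w) om_w.
  by rewrite dot_mid_xi ?dot_mid_eta // oppr0 !mulr0 !addr0 mulr1.
(* This pair inside the middle part, available since [mid != 0], is orthogonal to [w] and [u] and
   isolates [mu w] and [mu u] in [cyc], as the pair [w, u] did for the middle part. *)
have [x [y hxy]] : exists x y, om (x *m mid) (y *m mid) != 0.
  have [x hx] : exists x, x *m mid != 0.
    apply: contrapT => /forallNP h; move: mid0; rewrite -[mid]mul1mx.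
    suff -> : 1%:M *m mid = 0 by rewrite eqxx.
    apply/row_matrixP => i; rewrite row_mul row0; apply/eqP; apply: contrapT => /negP.
    exact: h.
  have phix : phi x != 0.
    by apply: contraNneq hx => h; apply/eqP/inj2; rewrite -h; exact: hphi.
  have [y hy] := dot_neq0r phix; exists x, y.
  by rewrite (om_a _ _ _ (hphi x)) -dphi.
have mu_w : mu w = 0.
  have := cyc w (x *m mid) (y *m mid); rewrite !mu_mid !mul0r !addr0 => /eqP.
  by rewrite mulf_eq0 (negPf hxy) orbF => /eqP.
have mu_u : mu u = 0.
  have := cyc u (x *m mid) (y *m mid); rewrite !mu_mid !mul0r !addr0 => /eqP.
  by rewrite mulf_eq0 (negPf hxy) orbF => /eqP.
move=> v x' y'.
have sub z : mu z = 0 -> om (x' *m F z) y' + om x' (y' *m F z) = 0.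
  by move=> h; rewrite hmu h mul0r.
have vE : v = dot v eta *: w + (dot v xi *: u + v *m mid).
  by rewrite row_mid; apply/matrixP => i j; rewrite !mxE; ring.
rewrite (Fsym x' v) (Fsym y' v) vE !mulmxDl -!scalemxAl !(omD, omDr) !(omZ, omZr).
rewrite !(Fsym _ x') !(Fsym _ y').
have h1 := sub w mu_w; have h2 := sub u mu_u; have h3 := sub _ (mu_mid v).
transitivity (dot v eta * (om (x' *m F w) y' + om x' (y' *m F w)) +
  (dot v xi * (om (x' *m F u) y' + om x' (y' *m F u)) +
  (om (x' *m F (v *m mid)) y' + om x' (y' *m F (v *m mid))))); last first.
  by rewrite h1 h2 h3 !mulr0 !addr0.
ring.
Qed.

End Graph.
End Dichotomy.
End Transvections.

(** A Jacobson-Morozov construction: [[B, op xi w]] is the semisimple element of an sl(2)-triple,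
    and the component of [B] of weight 2 is the opposite nilpotent element. *)
Lemma opposite_transvection (K : numFieldType) n' (M : 'M[K]_n'.+1 -> Prop) w xi B :
  mxlie M -> M (op xi w) -> dot w xi = 0 -> M B -> dot w (B *m xi) != 0 ->
  exists u eta, [/\ dot w eta = 1, dot u xi = 1, dot u eta = 0 & M (op eta u)].
Proof.
move=> hM MT wxi.
wlog wB : B / dot w (B *m xi) = 1 => [H MB d0|].
  apply: (H ((dot w (B *m xi))^-1 *: B)).
  - by rewrite -scalemxAl dotZr mulVf.
  - by apply: subspZ hM.1 _ _ MB.
  - by rewrite -scalemxAl dotZr mulVf ?oner_neq0.
move=> MB _; have two : (2 : K) != 0 by rewrite pnatr_eq0.
(* The correction by [c] changes neither [[B, op xi w]] nor the pairings equal to 1; half of the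
   pairing of [w *m B] and [B *m xi] is what makes [dot u eta] vanish. *)
pose c := dot (w *m B) (B *m xi) / 2.
pose u := w *m B - c *: w; pose eta := B *m xi - c *: xi.
have weta : dot w eta = 1 by rewrite /eta dotDr dotNr dotZr wxi wB; ring.
have uxi : dot u xi = 1 by rewrite /u dotDl dotNl dotZl wxi dotA wB; ring.
have ueta : dot u eta = 0.
  rewrite /u /eta !(dotDl, dotNl, dotZl) !(dotDr, dotNr, dotZr) !dotA wxi wB.
  by rewrite -dotA /c; field.
exists u, eta; split=> //.
have elt : M (op eta w - op xi u).
  have := hM.2 _ _ MB MT; congr M.
  rewrite op_mx mx_op /eta /u !(opDl, opDr, opNl, opNr, opZl, opZr).
  by apply/matrixP => i j; rewrite !mxE; ring.
have [] := weight_components hM wxi weta uxi ueta elt MB.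
rewrite /wt2 wB scale1r //.
Qed.

(* In the second case M lies in the sum of the scalars and of the symplectic
   algebra of om; the first prolongation of the scalar part vanishes, so that a
   prolongation F of M takes its values in the symplectic algebra. *)
Theorem rank_one_dichotomy (K : numClosedFieldType) n' (M : 'M[K]_n'.+1 -> Prop) w xi :
  mxlie M -> mxirr M -> M 1%:M -> M (op xi w) -> w != 0 -> xi != 0 ->
  (forall A, M A) \/
  exists om : 'rV[K]_n'.+1 -> 'rV[K]_n'.+1 -> K,
  [/\ forall c x y z, om (c *: x + y) z = c * om x z + om y z,
      forall c x y z, om z (c *: x + y) = c * om z x + om z y,
      exists x y, om x y != 0 &
      forall F : 'rV[K]_n'.+1 -> 'M[K]_n'.+1, (forall v, M (F v)) ->
        (forall x y, x *m F y = y *m F x) ->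
        forall v x y, om (x *m F v) y + om x (y *m F v) = 0].
Proof.
move=> hM irrM M1 MT w0 xi0; have [sM bM] := hM.
have [wxi|wxi] := eqVneq (dot w xi) 0; last by left; apply: rank_one_idem_full MT wxi.
have [[B [MB wB]]|hN] := pselect (exists B, M B /\ dot w (B *m xi) != 0); last first.
  (* Otherwise [op xi w] lies in the radical [R] of the trace form. The ideal [R, M] is nilpotent by
     Cartan's criterion, hence zero; so [op xi w] commutes with [M], and the kernel of [xi] is a
     proper stable subspace containing [w]. *)
  exfalso; pose R r := M r /\ forall b, M b -> \tr (r *m b) = 0.
  have hR : subsp R.
    split=> [|c x y [Mx hx] [My hy]].
      by split=> [|b _]; rewrite ?mul0mx ?linear0 //; exact: subsp0.
    split=> [|b Mb]; first exact: sM.2.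
    by rewrite mulmxDl -scalemxAl linearP /= hx ?hy // mulr0 addr0.
  pose G c := exists r m, [/\ R r, M m & c = r *m m - m *m r].
  have GR c : G c -> R c.
    move=> [r [m [[Mr hr] Mm ->]]]; split=> [|b Mb]; first exact: bM.
    rewrite mulmxBl linearB /= -!mulmxA [X in _ - X]mxtrace_mulC -!mulmxA.
    by rewrite -linearB -mulmxBr /= hr //; apply: bM.
  have IR c : spn G c -> R c by move=> h; apply: h.
  have I0 : forall A, spn G A -> A = 0.
    apply: (nil_ideal_eq0 irrM (spn_subsp G)) => [A /IR[]//|A B IA MB|A IA].
      by apply: spn_sub; exists A, B; split=> //; exact: IR.
    exists n'.+1; apply: (@cartan_nilpotent _ _ M R) => //.
    - by move=> r [].
    - by move=> r b [_ h]; exact: h.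
  have RT : R (op xi w).
    split=> // b Mb; rewrite op_mx /op mxtrace_mulC trace_mx11 -/(dot _ _) dotA.
    apply: contrapT => /eqP d; apply: hN; by exists b.
  have comm m : M m -> op xi (w *m m) = op (m *m xi) w.
    move=> Mm; apply/eqP; rewrite -subr_eq0 -op_mx -mx_op; apply/eqP/I0.
    by apply: spn_sub; exists (op xi w), m.
  pose U (x : 'rV[K]_n'.+1) := dot x xi = 0.
  have hU : subsp U.
    split=> [|c x y hx hy]; first exact: dot0l.
    by rewrite /U dotDl dotZl hx hy mulr0 addr0.
  have UM m x : M m -> U x -> U (x *m m).
    move=> Mm hx; have := congr1 (mulmx x) (comm m Mm).
    rewrite !row_op hx scale0r => /esym/eqP; rewrite scaler_eq0 (negPf w0) orbF.
    by rewrite /U dotA => /eqP.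
  have hall := irrM U hU UM (ex_intro2 _ _ w wxi w0).
  have [x] := dot_neq0r xi0; by rewrite hall eqxx.
have [u [eta [weta uxi ueta MT']]] := opposite_transvection hM MT wxi MB wB.
have [mid0|mid0] := eqVneq (mid w u xi eta) 0.
  left; apply: (full_of_mid hM irrM M1 weta uxi MT MT' (c := 0)).
    by rewrite add0r pnatr_eq0.
  by rewrite mid0 scale0r subrr; exact: subsp0.
have Ncol := Nrel_col hM irrM wxi weta uxi ueta MT MT'.
have [[a [a0 Na]]|N1] := pselect (exists a, a != 0 /\ Nrel M w u xi eta 0 a).
  by left; apply: (full_of_row hM irrM M1 wxi weta uxi ueta MT MT' Ncol a0 Na).
have [[al [al0 Nal]]|N2] := pselect (exists al, al != 0 /\ Nrel M w u xi eta al 0).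
  by left; apply: (full_of_col hM irrM M1 wxi weta uxi ueta MT MT' al0 Nal).
right; apply: (graph_form hM irrM wxi weta uxi ueta MT MT') => //.
- by move=> al Nal; apply: contrapT => /eqP al0; apply: N2; exists al.
- by move=> a Na; apply: contrapT => /eqP a0; apply: N1; exists a.
Qed.

(** * Polynomial vector fields *)

Notation PF K n := {ffun 'I_n -> {mpoly K[n]}}.

Section PolynomialFields.
Variables (K : numFieldType) (n : nat).
Implicit Types (P Q S : PF K n) (f g : {mpoly K[n]}) (v w : 'rV[K]_n) (A B : 'M[K]_n).

Definition lieD P f : {mpoly K[n]} := \sum_j P j * f^`M(j).

Definition br P Q : PF K n :=
  [ffun k => \sum_(j < n) (P j * (Q k)^`M(j) - Q j * (P k)^`M(j))].

Lemma brE P Q k : br P Q k = lieD P (Q k) - lieD Q (P k).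
Proof. by rewrite ffunE sumrB. Qed.

Lemma lieD_lin_l c P Q f : lieD (c *: P + Q) f = c *: lieD P f + lieD Q f.
Proof.
rewrite /lieD scaler_sumr -big_split /=; apply: eq_bigr => j _.
by rewrite !ffunE mulrDl -scalerAl.
Qed.

Lemma lieD_is_linear P : linear (lieD P).
Proof.
move=> c f g; rewrite /lieD scaler_sumr -big_split /=; apply: eq_bigr => j _.
by rewrite linearP mulrDr -scalerAr.
Qed.
HB.instance Definition _ P := GRing.isLinear.Build K _ _ _ (lieD P) (lieD_is_linear P).

Lemma lieDM P f g : lieD P (f * g) = lieD P f * g + f * lieD P g.
Proof.
rewrite /lieD mulr_suml mulr_sumr -big_split /=; apply: eq_bigr => j _.
by rewrite mderivM; ring.
Qed.

(** The second order terms of the two compositions agree by the symmetry of second derivatives. The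
    Jacobi identity for [br] follows. *)
Lemma lieD_br P Q f : lieD (br P Q) f = lieD P (lieD Q f) - lieD Q (lieD P f).
Proof.
have E (U V : PF K n) : lieD U (lieD V f) =
    \sum_k lieD U (V k) * f^`M(k) + \sum_k \sum_j U j * V k * f^`M(k)^`M(j).
  rewrite {2}/lieD linear_sum /= -big_split; apply: eq_bigr => k _ /=.
  rewrite lieDM; congr (_ + _); rewrite /lieD mulr_sumr; apply: eq_bigr => j _; ring.
rewrite !E opprD addrACA [X in _ + X](_ : _ = 0) ?addr0; last first.
  apply/eqP; rewrite subr_eq0 exchange_big; apply/eqP; apply: eq_bigr => k _ /=.
  by apply: eq_bigr => j _; rewrite mderiv_comm; ring.
rewrite -sumrB /lieD; apply: eq_bigr => k _.
by rewrite brE mulrBl.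
Qed.

Lemma br_lin_l c P Q S : br (c *: P + Q) S = c *: br P S + br Q S.
Proof.
apply/ffunP => k; rewrite [in RHS]ffunE [in X in _ = X + _]ffunE !brE !ffunE.
rewrite lieD_lin_l linearP /= scalerBr opprD; set a := c *: _; set b := c *: _.
by rewrite -!addrA; congr (_ + _); rewrite !addrA; congr (_ - _); rewrite addrC.
Qed.

Lemma br_anti P Q : br P Q = - br Q P.
Proof. by apply/ffunP => k; rewrite [in RHS]ffunE !brE opprB. Qed.

Lemma br_is_linear P : linear (br P).
Proof. by move=> c Q S; rewrite br_anti br_lin_l opprD -scalerN -!br_anti. Qed.
HB.instance Definition _ P := GRing.isLinear.Build K _ _ _ (br P) (br_is_linear P).

Lemma brDl P Q S : br (P + Q) S = br P S + br Q S.
Proof. by have := br_lin_l 1 P Q S; rewrite !scale1r. Qed.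
Lemma br0l P : br 0 P = 0. Proof. by rewrite br_anti linear0 oppr0. Qed.
Lemma brZl c P Q : br (c *: P) Q = c *: br P Q.
Proof. by rewrite -[c *: P]addr0 br_lin_l br0l addr0. Qed.
Lemma brNl P Q : br (- P) Q = - br P Q.
Proof. by rewrite -scaleN1r brZl scaleN1r. Qed.
Lemma brBl P Q S : br (P - Q) S = br P S - br Q S.
Proof. by rewrite brDl brNl. Qed.
Lemma br_sumr (I : Type) (r : seq I) (F : I -> PF K n) P :
  br P (\sum_(i <- r) F i) = \sum_(i <- r) br P (F i).
Proof. exact: (linear_sum (br P)). Qed.

Lemma jacobi P Q S : br P (br Q S) = br (br P Q) S + br Q (br P S).
Proof.
apply/ffunP => k; rewrite [in RHS]ffunE !brE !lieD_br !linearB /=.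
by ring.
Qed.

Lemma jacobi' P Q S : br (br P Q) S = br P (br Q S) - br Q (br P S).
Proof. by rewrite jacobi addrK. Qed.

Definition mon (m : 'X_{1..n}) k : PF K n := [ffun l => if l == k then 'X_[m] else 0].

Lemma monE m k l : mon m k l = if l == k then 'X_[m] else 0.
Proof. by rewrite ffunE. Qed.

Lemma lieD_mon m i f : lieD (mon m i) f = 'X_[m] * f^`M(i).
Proof.
rewrite /lieD (bigD1 i) //= big1 ?addr0 ?monE ?eqxx // => j ji.
by rewrite monE (negPf ji) mul0r.
Qed.

Lemma br_mon a b i j : br (mon a i) (mon b j) =
  (b i)%:R *: mon (a + (b - U_(i))) j - (a j)%:R *: mon (b + (a - U_(j))) i.
Proof.
apply/ffunP => k; rewrite brE !lieD_mon !monE [in RHS]ffunE [X in _ = X + _]ffunE.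
rewrite [X in _ = _ + X]ffunE [X in _ = _ - X]ffunE !monE; congr (_ - _).
  by case: eqP => _; rewrite ?mderivX ?linear0 ?mulr0 ?scaler0 // -scalerAr mpolyXD.
by case: eqP => _; rewrite ?mderivX ?linear0 ?mulr0 ?scaler0 // -scalerAr mpolyXD.
Qed.

Lemma mon_expand P : P = \sum_k \sum_(m <- msupp (P k)) (P k)@_m *: mon m k.
Proof.
apply/ffunP => l; rewrite sum_ffunE (bigD1 l) //= [X in _ + X]big1 => [|k kl].
  rewrite addr0 sum_ffunE {1}[P l]mpolyE; apply: eq_bigr => m _.
  by rewrite ffunE monE eqxx.
rewrite sum_ffunE big1 // => m _.
by rewrite ffunE monE eq_sym (negPf kl) scaler0.
Qed.

(* Points are row vectors: lin A is the field x |-> x A. A field with hom d lies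
   in Vect_(d - 1). *)
Definition cst v : PF K n := [ffun k => (v 0 k)%:MP].
Definition lin A : PF K n := [ffun k => \sum_i A i k *: 'X_i].
Definition cvec P : 'rV[K]_n := \row_k (P k)@_0.
Definition lmat P : 'M[K]_n := \matrix_(i, k) (P k)@_U_(i).
Definition hom d P := forall k, P k \is d.-homog.
Definition hc d P : PF K n := [ffun k => pihomog mdeg d (P k)].

Lemma cst_is_linear : linear cst.
Proof.
by move=> c v w; apply/ffunP => k; rewrite !ffunE !mxE mpolyCD -mul_mpolyC -mpolyCM.
Qed.
HB.instance Definition _ := GRing.isLinear.Build K _ _ _ cst cst_is_linear.

Lemma lin_is_linear : linear lin.
Proof.
move=> c A B; apply/ffunP => k; rewrite !ffunE scaler_sumr -big_split /=.
by apply: eq_bigr => i _; rewrite !mxE scalerA scalerDl.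
Qed.
HB.instance Definition _ := GRing.isLinear.Build K _ _ _ lin lin_is_linear.

Lemma cvec_is_linear : linear cvec.
Proof. by move=> c P Q; apply/rowP => k; rewrite !mxE !ffunE mcoeffD mcoeffZ. Qed.
HB.instance Definition _ := GRing.isLinear.Build K _ _ _ cvec cvec_is_linear.

Lemma lmat_is_linear : linear lmat.
Proof. by move=> c P Q; apply/matrixP => i k; rewrite !mxE !ffunE mcoeffD mcoeffZ. Qed.
HB.instance Definition _ := GRing.isLinear.Build K _ _ _ lmat lmat_is_linear.

Lemma hc_is_linear d : linear (hc d).
Proof. by move=> c P Q; apply/ffunP => k; rewrite !ffunE linearP. Qed.
HB.instance Definition _ d := GRing.isLinear.Build K _ _ _ (hc d) (hc_is_linear d).

Lemma cstK v : cvec (cst v) = v.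
Proof. by apply/rowP => k; rewrite !mxE ffunE mcoeffC eqxx mulr1. Qed.

Lemma linK A : lmat (lin A) = A.
Proof.
apply/matrixP => i k; rewrite !mxE ffunE raddf_sum (bigD1 i) //= big1 => [|j ji].
  by rewrite mcoeffZ mcoeffX eqxx mulr1 addr0.
by rewrite mcoeffZ mcoeffX eq_mnm1 (negPf ji) mulr0.
Qed.

Lemma hom_cst v : hom 0 (cst v).
Proof.
by move=> k; rewrite ffunE -[_%:MP]mulr1 mul_mpolyC; apply: dhomogZ; exact: dhomog1.
Qed.

Lemma hom_lin A : hom 1 (lin A).
Proof.
move=> k; rewrite ffunE; apply: rpred_sum => i _; apply: dhomogZ.
by rewrite dhomogX /= mdeg1.
Qed.

Lemma hom0P P : hom 0 P -> P = cst (cvec P).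
Proof.
move=> h; apply/ffunP => k; apply/mpolyP => m; rewrite ffunE mxE mcoeffC.
have [->|m0] := eqVneq 0%MM m; first by rewrite mulr1.
rewrite mulr0; apply: (dhomog_nemf_coeff (h k)).
by rewrite mdeg_eq0 eq_sym.
Qed.

Lemma hom1P P : hom 1 P -> P = lin (lmat P).
Proof.
move=> h; apply/ffunP => k; apply/mpolyP => m; rewrite ffunE raddf_sum /=.
have [hm|hm] := eqVneq (mdeg m) 1%N.
  have /eqP/mdeg1P[i /eqP ->] := hm.
  rewrite (bigD1 i) //= big1 => [|j ji].
    by rewrite addr0 mcoeffZ mcoeffX eqxx mulr1 mxE.
  by rewrite mcoeffZ mcoeffX eq_mnm1 (negPf ji) mulr0.
rewrite (dhomog_nemf_coeff (h k)) // big1 // => i _; rewrite mcoeffZ mcoeffX.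
case: eqP => [e|]; last by rewrite mulr0.
by rewrite -e mdeg1 eqxx in hm.
Qed.

Lemma hom_subsp d : subsp (hom d).
Proof.
split=> [k|c P Q hP hQ k]; rewrite ?ffunE; first exact: dhomog0.
by apply: dhomogD => //; apply: dhomogZ.
Qed.

Lemma hom_hc d P : hom d (hc d P).
Proof. by move=> k; rewrite ffunE; exact: pihomogP. Qed.

Lemma hc_hom d P : hom d P -> hc d P = P.
Proof. by move=> h; apply/ffunP => k; rewrite ffunE pihomog_dE. Qed.

Lemma hc_hom_ne d e P : hom d P -> e != d -> hc e P = 0.
Proof.
move=> h ed; apply/ffunP => k; rewrite !ffunE.
by apply: pihomog_ne0 (h k); rewrite eq_sym.
Qed.

Definition bounded N P := forall k, (msize (P k) <= N)%N.

Lemma bounded_ex P : exists N, bounded N P.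
Proof.
by exists (\max_k msize (P k))%N => k; rewrite (leq_bigmax k).
Qed.

Lemma bounded_mono N N' P : (N <= N')%N -> bounded N P -> bounded N' P.
Proof. by move=> h b k; apply: leq_trans h. Qed.

Lemma hc_sum N P : bounded N P -> P = \sum_(d < N) hc d P.
Proof.
move=> b; apply/ffunP => k; rewrite sum_ffunE {1}(pihomog_partitionE (b k)).
by apply: eq_bigr => d _; rewrite ffunE.
Qed.

Lemma hom_bounded d P : hom d P -> bounded d.+1 P.
Proof.
move=> h k; rewrite msizeE; apply/bigmax_leqP_seq => m mk _.
by rewrite (dhomog_mf (h k)).
Qed.

Lemma hc_bounded N d P : bounded N P -> (N <= d)%N -> hc d P = 0.
Proof.
move=> b Nd; rewrite (hc_sum b) linear_sum big1 //= => e _.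
apply: hc_hom_ne (hom_hc _ _) _.
by rewrite gtn_eqF // (leq_trans (ltn_ord e)).
Qed.

Lemma mderiv_homog d f i : f \is d.-homog -> f^`M(i) \is (d.-1).-homog.
Proof.
move=> h; apply/dhomogP => m; rewrite mcoeff_msupp mcoeff_deriv => hm.
have : f@_(m + U_(i)) != 0 by apply: contraNneq hm => ->; rewrite mul0rn.
rewrite -mcoeff_msupp => /(dhomog_mf h) /=; rewrite mdegD mdeg1 addn1 => <- //.
Qed.

Lemma mderiv_homog0 f i : f \is 0.-homog -> f^`M(i) = 0.
Proof.
move=> h; apply/mpolyP => m; rewrite mcoeff_deriv mcoeff0.
by rewrite (dhomog_nemf_coeff h) ?mul0rn //= mdegD mdeg1 addn1.
Qed.

Lemma lieD_homog a d P f : hom a P -> f \is d.-homog -> lieD P f \is (a + d).-1.-homog.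
Proof.
move=> hP; case: d => [|d] hf.
  by rewrite /lieD big1 ?dhomog0 // => j _; rewrite mderiv_homog0 ?mulr0.
rewrite addnS /=; apply: rpred_sum => j _; apply: dhomogM => //.
exact: (mderiv_homog j hf).
Qed.

Lemma hom_br a b P Q : hom a P -> hom b Q -> hom (a + b).-1 (br P Q).
Proof.
move=> hP hQ k; rewrite brE; apply: rpredB; first exact: lieD_homog.
by rewrite addnC; exact: lieD_homog.
Qed.

Lemma br_cst_cst v w : br (cst v) (cst w) = 0.
Proof.
apply/ffunP => k; rewrite !ffunE big1 // => j _.
by rewrite !ffunE !mderivC !mulr0 subr0.
Qed.

Lemma lieD_cst v f : lieD (cst v) f = \sum_j v 0 j *: f^`M(j).
Proof. by apply: eq_bigr => j _; rewrite ffunE mul_mpolyC. Qed.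

Lemma br_cst v P k : br (cst v) P k = \sum_j v 0 j *: (P k)^`M(j).
Proof.
rewrite brE lieD_cst [X in _ - X](_ : _ = 0) ?subr0 //.
by rewrite /lieD big1 // => j _; rewrite ffunE mderivC mulr0.
Qed.

Lemma mderivXU i j : ('X_i : {mpoly K[n]})^`M(j) = (i == j)%:R.
Proof.
rewrite mderivX mnm1E; case: eqP => [->|_]; last by rewrite scale0r.
by rewrite scale1r (_ : _ - _ = 0)%MM ?mpolyX0 //; apply/mnmP => k; rewrite mnmBE subnn mnm0E.
Qed.

Lemma mderiv_lin A j k : (lin A k)^`M(j) = (A j k)%:MP.
Proof.
rewrite [lin A k]ffunE (raddf_sum (mderiv j)) (bigD1 j) //= big1 => [|i ij].
  by rewrite mderivZ mderivXU eqxx addr0 -mul_mpolyC mulr1.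
by rewrite mderivZ mderivXU (negPf ij) scaler0.
Qed.

Lemma br_cst_lin v A : br (cst v) (lin A) = cst (v *m A).
Proof.
apply/ffunP => k; rewrite br_cst [RHS]ffunE mxE rmorph_sum; apply: eq_bigr => j _.
by rewrite mderiv_lin -mul_mpolyC -mpolyCM.
Qed.

Lemma br_lin_cst v A : br (lin A) (cst v) = - cst (v *m A).
Proof. by rewrite br_anti br_cst_lin. Qed.

Lemma lieD_lin A B k : lieD (lin A) (lin B k) = lin (A *m B) k.
Proof.
rewrite /lieD [RHS]ffunE.
under eq_bigr do rewrite mderiv_lin [lin A _]ffunE mulrC mul_mpolyC scaler_sumr.
rewrite exchange_big; apply: eq_bigr => i _ /=; rewrite mxE scaler_suml.
by apply: eq_bigr => j _; rewrite scalerA mulrC.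
Qed.

Lemma br_lin_lin A B : br (lin A) (lin B) = lin (A *m B - B *m A).
Proof.
by rewrite linearB; apply/ffunP => k; rewrite brE !lieD_lin [RHS]ffunE [X in _ = _ + X]ffunE.
Qed.

Definition eul : PF K n := lin 1%:M.

Lemma eulE k : eul k = 'X_k.
Proof.
rewrite ffunE (bigD1 k) //= mxE eqxx scale1r big1 ?addr0 // => i ik.
by rewrite mxE (negPf ik) scale0r.
Qed.

Lemma lieD_eul d f : f \is d.-homog -> lieD eul f = d%:R *: f.
Proof.
move=> h; rewrite [in LHS](mpolyE f) linear_sum /= [in RHS](mpolyE f) scaler_sumr.
rewrite big_seq [RHS]big_seq; apply: eq_bigr => m mf.
rewrite linearZ /= scalerA mulrC -scalerA; congr (_ *: _).
rewrite /lieD; under eq_bigr => j _.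
  rewrite eulE mderivX -scalerAr -mpolyXD.
  have -> : (m j)%:R *: 'X_[U_(j) + (m - U_(j))] = (m j)%:R *: 'X_[m] :> {mpoly K[n]}.
    case: (posnP (m j)) => [->|h0]; first by rewrite !scale0r.
    by rewrite addmC submK // lep1mP -lt0n.
  over.
by rewrite -scaler_suml -natr_sum -mdegE (dhomog_mf h).
Qed.

Lemma lieD_eul_id P k : lieD P (eul k) = P k.
Proof.
rewrite eulE /lieD (bigD1 k) //= mderivXU eqxx mulr1 big1 ?addr0 // => j jk.
by rewrite mderivXU eq_sym (negPf jk) mulr0.
Qed.

Lemma br_eul d P : hom d P -> br eul P = (d%:R - 1) *: P.
Proof.
move=> h; apply/ffunP => k; rewrite brE (lieD_eul (h k)) lieD_eul_id.
by rewrite ffunE scalerBl scale1r.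
Qed.

(** The homogeneous parts of a field are eigenvectors of [br eul] for the pairwise distinct
    eigenvalues [d - 1]. *)
Lemma eul_graded (T : PF K n -> Prop) : subsp T -> (forall P, T P -> T (br eul P)) ->
  forall P d, T P -> T (hc d P).
Proof.
move=> hT Teul P d TP; have [N b] := bounded_ex P.
have [Nd|dN] := leqP N d; first by rewrite (hc_bounded b Nd); exact: subsp0.
have := @geigen_reweight _ _ (br eul) T hT Teul 1 _ (iota 0 N) (fun d => d%:R - 1)
   (fun d => hc d P) (fun c => (c == d%:R - 1)%:R).
have E (F : nat -> PF K n) : \sum_(i <- iota 0 N) F i = \sum_(i < N) F i.
  by rewrite -[N in LHS]subn0 -/(index_iota 0 N) big_mkord.
rewrite !E -hc_sum //= => /(_ _ TP).
rewrite (bigD1 (Ordinal dN)) //= eqxx scale1r big1 ?addr0 => [|e ed].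
  by apply=> e _; rewrite (br_eul (hom_hc e P)) subrr.
rewrite (inj_eq (addIr _)) eqr_nat.
by rewrite -val_eqE /= in ed; rewrite (negPf ed) scale0r.
Qed.

Lemma mderiv_eq0 f : (forall i, f^`M(i) = 0) -> (msize f <= 1)%N.
Proof.
move=> h; rewrite msizeE; apply/bigmax_leqP_seq => m mf _.
rewrite ltnS leqn0 mdeg_eq0; apply/eqP/mnmP => i; rewrite mnm0E.
apply/eqP; apply: contraTT mf => mi; rewrite mcoeff_msupp negbK.
have /mpolyP /(_ (m - U_(i))%MM) := h i; rewrite mcoeff_deriv mcoeff0.
rewrite submK ?lep1mP //; move/eqP; rewrite -mulr_natr mulf_eq0 pnatr_eq0 orbF.
exact.
Qed.

Lemma msize_mderiv f i N : (msize f <= N.+1)%N -> (msize f^`M(i) <= N)%N.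
Proof.
move=> h; rewrite msizeE; apply/bigmax_leqP_seq => m.
rewrite mcoeff_msupp mcoeff_deriv => hm _.
have : f@_(m + U_(i)) != 0 by apply: contraNneq hm => ->; rewrite mul0rn.
rewrite -mcoeff_msupp => /msize_mdeg_lt; rewrite mdegD mdeg1 addn1 => h'.
by rewrite -ltnS (leq_trans h').
Qed.

Lemma br_delta i P k : br (cst (delta_mx 0 i)) P k = (P k)^`M(i).
Proof.
rewrite br_cst (bigD1 i) //= mxE !eqxx scale1r big1 ?addr0 // => j ji.
by rewrite mxE eqxx (negPf ji) scale0r.
Qed.

Lemma bounded1_cst P : bounded 1 P -> P = cst (cvec P).
Proof. by move=> b; apply/ffunP => k; rewrite ffunE mxE -msize1_polyC. Qed.

(* A nonzero last iterated derivative is constant. *)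
Lemma descent (T : PF K n -> Prop) : (forall v P, T P -> T (br (cst v) P)) ->
  forall P, T P -> P != 0 -> exists2 v, v != 0 & T (cst v).
Proof.
move=> hT P TP P0; have [N] := bounded_ex P.
have : forall N, bounded N.+1 P -> exists2 v, v != 0 & T (cst v).
  move=> {}N; elim: N P TP P0 => [|N IH] P TP P0 b.
    have e := bounded1_cst b; exists (cvec P); last by rewrite -e.
    by apply: contraNneq P0 => h; rewrite e h linear0.
  have [h|/existsNP[i /eqP h]] := pselect (forall i, br (cst (delta_mx 0 i)) P = 0).
    apply: (IH P) => // k; apply: (@leq_trans 1) => //; apply: mderiv_eq0 => i.
    by rewrite -br_delta h ffunE.
  apply: (IH _ (hT (delta_mx 0 i) _ TP) h) => k.
  by rewrite br_delta; apply: msize_mderiv.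
by move=> h b; apply: (h N); apply: bounded_mono b.
Qed.

End PolynomialFields.

(** * The theorem of Kobayashi and Nagano *)

Section Coordinates.
Variables (K : numFieldType) (n N : nat).

Let idx := ('I_n * 'X_{1..n < N})%type.
Let m := #|{: idx}|.

Let coef (P : PF K n) : 'rV[K]_m := \row_(i < m) (P (enum_val i : idx).1)@_(bmnm (enum_val i : idx).2).
Let dec (x : 'rV[K]_m) : PF K n :=
  [ffun k => \sum_(a : 'X_{1..n < N}) x 0 (enum_rank (k, a)) *: 'X_[a]].

Let coef_is_linear : linear coef.
Proof. by move=> c P Q; apply/rowP => i; rewrite !mxE !ffunE mcoeffD mcoeffZ. Qed.
HB.instance Definition _ := GRing.isLinear.Build K _ _ _ coef coef_is_linear.

Let dec_is_linear : linear dec.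
Proof.
move=> c x y; apply/ffunP => k; rewrite !ffunE scaler_sumr -big_split /=.
by apply: eq_bigr => a _; rewrite !mxE scalerA scalerDl.
Qed.
HB.instance Definition _ := GRing.isLinear.Build K _ _ _ dec dec_is_linear.

Let coefK P : bounded N P -> dec (coef P) = P.
Proof.
move=> b; apply/ffunP => k; rewrite ffunE [RHS](mpolywE (b k)).
by apply: eq_bigr => a _; rewrite mxE enum_rankK.
Qed.

Let decK x : coef (dec x) = x.
Proof.
apply/rowP => i; rewrite mxE ffunE raddf_sum /=.
case E: (enum_val i) => [k a] /=; rewrite (bigD1 a) //= big1 => [|b ba].
  by rewrite mcoeffZ mcoeffX eqxx mulr1 addr0 -E enum_valK.
by rewrite mcoeffZ mcoeffX (inj_eq val_inj) (negPf ba) mulr0.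
Qed.

(** Bounded fields are identified with vectors of coefficients, so that traces and ranks become
    available. [psi] is defined on all fields, but inverts [phi] on the right only on [T]. *)
Lemma coordinates (T : PF K n -> Prop) : subsp T -> (forall P, T P -> bounded N P) ->
  exists d (phi : {linear 'rV[K]_d -> PF K n}) (psi : {linear PF K n -> 'rV[K]_d}),
  [/\ forall x, T (phi x), cancel phi psi & forall P, T P -> phi (psi P) = P].
Proof.
move=> hT bT.
have hS : subsp (fun x => T (dec x)).
  split=> [|c x y hx hy]; rewrite ?linear0 ?linearP; first exact: subsp0.
  exact: hT.2.
have [d [B [fB hB]]] := subsp_rowspace hS.
exists d, (dec \o mulmxr B), (mulmxr (pinvmx B) \o coef); split=> [x|x|P TP] /=.
- by apply/hB; exact: submxMl.
- by rewrite decK mulmxKp.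
- have e : T (dec (coef P)) by rewrite coefK //; exact: bT.
  by rewrite mulmxKpV ?coefK //; [exact: bT | apply/hB].
Qed.

End Coordinates.

Section VectorFieldAlgebras.
Variables (K : numFieldType) (n : nat).
Implicit Types (P Q : PF K n) (L : PF K n -> Prop).

Definition pflie L := subsp L /\ forall P Q, L P -> L Q -> L (br P Q).
Definition pfgraded L := forall P d, L P -> L (hc d P).
Definition has_cst L := forall v, L (cst v).
Definition linpart L : 'M[K]_n -> Prop := fun A => L (lin A).
Definition transl_gen L P := [\/ exists v, P = cst v, L P /\ hom 2 P |
  exists v X, [/\ L X, hom 2 X & P = br (cst v) X]].

Lemma linpart_subsp L : subsp L -> subsp (linpart L).
Proof.
move=> hL; split=> [|c A B hA hB]; rewrite /linpart ?linear0 ?linearP; first exact: subsp0.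
exact: hL.2.
Qed.

Lemma linpart_br L A B : pflie L -> linpart L A -> linpart L B -> linpart L (A *m B - B *m A).
Proof. by move=> hL hA hB; rewrite /linpart -br_lin_lin; apply: hL.2. Qed.

Lemma br_cst_eq0 P : (forall v, br (cst v) P = 0) -> P = cst (cvec P).
Proof.
move=> h; apply: bounded1_cst => k; apply: mderiv_eq0 => i.
by rewrite -br_delta h ffunE.
Qed.

Lemma graded_eul L P : subsp L -> pfgraded L -> L P -> L (br (eul K n) P).
Proof.
move=> hL gL LP; have [N b] := bounded_ex P; rewrite (hc_sum b) br_sumr.
apply: subsp_sum => // d _; rewrite (br_eul (hom_hc _ _)).
by apply: subspZ => //; exact: gL.
Qed.

Lemma hom_ne0 d P : hom d.+1 P -> (forall v, br (cst v) P = 0) -> P = 0.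
Proof.
move=> h /br_cst_eq0 e; rewrite -(hc_hom h) e.
by apply: hc_hom_ne (hom_cst _) _.
Qed.

End VectorFieldAlgebras.

Section KobayashiNagano.
Variables (K : numClosedFieldType) (n' : nat).
Local Notation n := n'.+1.
Implicit Types (P Q S X y : PF K n) (v w u : 'rV[K]_n) (A B C : 'M[K]_n) (T : PF K n -> Prop).
Variables (L L' : PF K n -> Prop) (N : nat).
Hypotheses (hL : pflie L) (gL : pfgraded L) (VL : has_cst L) (irrL : mxirr (linpart L)).
Hypothesis L1 : exists X, [/\ L X, hom 2 X & X != 0].
Hypotheses (hL' : pflie L') (gL' : pfgraded L') (LL' : forall P, L P -> L' P)
  (bL' : forall P, L' P -> bounded N P).

Let J := spn (transl_gen L).
Let sL := hL.1.
Let sJ : subsp J := spn_subsp _.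
Let sL' := hL'.1.

Let JL P : J P -> L P.
Proof.
move=> h; apply: h => // Q [[v ->]|[]//|[v [X [LX _ ->]]]]; first exact: VL.
exact: hL.2.
Qed.

Let J_cst v : J (cst v).
Proof. by apply: spn_sub; constructor 1; exists v. Qed.

Let J_quad X : L X -> hom 2 X -> J X.
Proof. by move=> LX hX; apply: spn_sub; constructor 2. Qed.

Let J_br v X : L X -> hom 2 X -> J (br (cst v) X).
Proof. by move=> LX hX; apply: spn_sub; constructor 3; exists v, X. Qed.

Let subsp_br T P : subsp T -> subsp (fun y => T (br P y)).
Proof.
move=> hT; split=> [|c x y hx hy]; rewrite ?linear0 ?linearP; first exact: subsp0.
exact: hT.2.
Qed.

Let J_stab_cst v y : J y -> J (br (cst v) y).
Proof.
move=> h; apply: (h (fun y => J (br (cst v) y))); first exact/subsp_br/spn_subsp.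
move=> Q [[w ->]|[LQ hQ]|[w [X [LX hX ->]]]].
- by rewrite br_cst_cst; apply: subsp0; exact: spn_subsp.
- exact: J_br.
- have h0 : hom 0 (br (cst v) (br (cst w) X)).
    exact: (hom_br (hom_cst v) (hom_br (hom_cst w) hX)).
  by rewrite (hom0P h0).
Qed.

Let lin_quad A X : linpart L A -> L X -> hom 2 X ->
  L (br (lin A) X) /\ hom 2 (br (lin A) X).
Proof.
move=> hA LX hX; split; first exact: hL.2.
exact: (hom_br (hom_lin A) hX).
Qed.

Let J_stab_lin A y : linpart L A -> J y -> J (br (lin A) y).
Proof.
move=> hA h; apply: (h (fun y => J (br (lin A) y))); first exact/subsp_br/spn_subsp.
move=> Q [[w ->]|[LQ hQ]|[w [X [LX hX ->]]]].
- by rewrite br_lin_cst -linearN; exact: J_cst.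
- by have [? ?] := lin_quad hA LQ hQ; exact: J_quad.
- have [? ?] := lin_quad hA LX hX.
  rewrite jacobi br_lin_cst brNl; apply: (subspD sJ); last exact: J_br.
  by apply: (subspN sJ); exact: J_br.
Qed.

Section Trace.
Variables (d : nat) (phi : {linear 'rV[K]_d.+1 -> PF K n}) (psi : {linear PF K n -> 'rV[K]_d.+1}).
Hypotheses (Lphi : forall x, L' (phi x)) (phiK : cancel phi psi)
  (psiK : forall P, L' P -> phi (psi P) = P).

(** The Killing form is needed on the Euler field before it is known to lie in [L'], so that [ad]
    and [kap] are considered on the normalizer of [L']. *)
Let norm P := forall Q, L' Q -> L' (br P Q).

Let ad P : 'M[K]_d.+1 := lin1_mx (psi \o br P \o phi).

Let adE x P : x *m ad P = psi (br P (phi x)).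
Proof. by rewrite mul_rV_lin1. Qed.

Let ad_is_linear : linear ad.
Proof.
move=> c P Q; apply: mulmx_row_eq => x.
by rewrite mulmxDr -scalemxAr !adE br_lin_l linearP.
Qed.
HB.instance Definition _ := GRing.isLinear.Build K _ _ _ ad ad_is_linear.

Let L'norm P : L' P -> norm P.
Proof. by move=> LP Q LQ; exact: hL'.2. Qed.

Let eul_norm : norm (eul K n).
Proof. by move=> Q LQ; apply: graded_eul. Qed.

(** The product is reversed because matrices act on rows from the right. *)
Let ad_br P Q : norm P -> norm Q -> ad (br P Q) = ad Q *m ad P - ad P *m ad Q.
Proof.
move=> nP nQ; apply: mulmx_row_eq => x.
rewrite mulmxBr !mulmxA !adE jacobi' linearB /= psiK; last exact: nQ.
by rewrite psiK //; exact: nP.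
Qed.

(* The Killing form of L'. Its radical relative to the ideal J is zero, since
   otherwise it contains V, hence V is orthogonal to L, [V, L_1] acts nilpotently
   by Cartan's criterion, and Engel's theorem contradicts irreducibility. *)
Let kap P Q := \tr (ad P *m ad Q).

Let kap_lin_l c P P' Q : kap (c *: P + P') Q = c * kap P Q + kap P' Q.
Proof. by rewrite /kap linearP mulmxDl -scalemxAl mxtraceD mxtraceZ. Qed.
Let kap_lin_r P c Q Q' : kap P (c *: Q + Q') = c * kap P Q + kap P Q'.
Proof. by rewrite /kap linearP mulmxDr -scalemxAr mxtraceD mxtraceZ. Qed.
Let kap0l P : kap 0 P = 0. Proof. by rewrite /kap linear0 mul0mx linear0. Qed.
Let kap0r P : kap P 0 = 0. Proof. by rewrite /kap linear0 mulmx0 linear0. Qed.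
Let kapN P Q : kap (- P) Q = - kap P Q.
Proof. by rewrite /kap linearN mulNmx linearN. Qed.
Let kap_sumr (I : Type) (r : seq I) (F : I -> PF K n) P :
  kap P (\sum_(i <- r) F i) = \sum_(i <- r) kap P (F i).
Proof.
elim: r => [|i r IH]; first by rewrite !big_nil kap0r.
by rewrite !big_cons -IH -[F i]scale1r kap_lin_r mul1r scale1r.
Qed.
Let kap_suml (I : Type) (r : seq I) (F : I -> PF K n) P :
  kap (\sum_(i <- r) F i) P = \sum_(i <- r) kap (F i) P.
Proof.
elim: r => [|i r IH]; first by rewrite !big_nil kap0l.
by rewrite !big_cons -IH -[F i]scale1r kap_lin_l mul1r scale1r.
Qed.
Let kapZl c P Q : kap (c *: P) Q = c * kap P Q.
Proof. by rewrite -[c *: P]addr0 kap_lin_l kap0l addr0. Qed.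
Let kapZr c P Q : kap P (c *: Q) = c * kap P Q.
Proof. by rewrite -[c *: Q]addr0 kap_lin_r kap0r addr0. Qed.

Let kap_inv P Q S : norm P -> norm Q -> norm S -> kap (br P Q) S = kap P (br Q S).
Proof.
move=> nP nQ nS; rewrite /kap !ad_br // mulmxBl mulmxBr !linearB /=; congr (_ - _).
  by rewrite -mulmxA mxtrace_mulC mulmxA.
by rewrite mulmxA.
Qed.

(** Invariance under the Euler field gives [(a + b - 2) * kap P Q = 0], where [a - 1] and [b - 1]
    are the eigenvalues of [P] and [Q]. *)
Let kap_deg a b P Q : norm P -> norm Q -> hom a P -> hom b Q -> (a + b)%N != 2%N ->
  kap P Q = 0.
Proof.
move=> nP nQ hP hQ ab; set E := eul K n.
have eP : ad P *m ad E - ad E *m ad P = (a%:R - 1) *: ad P.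
  by rewrite -ad_br // /E (br_eul hP) linearZ.
have eQ : ad Q *m ad E - ad E *m ad Q = (b%:R - 1) *: ad Q.
  by rewrite -ad_br // /E (br_eul hQ) linearZ.
have : \tr (ad P *m (ad Q *m ad E - ad E *m ad Q) + (ad P *m ad E - ad E *m ad P) *m ad Q) = 0.
  rewrite mulmxBr mulmxBl !mulmxA addrA subrK linearB /=.
  by rewrite -(mulmxA (ad E)) [X in _ - X]mxtrace_mulC subrr.
rewrite eP eQ -scalemxAr -scalemxAl -scalerDl linearZ /= => /eqP.
rewrite mulf_eq0 => /orP[|/eqP //].
rewrite addrACA -opprD -natrD addnC subr_eq0 -(natrD _ 1 1) eqr_nat.
by rewrite (negPf ab).
Qed.

Let kill P := L' P /\ forall y, J y -> kap P y = 0.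

Let kill_subsp : subsp kill.
Proof.
split=> [|c P Q [LP hP] [LQ hQ]]; first by split=> [|y _]; [exact: subsp0 | exact: kap0l].
by split=> [|y Jy]; [exact: sL'.2 | rewrite kap_lin_l /= hP ?hQ // mulr0 addr0].
Qed.

Let J_norm y : J y -> norm y. Proof. by move=> /JL/LL'; exact: L'norm. Qed.

Let kill_stab Q P : norm Q -> L' (br Q P) -> (forall y, J y -> J (br Q y)) ->
  kill P -> kill (br Q P).
Proof.
move=> nQ LQP JQ [LP hP]; split=> // y Jy.
rewrite br_anti kapN (kap_inv (L'norm LP) nQ (J_norm Jy)).
by rewrite (hP _ (JQ _ Jy)) oppr0.
Qed.

Let cst_norm v : norm (cst v).
Proof. exact/L'norm/LL'/VL. Qed.

Let kill_cst v P : kill P -> kill (br (cst v) P).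
Proof.
move=> kP; refine (kill_stab (@cst_norm v) _ _ kP).
  exact: hL'.2 (LL' (VL v)) kP.1.
by move=> y; exact: J_stab_cst.
Qed.

Let kill_lin A P : linpart L A -> kill P -> kill (br (lin A) P).
Proof.
move=> hA kP; refine (kill_stab (L'norm (LL' hA)) _ _ kP).
  exact: hL'.2 (LL' hA) kP.1.
by move=> y; exact: J_stab_lin.
Qed.

Let cst_not_orthogonal : ~ forall v y, L y -> kap (cst v) y = 0.
Proof.
move=> h.
pose h0 := spn (fun P => exists v X, [/\ L X, hom 2 X & P = br (cst v) X]).
have sh0 : subsp h0 := spn_subsp _.
have h0L P : h0 P -> L P.
  by move=> hP; apply: hP => // Q [v [X [LX _ ->]]]; apply: hL.2.
pose g m := exists2 P, L P & m = ad P.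
pose R m := exists v, m = ad (cst v).
pose G c := exists r m, [/\ R r, g m & c = r *m m - m *m r].
have ad_nil P : h0 P -> ad P ^+ d.+1 = 0.
  move=> hP; apply: (@cartan_nilpotent _ _ g R).
  - split=> [|c m m' [P' LP ->] [Q LQ ->]].
      by exists 0; rewrite ?linear0 //; exact: subsp0.
    by exists (c *: P' + Q); rewrite ?linearP //; apply: sL.2.
  - move=> m m' [P' LP ->] [Q LQ ->]; exists (br Q P'); first exact: hL.2.
    by rewrite (ad_br (L'norm (LL' LQ)) (L'norm (LL' LP))).
  - by move=> r [v ->]; exists (cst v).
  - by move=> r b [v ->] [Q LQ ->]; exact: h.
  apply: (hP (fun P => spn G (ad P))).
    split=> [|c x y hx hy]; rewrite ?linear0 ?linearP; first exact: subsp0 (spn_subsp _).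
    by apply: (spn_subsp G).2.
  move=> Q [v [X [LX _ ->]]]; rewrite br_anti linearN; apply: (subspN (spn_subsp G)).
  apply: spn_sub; exists (ad (cst v)), (ad X); split; [by exists v | by exists X |].
  by rewrite -[LHS]/(ad _) (ad_br (L'norm (LL' LX)) (@cst_norm v)).
pose I A := h0 (lin A).
have I0 A : I A -> A = 0.
  apply: (nil_ideal_eq0 irrL).
  - split=> [|c x y hx hy]; rewrite /I ?linear0 ?linearP; first exact: subsp0 sh0.
    exact: (sh0.2 c _ _ hx hy).
  - by move=> B hB; exact: h0L.
  - move=> B C hB hC; rewrite /I -br_lin_lin br_anti; apply: (subspN sh0).
    apply: (hB (fun P => h0 (br (lin C) P))); first exact: subsp_br sh0.
    move=> Q [v [X [LX hX ->]]]; have [? ?] := lin_quad hC LX hX.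
    rewrite jacobi br_lin_cst brNl; apply: (subspD sh0).
      apply: (subspN sh0).
      by apply: spn_sub; exists (v *m C), X.
    by apply: spn_sub; exists v, (br (lin C) X).
  - move=> B hB; exists d.+1; have hn := ad_nil _ hB.
    apply/row_matrixP => i; rewrite rowE row0; set v := delta_mx 0 i.
    (* Nilpotency on [L'] is transferred to the matrix [B] by restriction to the constant fields, on
       which [lin B] acts as [- B]. *)
    have it k : psi (cst v) *m ad (lin B) ^+ k = (-1) ^+ k *: psi (cst (v *m B ^+ k)).
      elim: k => [|k IH]; first by rewrite !expr0 !mulmx1 scale1r.
      rewrite exprSr -mulmxE mulmxA IH -scalemxAl adE psiK; last exact: LL'.
      rewrite br_lin_cst linearN /= scalerN [(-1) ^+ k.+1]exprS mulN1r scaleNr.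
      by rewrite -mulmxA mulmxE -exprSr.
    have := it d.+1; rewrite hn mulmx0 => /esym/eqP; rewrite scaler_eq0.
    rewrite expf_eq0 oppr_eq0 oner_eq0 andbF /= => /eqP h1.
    have h2 : cst (v *m B ^+ d.+1) = 0 by rewrite -[LHS]psiK ?h1 ?linear0 //; exact: LL'.
    by rewrite -[LHS]cstK h2 linear0.
have [X [LX hX X0]] := L1.
move/eqP: X0; apply; apply: (hom_ne0 hX) => v.
have h1 : hom 1 (br (cst v) X) := hom_br (hom_cst v) hX.
rewrite (hom1P h1) (I0 (lmat _)) ?linear0 // /I -(hom1P h1).
by apply: spn_sub; exists v, X.
Qed.

Let nondeg P : kill P -> P = 0.
Proof.
move=> kP; apply: contrapT => /eqP P0; apply: cst_not_orthogonal.
have [v v0 kv] := descent kill_cst kP P0.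
have kall : forall v, kill (cst v).
  apply: (irrL (U := fun v => kill (cst v))); last by exists v.
    split=> [|c x y hx hy]; rewrite ?linear0 ?linearP; first exact: (subsp0 kill_subsp).
    exact: kill_subsp.2.
  move=> A u hA ku; rewrite -[cst _]opprK -br_lin_cst -scaleN1r.
  by apply: (subspZ kill_subsp); exact: kill_lin.
move=> u y Ly; have [M b] := bounded_ex y; rewrite (hc_sum b).
rewrite kap_sumr big1 // => e _.
have Le : L (hc e y) by exact: gL.
have he := @hom_hc _ _ e y.
(* Constant fields pair nontrivially only with quadratic ones, and those of [L] lie in [J], to which
   [cst u] is orthogonal. *)
have [e2|e2] := eqVneq (e : nat) 2%N.
  by apply: (kall u).2; apply: J_quad => //; rewrite e2 in he *.
by apply: (kap_deg _ _ (hom_cst u) he); [exact: cst_norm | apply: L'norm; apply: LL' |].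
Qed.

(** By [nondeg] the pairing of [L'] with [J] has no left kernel, so that the subspace [J] has at
    least the dimension of [L']. *)
Let J_all P : L' P -> J P.
Proof.
move=> LP; have hJ : subsp (fun x => J (phi x)).
  split=> [|c x y hx hy]; rewrite ?linear0 ?linearP; first exact: subsp0 sJ.
  exact: sJ.2.
have [r [B [fB hB]]] := subsp_rowspace hJ.
pose F : 'M[K]_(d.+1, r) := \matrix_(i, j) kap (phi (delta_mx 0 i)) (phi (row j B)).
have FE x j : (x *m F) 0 j = kap (phi x) (phi (row j B)).
  rewrite mxE {2}(row_sum_delta x) linear_sum kap_suml; apply: eq_bigr => i _.
  by rewrite linearZ kapZl mxE.
have kerF (x : 'rV_d.+1) : x *m F = 0 -> x = 0.
  move=> hx.
  suff /nondeg h : kill (phi x) by rewrite -(phiK x) h linear0.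
  split=> // y Jy; have Ly : L' y := LL' (JL Jy).
  have : J (phi (psi y)) by rewrite psiK.
  move=> /hB/submxP[c hc]; rewrite -(psiK Ly) hc mulmx_sum_row linear_sum.
  rewrite kap_sumr big1 // => j _; rewrite linearZ kapZr.
  by rewrite -FE hx mxE mulr0.
have : row_free (F).
  rewrite -kermx_eq0; apply/rowV0P => x /sub_kermxP; exact: kerF.
rewrite /row_free => /eqP rk; have := rank_leq_col (F); rewrite rk => dr.
have fullB : row_full B.
  by rewrite /row_full (eqP fB) eqn_leq dr andbT -(eqP fB) rank_leq_col.
by rewrite -(psiK LP); apply/hB; exact: submx_full.
Qed.

(** The form is nondegenerate on [L'], so that some [e] in [L'] pairs with [L'] as the Euler field
    does. The brackets of [e - eul] with constant fields are orthogonal to [J], hence zero; so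
    [e - eul] is constant. *)
Let eul_in : L' (eul K n).
Proof.
pose F : 'M[K]_d.+1 := \matrix_(i, j) kap (phi (delta_mx 0 i)) (phi (delta_mx 0 j)).
have FE x j : (x *m F) 0 j = kap (phi x) (phi (delta_mx 0 j)).
  rewrite mxE {2}(row_sum_delta x) linear_sum kap_suml; apply: eq_bigr => i _.
  by rewrite linearZ kapZl mxE.
have kapx x z : kap (phi x) (phi z) = (x *m F *m z^T) 0 0.
  rewrite {1}(row_sum_delta z) linear_sum kap_sumr mxE; apply: eq_bigr => j _.
  by rewrite linearZ kapZr FE mxE mulrC.
have : F \in unitmx.
  rewrite -row_free_unit -kermx_eq0; apply/rowV0P => x /sub_kermxP hx.
  suff /nondeg h : kill (phi x) by rewrite -(phiK x) h linear0.
  split=> // y Jy; have Ly : L' y := LL' (JL Jy).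
  by rewrite -(psiK Ly) kapx hx mul0mx mxE.
move=> Fu; pose t : 'rV[K]_d.+1 := \row_j kap (eul K n) (phi (delta_mx 0 j)).
pose e := phi (t *m invmx (F)).
have Le : L' e by exact: Lphi.
have ke y : L' y -> kap (e - eul K n) y = 0.
  move=> Ly; rewrite -scaleN1r addrC kap_lin_l /= -(psiK Ly) kapx mulmxKV //.
  rewrite {1}(row_sum_delta (psi y)) linear_sum.
  rewrite kap_sumr mxE mulN1r; apply/eqP.
  rewrite addrC subr_eq0; apply/eqP/eq_bigr => j _.
  by rewrite linearZ kapZr !mxE mulrC.
have ne : norm (e - eul K n).
  move=> Q LQ; rewrite brBl; apply: subspB => //; first exact: hL'.2.
  exact: eul_norm.
have cst0 v : br (cst v) (e - eul K n) = 0.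
  rewrite br_anti; apply/eqP; rewrite oppr_eq0; apply/eqP/nondeg; split.
    by apply: ne; apply: LL'.
  move=> y Jy; rewrite (kap_inv ne (@cst_norm v) (J_norm Jy)).
  by apply: ke; apply: hL'.2; [apply: LL' | apply/LL'/JL].
have h := br_cst_eq0 cst0.
rewrite (_ : eul K n = e - cst (cvec (e - eul K n))); last by rewrite -h opprB addrC subrK.
by apply: subspB => //; apply: LL'.
Qed.

Lemma kn_trace : (forall P, L' P -> J P) /\ L' (eul K n).
Proof. by split; [exact: J_all | exact: eul_in]. Qed.
End Trace.

Theorem kobayashi_nagano : (forall P, L' P -> spn (transl_gen L) P) /\ L' (eul K n).
Proof.
have [d [phi [psi [h1 h2 h3]]]] := coordinates sL' bL'.
case: d phi psi h1 h2 h3 => [|d] phi psi h1 h2 h3; last exact: kn_trace h1 h2 h3.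
exfalso; pose v : 'rV[K]_n := delta_mx 0 0.
have e : cst v = 0 by rewrite -[LHS]h3 ?(thinmx0 (psi _)) ?linear0 //; exact: LL'.
have := congr1 (@cvec _ _) e; rewrite cstK linear0 => /rowP /(_ 0) /eqP.
by rewrite !mxE !eqxx oner_eq0.
Qed.

End KobayashiNagano.

(** * Unbounded subalgebras *)

Section RankOneFields.
Variables (K : numFieldType) (n : nat).
Implicit Types (P Q : PF K n) (f g : {mpoly K[n]}) (c xi : 'cV[K]_n) (v w : 'rV[K]_n).

Definition ell xi : {mpoly K[n]} := \sum_i xi i 0 *: 'X_i.
Definition powf d xi w : PF K n := [ffun k => w 0 k *: ell xi ^+ d].
Definition der i P : PF K n := br (cst (delta_mx 0 i)) P.

Lemma derE i P k : der i P k = (P k)^`M(i).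
Proof. exact: br_delta. Qed.

Lemma der_comm i j P : der i (der j P) = der j (der i P).
Proof. by apply/ffunP => k; rewrite !derE mderiv_comm. Qed.

Lemma der_is_linear i : linear (der i).
Proof. by move=> a P Q; rewrite /der linearP. Qed.
HB.instance Definition _ i := GRing.isLinear.Build K _ _ _ (der i) (der_is_linear i).

Lemma der_lin i a P Q : der i (a *: P + Q) = a *: der i P + der i Q.
Proof. exact: der_is_linear. Qed.
Lemma der0 i : der i 0 = 0. Proof. exact: linear0. Qed.
Lemma derB i P Q : der i (P - Q) = der i P - der i Q.
Proof. by rewrite -scaleN1r addrC der_lin scaleN1r addrC. Qed.
Lemma der2B i P Q : der i (der i (P - Q)) = der i (der i P) - der i (der i Q).
Proof. by rewrite !derB. Qed.
Lemma derZ i a P : der i (a *: P) = a *: der i P.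
Proof. by rewrite -[a *: P]addr0 der_lin der0 addr0. Qed.

Lemma hom_der d i P : hom d P -> hom d.-1 (der i P).
Proof. by move=> h k; rewrite derE; exact: mderiv_homog. Qed.

Lemma der_ne0 d P : hom d.+1 P -> P != 0 -> exists i, der i P != 0.
Proof.
move=> hP P0; apply: contrapT => /forallNP h; move/eqP: P0; apply.
have b : bounded 1 P.
  move=> k; apply: mderiv_eq0 => i; rewrite -derE.
  by have /negP := h i; rewrite negbK => /eqP ->; rewrite ffunE.
rewrite -(hc_hom hP) (bounded1_cst b).
by apply: hc_hom_ne (hom_cst _) _.
Qed.

Lemma mderiv_ell i xi : (ell xi)^`M(i) = (xi i 0)%:MP.
Proof.
rewrite /ell (raddf_sum (mderiv i)) (bigD1 i) //= big1 => [|j ji].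
  by rewrite mderivZ mderivXU eqxx addr0 -mul_mpolyC mulr1.
by rewrite mderivZ mderivXU (negPf ji) scaler0.
Qed.

Lemma mderiv_ellX i xi d : (ell xi ^+ d.+1)^`M(i) = (d.+1%:R * xi i 0) *: ell xi ^+ d.
Proof.
elim: d => [|d IH]; first by rewrite expr1 mderiv_ell mul1r expr0 -mul_mpolyC mulr1.
rewrite exprS mderivM IH mderiv_ell mul_mpolyC -scalerAr -exprS -scalerDl.
by congr (_ *: _); rewrite -[in RHS]natr1; ring.
Qed.

Lemma der_powf i d xi w : der i (powf d.+1 xi w) = (d.+1%:R * xi i 0) *: powf d xi w.
Proof.
apply/ffunP => k; rewrite derE [in RHS]ffunE !ffunE mderivZ mderiv_ellX !scalerA.
by rewrite mulrC.
Qed.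

Lemma lieD_eul_der f : lieD (eul K n) f = \sum_i 'X_i * f^`M(i).
Proof. by apply: eq_bigr => i _; rewrite eulE. Qed.

(** Euler's identity expresses [f], up to its degree, as [ell xi] times its derivative along [i0],
    which satisfies the same relations in lower degree. *)
Lemma proportional_derivs d f xi i0 : f \is d.-homog -> xi i0 0 = 1 ->
  (forall i, f^`M(i) = xi i 0 *: f^`M(i0)) -> exists a, f = a *: ell xi ^+ d.
Proof.
move=> hf x1; elim: d f hf => [|d IH] f hf hd.
  exists f@_0; rewrite expr0 -mul_mpolyC mulr1; apply: msize1_polyC.
  by rewrite msizeE; apply/bigmax_leqP_seq => m mf _; rewrite ltnS (dhomog_mf hf).
have [a ha] : exists a, f^`M(i0) = a *: ell xi ^+ d.
  apply: IH; first exact: (mderiv_homog i0 hf).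
  by move=> i; rewrite mderiv_comm hd mderivZ.
exists (a / d.+1%:R); have := lieD_eul hf; rewrite lieD_eul_der.
under eq_bigr do rewrite hd ha scalerA -scalerAr mulrC -scalerA scalerAl.
rewrite -scaler_sumr -mulr_suml -/(ell xi) -exprS => h.
have d0 : d.+1%:R != 0 :> K by rewrite pnatr_eq0.
by rewrite mulrC -scalerA h scalerA mulVf // scale1r.
Qed.

End RankOneFields.

(** * Fields of rank one in every degree *)

Section Search.
Variables (K : numClosedFieldType) (n : nat).
Implicit Types (P Q : PF K n) (W : PF K n -> Prop).

Definition unbounded W := forall N, exists P, [/\ W P, hom N P & P != 0].

(* If the last partial derivative d has an unbounded kernel in W, pass to this
   kernel. Otherwise d is injective, hence eventually bijective, between
   consecutive homogeneous components of W; the operators d^-1 d_i then commute,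
   and a common eigenvector of them is a field with proportional derivatives. *)
Lemma rank_one_field W : subsp W -> (forall v P, W P -> W (br (cst v) P)) ->
  unbounded W -> forall N, exists xi w, [/\ xi != 0, w != 0 & W (powf N xi w)].
Proof.
move=> hW dW uW N.
(* The induction is on the number [m] of variables on which the fields of [W] may depend; it starts
   from this void condition for [m = n]. *)
have : forall P (i : 'I_n), W P -> (n <= i)%N -> der i P = 0.
  by move=> P i _; rewrite leqNgt ltn_ord.
suff gen m : (m <= n)%N -> (forall P (i : 'I_n), W P -> (m <= i)%N -> der i P = 0) ->
    exists xi w, [/\ xi != 0, w != 0 & W (powf N xi w)] by exact: gen.
elim: m W hW dW uW => [|m IH] W hW dW uW mn W0.
  have [P [WP hP P0]] := uW 1%N; have [i hi] := der_ne0 hP P0.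
  by rewrite W0 ?eqxx in hi.
pose i0 := Ordinal mn.
have Wder i P : W P -> W (der i P) by exact: dW.
pose W' P := W P /\ der i0 P = 0.
have hW' : subsp W'.
  split=> [|c x y [hx ex] [hy ey]]; first by split; [exact: subsp0 | exact: der0].
  by split; [exact: hW.2 | rewrite der_lin ex ey scaler0 addr0].
have dW' v P : W' P -> W' (br (cst v) P).
  move=> [WP e]; split; first exact: dW.
  rewrite /der jacobi br_cst_cst br0l add0r -/(der i0 P) e.
  exact: (linear0 (br (cst v))).
have [u'|] := pselect (unbounded W').
  have [|P i [WP e]|xi [w [x0 w0 [h _]]]] := IH W' hW' dW' u'; first exact: ltnW.
    rewrite leq_eqVlt => /predU1P[mi|]; last exact: W0.
    by rewrite (_ : i = i0) //; apply: val_inj.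
  by exists xi, w.
move=> /existsNP[N0 /forallNP hN0].
(* Injectivity in degree [N0] propagates upwards: the derivatives of a field killed by [der i0] are
   killed as well. *)
have inj0 a P : W P -> hom (N0 + a) P -> der i0 P = 0 -> P = 0.
  elim: a P => [|a IHa] P WP hP e.
    apply: contrapT => /eqP P0; apply: (hN0 P); split=> //.
    by rewrite addn0 in hP.
  apply: contrapT => /eqP P0; rewrite addnS in hP; have [i hi] := der_ne0 hP P0.
  move/eqP: hi; apply; apply: IHa; [exact: Wder | exact: (hom_der i hP) |].
  by rewrite der_comm e der0.
pose Wh a P := W P /\ hom (N0 + a) P.
have hWh a : subsp (Wh a).
  split=> [|c x y [hx ex] [hy ey]].
    by split; [exact: subsp0 | exact: (subsp0 (@hom_subsp K n _))].
  by split; [exact: hW.2 | apply: (@hom_subsp K n _).2].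
pose crd a d (phi : {linear 'rV[K]_d -> PF K n}) (psi : {linear PF K n -> 'rV[K]_d}) :=
  [/\ forall x, Wh a (phi x), cancel phi psi & forall P, Wh a P -> phi (psi P) = P].
have /choice[dm hdm] : forall a, exists d, exists phi psi, @crd a d phi psi.
  move=> a; apply: (coordinates (hWh a) (N := (N0 + a).+1)) => P [_ hP].
  exact: hom_bounded hP.
pose D a (phi : {linear 'rV[K]_(dm a.+1) -> PF K n}) (psi : {linear PF K n -> 'rV[K]_(dm a)}) i :
  'M[K]_(dm a.+1, dm a) := lin1_mx (psi \o der i \o phi).
have WhS a i P : Wh a.+1 P -> Wh a (der i P).
  by move=> [WP hP]; split; [exact: Wder | rewrite addnS in hP; exact: (hom_der i hP)].
have freeD a phi psi phi' psi' : @crd a.+1 _ phi' psi' -> @crd a _ phi psi ->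
    row_free (D a phi' psi i0).
  move=> [h1' h2' h3'] [h1 h2 h3]; rewrite -kermx_eq0; apply/rowV0P => x /sub_kermxP.
  rewrite mul_rV_lin1 /= => hx.
  have e : der i0 (phi' x) = 0 by rewrite -[LHS]h3 ?hx ?linear0 //; exact/WhS/h1'.
  have [Wx hx'] := h1' x.
  by rewrite -(h2' x) (inj0 _ _ Wx hx' e) linear0.
have dmS a : (dm a.+1 <= dm a)%N.
  have [phi [psi c]] := hdm a; have [phi' [psi' c']] := hdm a.+1.
  have := freeD _ _ _ _ _ c' c; rewrite /row_free => /eqP rk.
  by have := rank_leq_col (D a phi' psi i0); rewrite rk.
(* The dimensions do not increase with the degree, so they are constant from some point on, where
   the injections become bijections. *)
have [a1 ha1] : exists a1, forall a, (a1 <= a)%N -> dm a = dm a1.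
  have ex : exists x, `[< exists a, dm a = x >] by exists (dm 0%N); apply/asboolP; exists 0%N.
  case: (ex_minnP ex) => x /asboolP[a1 e1] hmin; exists a1 => a a1a.
  apply/eqP; rewrite eqn_leq e1 hmin ?andbT; last by apply/asboolP; exists a.
  elim: a a1a => [|a IHa]; first by rewrite leqn0 => /eqP e; rewrite -e1 e.
  rewrite leq_eqVlt => /predU1P[<-|]; first by rewrite e1.
  by rewrite ltnS => /IHa; apply: leq_trans.
(* Large enough for the dimensions to be constant, and above [N], so that the degree [N] is reached
   by differentiating. *)
pose a := (a1 + N).+1.
have [phi [psi [h1 h2 h3]]] := hdm a; have [phi' [psi' [h1' h2' h3']]] := hdm a.+1.
have e : dm a.+1 = dm a by rewrite !ha1 ?leq_addr // /a -?addnS leq_addr.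
pose T i : 'M[K]_(dm a.+1) := D a phi' psi i *m pinvmx (D a phi' psi i0).
have full0 : row_full (D a phi' psi i0).
  have := freeD _ _ _ _ _ (And3 h1' h2' h3') (And3 h1 h2 h3).
  by rewrite /row_free /row_full => /eqP ->; rewrite e.
have TE i x : der i0 (phi' (x *m T i)) = der i (phi' x).
  have d0 y j : psi (der j (phi' y)) = y *m D a phi' psi j by rewrite mul_rV_lin1.
  have key y j : phi (psi (der j (phi' y))) = der j (phi' y) by apply/h3/WhS/h1'.
  by rewrite -key -[RHS]key !d0 /T mulmxA mulmxKpV //; exact: submx_full.
(* Both products become the same second derivative of [phi' x] after two applications of [der i0],
   which is injective in both degrees. *)
have Tcomm i j : T i *m T j = T j *m T i.
  apply: mulmx_row_eq => x.
  rewrite (mulmxA x (T i)) (mulmxA x (T j)); apply: (can_inj h2').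
  apply/eqP; rewrite -subr_eq0; apply/eqP.
  have [Wx hx] := subspB (hWh _) (h1' (x *m T i *m T j)) (h1' (x *m T j *m T i)).
  apply: (inj0 a.+1) => //; apply: (inj0 a).
  - exact: Wder.
  - by rewrite addnS in hx; exact: (hom_der i0 hx).
  have TT k l : der i0 (der i0 (phi' (x *m T k *m T l))) = der l (der k (phi' x)).
    by rewrite (TE l (x *m T k)) der_comm (TE k x).
  rewrite (der2B i0 (phi' (x *m T i *m T j)) (phi' (x *m T j *m T i))).
  apply/eqP; rewrite subr_eq0; apply/eqP.
  exact: etrans (TT i j) (etrans (der_comm j i _) (esym (TT j i))).
have [P [WP hP P0]] := uW (N0 + a.+1)%N.
have dpos : (0 < dm a.+1)%N.
  rewrite lt0n; apply: contraNneq P0 => d0; rewrite -(h3' P) //.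
  suff -> : psi' P = 0 by rewrite linear0.
  by apply/rowP => -[j jd]; exfalso; move: jd; rewrite d0.
have [|v v0 /allP hv] := common_eigenvector (As := [seq T i | i <- enum 'I_n]) dpos.
  by move=> _ _ /mapP[i _ ->] /mapP[j _ ->]; exact: Tcomm.
have /choice[c hc] : forall i, exists b, v *m T i = b *: v.
  move=> i; have := hv (T i); rewrite map_f ?mem_enum // => /(_ isT).
  by move=> /sub_rVP[b ->]; exists b.
pose F := phi' v; have [WF hF] := h1' v.
have F0 : F != 0 by apply: contraNneq v0 => h; rewrite -(h2' v) -/F h linear0.
have hd i : der i F = c i *: der i0 F by rewrite /F -TE hc linearZ derZ.
have c0 : c i0 = 1.
  have /eqP := hd i0; rewrite -subr_eq0 -{1}[der i0 F]scale1r -scalerBl scaler_eq0.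
  case/orP => [|/eqP e0]; first by rewrite subr_eq0 eq_sym => /eqP.
  by move/eqP: F0; case; exact: inj0 WF hF e0.
pose xi : 'cV[K]_n := \col_i c i.
have /choice[w hw] : forall k, exists b, F k = b *: ell xi ^+ (N0 + a.+1).
  move=> k; apply: (proportional_derivs (hF k) (i0 := i0)); first by rewrite mxE.
  by move=> i; rewrite mxE -!derE hd ffunE.
pose wv : 'rV[K]_n := \row_k w k.
have FE : F = powf (N0 + a.+1) xi wv by apply/ffunP => k; rewrite ffunE mxE.
(* As [xi] has entry 1 at [i0], [der i0] lowers the exponent up to a nonzero integer factor. *)
have low b : (b <= N0 + a.+1)%N -> W (powf b xi wv).
  move=> hb; rewrite -(subKn hb); elim: (_ - b)%N => [|t IHt]; first by rewrite subn0 -FE.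
  have [ht|ht] := leqP (N0 + a.+1) t; last first.
    move: IHt; rewrite -[(N0 + a.+1 - t)%N]prednK ?subn_gt0 // => /(Wder i0).
    rewrite der_powf mxE c0 mulr1 => /(subspZE hW); rewrite -subnS; apply.
    by rewrite pnatr_eq0.
  by move: IHt; rewrite subnS (eqP (_ : (N0 + a.+1 - t)%N == 0%N)) // subn_eq0.
exists xi, wv; split.
- by apply: contra_eqN c0 => /eqP /colP /(_ i0); rewrite !mxE => ->; rewrite eq_sym oner_eq0.
- apply: contraNneq F0 => h; rewrite FE h; apply/eqP/ffunP => k.
  by rewrite !ffunE mxE scale0r.
- apply: low; apply: leq_trans (leq_addl N0 _).
  by rewrite /a; do 2!apply: leqW; exact: leq_addl.
Qed.

End Search.

(** * Generation of all polynomial fields from the linear ones and pure powers *)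

Section Generation.
Variables (K : numFieldType) (n : nat) (T : PF K n -> Prop).
Implicit Types (P Q : PF K n) (m a b : 'X_{1..n}) (i j k l : 'I_n).
Hypotheses (hT : pflie T) (Tlin : forall A, T (lin A)).
Hypothesis two : forall k : 'I_n, exists i, i != k.

Let sT := hT.1.

Lemma mon_lin i k : mon K U_(i) k = lin (delta_mx i k).
Proof.
apply/ffunP => l; rewrite monE ffunE (bigD1 i) //= mxE eqxx big1 => [|j ji].
  by rewrite addr0 eq_sym /=; case: eqP; rewrite ?scale1r ?scale0r.
by rewrite mxE (negPf ji) scale0r.
Qed.

Let Tmon1 i k : T (mon K U_(i) k). Proof. by rewrite mon_lin. Qed.

Let Tbr m i b k : T (mon K m i) -> T (mon K b k) ->
  T ((b i)%:R *: mon K (m + (b - U_(i))) k - (m k)%:R *: mon K (b + (m - U_(k))) i).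
Proof. by move=> h1 h2; rewrite -br_mon; apply: hT.2. Qed.

Definition wt l (mk : 'X_{1..n} * 'I_n) : K := (mk.1 l)%:R - (l == mk.2)%:R.

Lemma br_torus l mk : br (mon K U_(l) l) (mon K mk.1 mk.2) = wt l mk *: mon K mk.1 mk.2.
Proof.
case: mk => m k; rewrite br_mon /wt scalerBl /=; congr (_ - _).
  have [->|h0] := posnP (m l); first by rewrite !scale0r.
  by rewrite addmC submK // lep1mP -lt0n.
rewrite mnm1E; case: eqP => [->|_]; last by rewrite !scale0r.
by congr (_ *: _); apply/ffunP => j; rewrite !monE; case: eqP => // _; congr 'X_[_];
  apply/mnmP => h; rewrite mnmDE mnmBE subnn addn0.
Qed.

Definition supp P : seq ('X_{1..n} * 'I_n) :=
  [seq (m, k) | k <- enum 'I_n, m <- msupp (P k)].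

Lemma supp_sum P : P = \sum_(mk <- supp P) (P mk.2)@_(mk.1) *: mon K mk.1 mk.2.
Proof.
rewrite {1}[P]mon_expand /supp big_allpairs_dep /= big_enum /=.
by apply: eq_bigr.
Qed.

Lemma torus_component P mk0 : T P -> T (\sum_(mk <- supp P | [forall l, wt l mk == wt l mk0])
   (P mk.2)@_(mk.1) *: mon K mk.1 mk.2).
Proof.
move=> TP; suff h s : T (\sum_(mk <- supp P | all (fun l => wt l mk == wt l mk0) s)
    (P mk.2)@_(mk.1) *: mon K mk.1 mk.2).
  have := h (enum 'I_n); congr T; apply: eq_bigl => mk.
  apply/allP/forallP => [H l|H l _]; last exact: H.
  by apply: H; rewrite mem_enum.
elim: s => [|l s IH]; first by rewrite /= -supp_sum.
rewrite -big_filter in IH.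
have Tl Q : T Q -> T (br (mon K U_(l) l) Q) by move=> TQ; apply: hT.2.
have := @geigen_reweight _ _ (br (mon K U_(l) l)) T sT Tl 1 _ _ (wt l)
  (fun mk => (P mk.2)@_(mk.1) *: mon K mk.1 mk.2) (fun c => (c == wt l mk0)%:R) _ IH.
rewrite big_filter => h.
have e : \sum_(mk <- supp P | all (fun l0 : 'I_n => wt l0 mk == wt l0 mk0) s)
    (wt l mk == wt l mk0)%:R *: ((P mk.2)@_(mk.1) *: mon K mk.1 mk.2) =
  \sum_(mk <- supp P | all (fun l0 : 'I_n => wt l0 mk == wt l0 mk0) (l :: s))
    (P mk.2)@_(mk.1) *: mon K mk.1 mk.2.
  rewrite /= [RHS]big_mkcondl /=; apply: eq_bigr => mk _.
  by case: eqP => _; rewrite ?scale1r ?scale0r.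
rewrite -e; apply: h => mk _ /=.
by rewrite linearZ /= br_torus !scalerA mulrC subrr.
Qed.

(** The torus weight space of x_i^d d_k is a line: the weight -1 at [k] can only come from the
    direction d_k, and then the weights determine the exponents. *)
Lemma extract_pure P d i k : i != k -> T P -> (P k)@_(U_(i) *+ d) != 0 ->
  T (mon K (U_(i) *+ d) k).
Proof.
move=> ik TP c0; have := torus_component (U_(i) *+ d, k)%MM TP.
rewrite (_ : \sum_(mk <- _ | _) _ = (P k)@_(U_(i) *+ d) *: mon K (U_(i) *+ d) k).
  by move/(subspZE sT); exact.
have key mk : [forall l, wt l mk == wt l (U_(i) *+ d, k)%MM] -> mk = (U_(i) *+ d, k)%MM.
  case: mk => m k' /forallP h.
  have kk' : k' = k.
    have := h k; rewrite /wt /= mulmnE mnm1E (negPf ik) mul0n eqxx.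
    case: (k =P k') => [//|_]; rewrite subr0 sub0r => /eqP e.
    have : (0 : K) <= (m k)%:R by exact: ler0n.
    by rewrite e oppr_ge0 ler10.
  rewrite kk' in h *; congr pair; apply/mnmP => l.
  have := h l; rewrite /wt /= => /eqP /(addIr _) /eqP.
  by rewrite eqr_nat => /eqP.
have us : uniq (supp P).
  apply: allpairs_uniq_dep => [|j _|[k1 m1] [k2 m2] _ _ /= [-> ->]] //.
    exact: enum_uniq.

rewrite -big_filter.
have -> : [seq mk <- supp P | [forall l, wt l mk == wt l (U_(i) *+ d, k)%MM]] =
   [:: (U_(i) *+ d, k)%MM].
  rewrite (eq_filter (a2 := pred1 (U_(i) *+ d, k)%MM)); last first.
    move=> mk /=; apply/idP/eqP => [/key //|->].
    by apply/forallP => l.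
  rewrite filter_pred1_uniq //.
  apply/allpairsPdep; exists k, (U_(i) *+ d)%MM; split; rewrite ?mem_enum //.
  by rewrite mcoeff_msupp.
by rewrite big_seq1.
Qed.

Let Tmono m i k (c : nat) : (0 < c)%N -> T (c%:R *: mon K m k) -> T (mon K m k).
Proof. by move=> c0; apply: subspZE => //; rewrite pnatr_eq0 -lt0n. Qed.

Let mnm_sub_add m i j : (U_(j) + (m + U_(i) - U_(i)) = m + U_(j))%MM.
Proof. by apply/mnmP => l; rewrite !(mnmDE, mnmBE) addnK addnC. Qed.

(* The action of x_j d_i and x_k d_i on the field x^m d_k. *)
Let move_left m i j k : j != k -> T (mon K (m + U_(i)) k) -> T (mon K (m + U_(j)) k).
Proof.
move=> jk h; have := Tbr (Tmon1 j i) h.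
rewrite mnm_sub_add [(U_(j))%MM k]mnm1E (negPf jk) scale0r subr0.
by apply: Tmono => //; rewrite mnmDE mnm1E eqxx addn1.
Qed.

Let mnm_add_sub0 m k : (m + (U_(k) - U_(k)) = m)%MM.
Proof. by apply/mnmP => l; rewrite !(mnmDE, mnmBE) subnn addn0. Qed.

Let move_right m i k : m i = 0%N -> T (mon K m k) -> T (mon K m i).
Proof.
move=> mi h; have := Tbr (Tmon1 k i) h.
rewrite mi scale0r sub0r mnm1E eqxx scale1r mnm_add_sub0 => /(subspN sT).
by rewrite opprK.
Qed.

Let Tbr_ki m i k : T (mon K m k) ->
  T ((m i)%:R *: mon K (U_(k) + (m - U_(i))) k - mon K m i).
Proof.
move=> h; have := Tbr (Tmon1 k i) h.
by rewrite mnm1E eqxx scale1r mnm_add_sub0.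
Qed.

(** Bracketing [e] times with x_k d_i yields [al] times a field in direction d_k minus [be] times
    one in direction d_i. Both coefficients are natural numbers, so that nothing cancels in the last
    bracket, equal to [- (al + be)] times x_k^d d_i. *)
Let swap d i k : i != k -> T (mon K (U_(i) *+ d) k) -> T (mon K (U_(k) *+ d) i).
Proof.
move=> ik h0; have ki : (k == i) = false by rewrite eq_sym (negPf ik).
pose f e := (U_(i) *+ (d - e) + U_(k) *+ e)%MM.
have fi e : f e i = (d - e)%N by rewrite mnmDE !mulmnE !mnm1E eqxx eq_sym (negPf ik) addn0 mul1n.
have fk e : f e k = e by rewrite mnmDE !mulmnE !mnm1E eqxx (negPf ik) mul1n.
have fS e : (e < d)%N -> (U_(k) + (f e - U_(i)) = f e.+1)%MM.
  move=> ed; apply/mnmP => l; rewrite /f !(mnmDE, mnmBE, mulmnE, mnm1E).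
  have : (d - e = (d - e.+1).+1)%N by rewrite -subSn.
  by case: (i =P l) => [<-|_]; case: (k =P l) => _ /=; lia.
have : forall e, (e <= d)%N -> exists al be : nat, [/\ (0 < al)%N, (e = 0 -> be = 0)%N &
    T (al%:R *: mon K (f e) k - be%:R *: mon K (f e.-1) i)].
  elim=> [|e IH] he.
    exists 1%N, 0%N; split=> //; rewrite scale1r scale0r subr0 /f subn0.
    by rewrite (_ : (_ + _)%MM = (U_(i) *+ d)%MM) //; apply/mnmP => l; rewrite mnmDE !mulmnE muln0 addn0.
  have [al [be [al0 be0 h]]] := IH (ltnW he).
  exists (al * (d - e))%N, (al + be * (d - e.-1))%N; split=> //.
    by rewrite muln_gt0 al0 subn_gt0.
  have := hT.2 _ _ (Tmon1 k i) h; rewrite linearB !linearZ /= !br_mon.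
  rewrite !mnm1E eqxx ki !fi /= mulr1n mulr0n scale1r scale0r subr0 !scalerN.
  rewrite mnm_add_sub0 fS //.
  case: e be0 {IH h} he => [|e] be0 he.
    rewrite be0 // !mul0n addn0 scale0r subr0 scalerBr scalerA -natrM //.
  rewrite /= fS ?(ltnW he) // scalerBr !scalerA -!natrM addnC natrD scalerDl.
  by rewrite -addrA -opprD [al%:R *: _ + _]addrC.
move=> /(_ d (leqnn d))[al [be [al0 be0 h]]].
have := hT.2 _ _ (Tmon1 k i) h; rewrite linearB !linearZ /= !br_mon.
rewrite !mnm1E eqxx ki !fi subnn /= mulr1n mulr0n !scale0r scale1r sub0r subr0.
rewrite mnm_add_sub0 !scalerN.
have fd : f d = (U_(k) *+ d)%MM.
  by apply/mnmP => l; rewrite /f subnn mnmDE !mulmnE muln0.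
rewrite fd; case: d {h0 h} f fi fk fS fd be0 => [|d] f fi fk fS fd be0.
  by rewrite be0 // scale0r subr0 => /(subspN sT); rewrite opprK; exact: Tmono.
rewrite /= fS // fd subSn // subnn scale1r -opprD -scalerDl -natrD.
by move=> /(subspN sT); rewrite opprK; apply: Tmono => //; rewrite addn_gt0 al0.
Qed.

Section Degree.
Hypothesis pure : forall d, exists i k, i != k /\ T (mon K (U_(i) *+ d) k).

Let pure_all d i k : i != k -> T (mon K (U_(i) *+ d) k).
Proof.
have [i0 [k0 [ik0 h0]]] := pure d.
have chg i' k' l : i' != k' -> i' != l -> T (mon K (U_(i') *+ d) k') -> T (mon K (U_(i') *+ d) l).
  by move=> ik il; apply: move_right; rewrite mulmnE mnm1E (negPf il).
move=> ik; have [ii|ii] := eqVneq i0 i; first by subst i0; apply: chg h0.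
apply: (chg i i0) => //; first by rewrite eq_sym.
by apply: swap => //; apply: chg h0.
Qed.

Let mon_free m k : m k = 0%N -> T (mon K m k).
Proof.
move=> mk; have [i ik] := two k.
have [e he] := ubnP (\sum_(j | j != i) m j)%N.
elim: e m mk he => // e IH m mk; rewrite ltnS => he.
have [h|/existsNP[j /not_implyP[ji /eqP mj]]] := pselect (forall j, j != i -> m j = 0%N).
  rewrite (_ : m = (U_(i) *+ m i)%MM); first exact: pure_all.
  apply/mnmP => l; rewrite mulmnE mnm1E; case: (i =P l) => [<-|/eqP il].
    by rewrite mul1n.
  by rewrite h // eq_sym.
have jm : (U_(j) <= m)%MM by rewrite lep1mP.
have jk : j != k by apply: contraNneq mj => ->; rewrite mk.
rewrite -(submK jm); apply: (@move_left _ i) => //; apply: IH.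
  by rewrite mnmDE mnmBE mk !mnm1E (negPf ik) sub0n.
apply: leq_trans he; rewrite (bigD1 j) //= [X in (_ <= X)%N](bigD1 j) //=.
have e1 : (m - U_(j) + U_(i))%MM j = (m j).-1.
  by rewrite mnmDE mnmBE !mnm1E eqxx eq_sym (negPf ji) addn0 subn1.
rewrite e1 (eq_bigr m) => [|l /andP[li lj]]; last first.
  by rewrite mnmDE mnmBE !mnm1E eq_sym (negPf lj) eq_sym (negPf li) subn0 addn0.
by rewrite -lt0n in mj; rewrite -addSn prednK.
Qed.

Section Quadratic.
Hypothesis quad : forall k l, T (mon K (U_(k) + U_(l)) l).

Let base m k : m k = 0%N -> forall j, T (mon K m j).
Proof.
move=> mk j; have [->|jk] := eqVneq j k; first exact: mon_free.
have [mj|mj] := posnP (m j); first exact: mon_free.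
have jm : (U_(j) <= m)%MM by rewrite lep1mP -lt0n.
have [th mE hth] : exists2 th, m = (th + U_(j))%MM & (m - U_(j))%MM = th.
  by exists (m - U_(j))%MM; rewrite ?submK.
have thk : th k = 0%N by rewrite -hth mnmBE mk.
(* With t the exponent of x_j in [th], the fields x^m d_j and x_k x^th d_k occur with coefficients
   1, -t in [h1] and -1, t + 1 in [h2]: a system of determinant 1. *)
have h1 := Tbr (mon_free thk) (quad k j).
have h2 := Tbr_ki j (mon_free mk).
have e1 : (U_(k) + U_(j))%MM k = 1%N by rewrite mnmDE !mnm1E eqxx (negPf jk) addn0.
have e2 : (th + (U_(k) + U_(j) - U_(k)) = m)%MM.
  by rewrite mE; apply/mnmP => l; rewrite 2!mnmDE mnmBE mnmDE addKn.
rewrite e1 e2 scale1r in h1.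
have [tj|tj] := posnP (th j); first by rewrite tj scale0r subr0 in h1.
have e3 : (U_(k) + U_(j) + (th - U_(j)) = U_(k) + th)%MM.
  apply/mnmP => l; rewrite !(mnmDE, mnmBE, mnm1E).
  by case: (j =P l) => [<-|_] /=; lia.
rewrite e3 in h1; rewrite hth in h2.
have h3 : T (mon K (U_(k) + th) k).
  have := subspD sT h1 h2.
  have -> : m j = (th j).+1 by rewrite mE mnmDE mnm1E eqxx addn1.
  by rewrite -natr1 scalerDl scale1r addrC addrA subrK addrAC subrr add0r.
by have := subspD sT h1 (subspZ sT (th j)%:R h3); rewrite subrK.
Qed.

(** The induction is on the exponent of a single variable x_k, whose absence is the case of
    [base]. *)
Lemma mon_all m j : T (mon K m j).
Proof.
have [k _] := two j; have [e he] : exists e, m k = e by exists (m k).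
elim: e m k he j => [|e IH] m k he j; first exact: base he j.
have km : (U_(k) <= m)%MM by rewrite lep1mP he.
have [th mE hth] : exists2 th, m = (th + U_(k))%MM & (m - U_(k))%MM = th.
  by exists (m - U_(k))%MM; rewrite ?submK.
have thk : th k = e by rewrite -hth mnmBE mnm1E eqxx he subn1.
have [->|jk] := eqVneq j k.
  have [i ik] := two k; pose m' := (th + U_(i))%MM.
  have m'k : m' k = e by rewrite mnmDE thk mnm1E (negPf ik) addn0.
  have := subspD sT (Tbr_ki i (IH m' k m'k k)) (IH m' k m'k i).
  rewrite subrK (_ : (_ + (m' - _))%MM = m); last by rewrite mnm_sub_add.
  by apply: Tmono => //; rewrite mnmDE mnm1E eqxx addn1.
have m'k : (th + U_(j))%MM k = e by rewrite mnmDE thk mnm1E (negPf jk) addn0.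
by rewrite mE; apply: (@move_left _ j) (IH _ k m'k j); rewrite eq_sym.
Qed.

Lemma generate_all P : T P.
Proof.
rewrite [P]mon_expand; do 2!apply: subsp_sum => // ? _.
by apply: subspZ => //; exact: mon_all.
Qed.

End Quadratic.

(** Modulo the divergence-free fields 2 x_k x_l d_l - x_k^2 d_k, all x_k x_l d_l are multiples of
    x_k^2 d_k. The torus component of [X] of that weight reduces to a multiple of x_k^2 d_k, whose
    factor is half the coefficient of x_k in the divergence of [X]. *)
Lemma quad_of_div X v : T X -> hom 2 X -> \tr (lmat (br (cst v) X)) != 0 ->
  forall k l, T (mon K (U_(k) + U_(l)) l).
Proof.
move=> TX hX tr0.
have D k l : l != k -> T (2 *: mon K (U_(k) + U_(l)) l - mon K (U_(k) + U_(k)) k).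
  move=> lk; have h : (U_(k) + U_(k))%MM l = 0%N by rewrite mnmDE !mnm1E eq_sym (negPf lk).
  have := Tbr_ki k (mon_free h); rewrite (_ : (U_(k) + U_(k))%MM k = 2%N); last first.
    by rewrite mnmDE !mnm1E eqxx.
  rewrite (_ : (U_(l) + (U_(k) + U_(k) - U_(k)) = U_(k) + U_(l))%MM); last by rewrite addmK addmC.
  exact.
pose c k l := (X l)@_(U_(k) + U_(l)).
have [k0 hk0] : exists k, \sum_l c k l *+ ((k == l).+1) != 0.
  apply: contrapT => /forallNP h; move/eqP: tr0; apply.
  have -> : \tr (lmat (br (cst v) X)) = \sum_k v 0 k * \sum_l c k l *+ ((k == l).+1).
    under [RHS]eq_bigr do rewrite mulr_sumr.
    rewrite exchange_big; apply: eq_bigr => l _; rewrite mxE br_cst raddf_sum /=.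
    by apply: eq_bigr => k _; rewrite mcoeffZ mcoeff_deriv /c addmC mnm1E eq_sym.
  rewrite big1 // => k _; have /negP := h k; rewrite negbK => /eqP ->.
  by rewrite mulr0.
have sq0 : T (mon K (U_(k0) + U_(k0)) k0).
  have := torus_component (U_(k0) + U_(k0), k0)%MM TX.
  have -> : \sum_(mk <- supp X | [forall l, wt l mk == wt l (U_(k0) + U_(k0), k0)%MM])
     (X mk.2)@_(mk.1) *: mon K mk.1 mk.2 = \sum_l c k0 l *: mon K (U_(k0) + U_(l)) l.
    rewrite big_mkcond /supp big_allpairs_dep /= big_enum /=; apply: eq_bigr => l _.
    rewrite -big_mkcond.
    have wtE m : [forall j, wt j (m, l) == wt j (U_(k0) + U_(k0), k0)%MM] = (m == (U_(k0) + U_(l))%MM).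
      apply/forallP/eqP => [h|-> j]; last first.
        by rewrite /wt /= !mnmDE !mnm1E !natrD (eq_sym j l) (eq_sym j k0) !addrK.
      apply/mnmP => j; have := h j; rewrite /wt /= !mnmDE !mnm1E natrD (eq_sym j k0) addrK.
      by rewrite subr_eq -natrD eqr_nat eq_sym (eq_sym j l) => /eqP.
    under eq_bigl do rewrite wtE.
    case: (boolP ((U_(k0) + U_(l))%MM \in msupp (X l))) => hm.
      by rewrite -big_filter filter_pred1_uniq ?msupp_uniq // big_seq1.
    rewrite /c memN_msupp_eq0 // scale0r big_seq_cond big1 // => m /andP[hm' /eqP e].
    by rewrite -e hm' in hm.
  rewrite (bigD1 k0) //= => h.
  have h2 : T (\sum_(l | l != k0) (c k0 l / 2) *: (2 *: mon K (U_(k0) + U_(l)) l - mon K (U_(k0) + U_(k0)) k0)).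
    by apply: subsp_sum => // l lk; apply: subspZ => //; exact: D.
  apply: (subspZE sT hk0); move: (subspZ sT 2 (subspB sT h h2)); congr T.
  rewrite -addrA -sumrB.
  have e0 : (2 : K) != 0 by rewrite pnatr_eq0.
  under eq_bigr do rewrite scalerBr scalerA divfK // opprB addrC subrK.
  rewrite -scaler_suml -scalerDl scalerA; congr (_ *: _).
  rewrite [in RHS](bigD1 k0) //= eqxx mulrDr mulr_sumr mulr_natl; congr (_ + _).
  apply: eq_bigr => l lk; rewrite eq_sym (negPf lk) mulr1n mulrC divfK //.
have allsq k : T (mon K (U_(k) + U_(k)) k).
  have [->//|kk0] := eqVneq k k0.
  have h1 : T (mon K (U_(k0) + U_(k)) k0) by apply: move_left sq0.
  have := subspB sT (subspZ sT 2 h1) (D k k0 (_ : k0 != k)).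
  by rewrite eq_sym kk0 addmC opprB addrC subrK; apply.
move=> k l; have [->|lk] := eqVneq l k; first exact: allsq.
apply: (subspZE sT (_ : 2 != 0)); first by rewrite pnatr_eq0.
by have := subspD sT (D k l lk) (allsq k); rewrite subrK.
Qed.

End Degree.
End Generation.

Section Degrees.
Variables (K : numFieldType) (n : nat).
Implicit Types (P : PF K n).

Lemma bounded_subsp N : subsp (@bounded K n N).
Proof.
split=> [k|a P Q hP hQ k]; first by rewrite ffunE msize0.
rewrite !ffunE; apply: leq_trans (msizeD_le _ _) _.
by rewrite geq_max hQ (leq_trans (msizeZ_le _ _) (hP k)).
Qed.

Lemma lmat_hom d P : hom d P -> d != 1%N -> lmat P = 0.
Proof.
move=> hP d1; apply/matrixP => i k; rewrite !mxE (dhomog_nemf_coeff (hP k)) //=.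
by rewrite mdeg1 eq_sym.
Qed.

Lemma mcoeff_ellX (xi : 'cV[K]_n) d i : (ell xi ^+ d)@_(U_(i) *+ d) = xi i 0 ^+ d.
Proof.
elim: d => [|d IH]; first by rewrite mulm0n mcoeff1 eqxx.
apply: (@mulfI _ (d.+1%:R)); first by rewrite pnatr_eq0.
have := congr1 (fun f : {mpoly K[n]} => f@_(U_(i) *+ d)) (mderiv_ellX i xi d).
rewrite mcoeff_deriv mcoeffZ IH => e; rewrite [xi i 0 ^+ _]exprS mulrA -e.
by rewrite mulmnE mnm1E eqxx mul1n mulmS addmC mulr_natl.
Qed.

End Degrees.

(** * Maximality over an algebraically closed field *)

Section Core.
Variables (K : numClosedFieldType) (n' : nat).
Let n := n'.+1.
Implicit Types (P Q : PF K n) (L W : PF K n -> Prop).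

(** A nonzero homogeneous field of positive degree has a nonzero partial derivative, so that fields
    of large degree provide fields of all smaller degrees. *)
Lemma unbounded_or W : subsp W -> pfgraded W -> (forall v P, W P -> W (br (cst v) P)) ->
  (exists N, forall P, W P -> bounded N P) \/ unbounded W.
Proof.
move=> sW gW dW; have [h|/forallNP h] := pselect (exists N, forall P, W P -> bounded N P).
  by left.
right=> N; have [e [Q [WQ hQ Q0]]] : exists e Q, [/\ W Q, hom (N + e) Q & Q != 0].
  have /existsNP[P /not_implyP[WP nb]] := h N.
  apply: contrapT => hn; apply: nb; have [N' bP] := bounded_ex P.
  rewrite (hc_sum bP); apply: subsp_sum => [|d _]; first exact: bounded_subsp.
  have [Nd|dN] := leqP N d; last by apply: bounded_mono dN (hom_bounded (hom_hc _ _)).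
  have [->|d0] := eqVneq (hc d P) 0; first by case: (bounded_subsp K n N).
  by case: hn; exists (d - N)%N, (hc d P); split; rewrite ?subnKC //; [exact: gW|exact: hom_hc].
elim: e Q WQ hQ Q0 => [|e IH] Q WQ hQ Q0; first by exists Q; rewrite addn0 in hQ.
rewrite addnS in hQ; have [i hi] := der_ne0 hQ Q0.
by apply: IH hi; [exact: dW|exact: (hom_der i hQ)].
Qed.

Lemma pure_of_rank_one W d (xi : 'cV[K]_n) (w : 'rV[K]_n) : (1 < n)%N -> pflie W ->
  (forall A, W (lin A)) -> xi != 0 -> w != 0 -> W (powf d xi w) ->
  exists i k : 'I_n, i != k /\ W (mon K (U_(i) *+ d) k).
Proof.
move=> n2 hW Wlin xi0 w0 h.
have /cV0Pn[i hi] := xi0.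
have cE k : (powf d xi w k)@_(U_(i) *+ d) = w 0 k * xi i 0 ^+ d.
  by rewrite ffunE mcoeffZ mcoeff_ellX.
have [[k [ik wk]]|hk] := pselect (exists k, i != k /\ w 0 k != 0).
  exists i, k; split=> //; apply: extract_pure ik h _ => //.
  by rewrite cE mulf_neq0 // expf_neq0.
have wi : w 0 i != 0.
  apply: contraNneq w0 => wi; apply/eqP/rowP => k; rewrite mxE.
  have [->//|ik] := eqVneq k i.
  by apply: contrapT => /eqP wk; apply: hk; exists k; rewrite eq_sym.
have [k ik] : exists k, i != k.
  have [->|i0] := eqVneq i 0; last by exists 0.
  by exists (Ordinal n2).
have wk : w 0 k = 0 by apply: contrapT => /eqP wk; apply: hk; exists k.
exists i, k; split=> //.
(* Here [w] points in direction [i] only; the bracket with x_i d_k moves this component, with a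
   sign, to direction [k]. *)
have hb : W (br (mon K U_(i) k) (powf d xi w)) by rewrite mon_lin; apply: hW.2.
apply: extract_pure ik hb _ => //.
rewrite brE lieD_mon {1}/powf ffunE wk scale0r mderiv0 mulr0 sub0r.
rewrite monE eqxx -(eulE K i) lieD_eul_id mcoeffN cE oppr_eq0.
by rewrite mulf_neq0 // expf_neq0.
Qed.

Lemma core_maximal L W N : pflie L -> pfgraded L -> has_cst L -> mxirr (linpart L) ->
  (exists X, [/\ L X, hom 2 X & X != 0]) -> (forall P, L P -> bounded N P) ->
  pflie W -> (forall P, L P -> W P) -> (forall P, W P -> L P) \/ (forall P, W P).
Proof.
move=> hL gL VL irrL L1 bL hW LW.
have [LJ Leul] := kobayashi_nagano hL gL VL irrL L1 hL gL (fun P h => h) bL.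
have JL P : spn (transl_gen L) P -> L P.
  apply; first exact: hL.1.
  by move=> Q [[v ->]|[]//|[v [X [LX _ ->]]]]; [exact: VL|apply: hL.2].
have gW : pfgraded W.
  by move=> P d WP; apply: eul_graded WP; [exact: hW.1|move=> Q WQ; apply: hW.2 => //; exact: LW].
have dW v P : W P -> W (br (cst v) P) by move=> WP; apply: hW.2 => //; apply: LW.
have [[N' bW]|uW] := unbounded_or hW.1 gW dW.
  left=> P WP; apply: JL.
  by have [h _] := kobayashi_nagano hL gL VL irrL L1 hW gW LW bW; apply: h.
right; have rk1 := rank_one_field hW.1 dW uW.
have F_hom X v : hom 2 X -> lin (lmat (br (cst v) X)) = br (cst v) X.
  by move=> hX; rewrite -hom1P //; apply: (hom_br (hom_cst v) hX).
have eulJ := LJ _ Leul.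
(* In dimension one there are no two distinct indices, but the fields of rank one are already all
   the monomial fields. *)
have [n1|n2] := leqP n 1.
  have ord1' (j : 'I_n) : j = ord0.
    by apply: val_inj; case: j => -[|j] //= hj; have := leq_trans hj n1.
  have Wm d : W (mon K (U_(ord0) *+ d) ord0).
    have [xi [w [xi0 w0 h]]] := rk1 d.
    apply: (subspZE hW.1 (_ : w 0 ord0 * xi ord0 0 ^+ d != 0)).
      rewrite mulf_neq0 // ?expf_neq0 //.
        by apply: contraNneq w0 => e; apply/eqP/rowP => j; rewrite mxE (ord1' j).
      by apply: contraNneq xi0 => e; apply/eqP/colP => j; rewrite mxE (ord1' j).
    move: h; congr W; apply/ffunP => k; rewrite !ffunE.
    rewrite (ord1' k) eqxx /ell (bigD1 ord0) //= big1 ?addr0; last first.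
      by move=> j; rewrite (ord1' j) eqxx.
    by rewrite exprZn scalerA mpolyXn.
  move=> P; rewrite [P]mon_expand.
  apply: subsp_sum => [|k _]; first exact: hW.1.
  apply: subsp_sum => [|m _]; first exact: hW.1.
  apply: (subspZ hW.1); rewrite (ord1' k) (_ : m = (U_(ord0) *+ m ord0)%MM) //.
  by apply/mnmP => j; rewrite mulmnE mnm1E (ord1' j) eqxx mul1n.
have [xi [w [xi0 w0 h]]] := rk1 1%N.
have hM : mxlie (linpart W).
  by split; [exact: linpart_subsp hW.1|move=> A B; exact: linpart_br].
have irrM : mxirr (linpart W).
  move=> U sU stU; apply: irrL => // A v LA; apply: stU; exact: LW.
have M1 : linpart W 1%:M by exact: LW.
have Mop : linpart W (op xi w).
  move: h; congr W; apply/ffunP => k; rewrite !ffunE expr1 /ell scaler_sumr.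
  by apply: eq_bigr => i _; rewrite opE scalerA mulrC.
have [full|[om [oml omr [x0 [y0 om0]] inv]]] := rank_one_dichotomy hM irrM M1 Mop w0 xi0.
  have two (k : 'I_n) : exists i, i != k.
    have [->|k0] := eqVneq k 0; last by exists 0; rewrite eq_sym.
    by exists (Ordinal n2).
  have pure d : exists i k : 'I_n, i != k /\ W (mon K (U_(i) *+ d) k).
    by have [xi' [w' [xi0' w0' h']]] := rk1 d; apply: pure_of_rank_one h'.
  (* If every [v, X] had trace zero, so would the linear part of every field of J, in particular the
     identity, whose trace is [n]. *)
  have [X [v [LX hX tr0]]] : exists X v, [/\ L X, hom 2 X & \tr (lmat (br (cst v) X)) != 0].
    apply: contrapT => hn; have : \tr (lmat (eul K n)) = 0.
      apply: (eulJ (fun P => \tr (lmat P) = 0)); first split; first by rewrite linear0 mxtrace0.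
        by move=> a P Q hP hQ; rewrite linearP mxtraceD mxtraceZ hP hQ mulr0 addr0.
      move=> P [[v ->]|[_ hP]|[v [X [LX hX ->]]]].
      - by rewrite (lmat_hom (hom_cst v)) ?mxtrace0.
      - by rewrite (lmat_hom hP) ?mxtrace0.
      - by apply: contrapT => /eqP hne; apply: hn; exists X, v.
    by rewrite linK mxtrace1 => /eqP; rewrite pnatr_eq0.
  have quad := quad_of_div hW full two pure (LW _ LX) hX tr0.
  exact (generate_all hW full two pure quad).
exfalso; have om0l y : om 0 y = 0.
  by have := oml (-1) 0 0 y; rewrite scaler0 addr0 mulN1r addNr.
have om0r y : om y 0 = 0.
  by have := omr (-1) 0 0 y; rewrite scaler0 addr0 mulN1r addNr.
(* The fields [v, X] preserve [om], so the identity would as well, and twice [om] would vanish. *)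
have : forall x y, om (x *m lmat (eul K n)) y + om x (y *m lmat (eul K n)) = 0.
  apply: (eulJ (fun P => forall x y, om (x *m lmat P) y + om x (y *m lmat P) = 0)).
    split=> [x y|a P Q hP hQ x y]; first by rewrite linear0 !mulmx0 om0l om0r addr0.
    rewrite linearP !mulmxDr -!scalemxAr oml omr addrACA -mulrDr hP hQ mulr0 addr0 //.
  move=> P [[v ->]|[_ hP]|[v [X [LX hX ->]]]] x y.
  - by rewrite (lmat_hom (hom_cst v)) // !mulmx0 om0l om0r addr0.
  - by rewrite (lmat_hom hP) // !mulmx0 om0l om0r addr0.
  apply: (inv (fun v => lmat (br (cst v) X))) => [u|u u'].
    by rewrite /linpart F_hom //; apply: hW.2; apply: LW.
  apply: (can_inj (@cstK K n)).
  by rewrite -!br_cst_lin !F_hom // jacobi br_cst_cst br0l add0r.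
move/(_ x0 y0); rewrite linK !mulmx1 -mulr2n => /eqP.
by rewrite mulrn_eq0 /= (negPf om0).
Qed.

End Core.

(** * Complexification *)

Section Coefficients.
Variables (K : numFieldType) (n : nat).
Implicit Types (P Q : PF K n).

Lemma pf_eq P Q : (forall k m, (P k)@_m = (Q k)@_m) -> P = Q.
Proof. by move=> h; apply/ffunP => k; apply/mpolyP => m. Qed.

Lemma mcoeff_lc a P Q k m : ((a *: P + Q) k)@_m = a * (P k)@_m + (Q k)@_m.
Proof. by rewrite !ffunE mcoeffD mcoeffZ. Qed.

Lemma mcoeff_sum_msupp (K' : numFieldType) (g : 'X_{1..n} -> K') (f : {mpoly K[n]}) m :
  (m \notin msupp f -> g m = 0) -> (\sum_(m' <- msupp f) g m' *: 'X_[m'])@_m = g m.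
Proof.
move=> g0; rewrite raddf_sum /=.
case: (boolP (m \in msupp f)) => hm.
  rewrite (bigD1_seq m) ?msupp_uniq //= big1 ?addr0 => [|m' mm'].
    by rewrite mcoeffZ mcoeffX eqxx mulr1.
  by rewrite mcoeffZ mcoeffX (negPf mm') mulr0.
rewrite g0 // big_seq big1 // => m' hm'.
rewrite mcoeffZ mcoeffX; case: eqP => [e|_]; last by rewrite mulr0.
by rewrite -e hm' in hm.
Qed.

Lemma mcoeff_hc d P k m : (hc d P k)@_m = if mdeg m == d then (P k)@_m else 0.
Proof.
rewrite ffunE pihomogE big_mkcond /=.
rewrite -[RHS](@mcoeff_sum_msupp _ (fun m => if mdeg m == d then (P k)@_m else 0) (P k)).
  by congr (_@_m); apply: eq_bigr => m' _; case: ifP => _ //; rewrite scale0r.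
by move/memN_msupp_eq0 ->; case: ifP.
Qed.

Lemma mcoeff_cst (v : 'rV[K]_n) k m : (cst v k)@_m = v 0 k * (m == 0%MM)%:R.
Proof. by rewrite ffunE mcoeffC eq_sym. Qed.

Lemma mcoeff_lin (A : 'M[K]_n) k m : (lin A k)@_m = \sum_i A i k * (U_(i)%MM == m)%:R.
Proof.
by rewrite ffunE raddf_sum; apply: eq_bigr => i _; rewrite /= mcoeffZ mcoeffX.
Qed.

Lemma boundedP N P :
  bounded N P <-> forall k m, (N <= mdeg m)%N -> (P k)@_m = 0.
Proof.
split=> [h k m Nm|h k].
  by apply: memN_msupp_eq0; apply: msize_mdeg_ge; apply: leq_trans Nm.
rewrite msizeE; apply/bigmax_leqP_seq => m mk _.
rewrite ltnNge; apply: contraL mk => Nm.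
by rewrite mcoeff_msupp negbK h.
Qed.

End Coefficients.

Section Complexification.
Variables (R : numFieldType) (C : numClosedFieldType) (toC : {rmorphism R -> C}).
Variables (i_ : C) (re im : C -> R).
Hypotheses (complexE : forall z, z = i_ * toC (im z) + toC (re z)).
Hypotheses (reE : forall a b, re (i_ * toC b + toC a) = a).
Hypotheses (imE : forall a b, im (i_ * toC b + toC a) = b).
Hypothesis ii : i_ * i_ = -1.

Let re0 : re 0 = 0. Proof. by have := reE 0 0; rewrite rmorph0 mulr0 addr0. Qed.
Let im0 : im 0 = 0. Proof. by have := imE 0 0; rewrite rmorph0 mulr0 addr0. Qed.

Section Parts.
Variable n : nat.
Implicit Types (P Q : PF R n) (F G : PF C n).

Definition emb P : PF C n := [ffun k => map_mpoly toC (P k)].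
Definition cpart (f : C -> R) F : PF R n :=
  [ffun k => \sum_(m <- msupp (F k)) f (F k)@_m *: 'X_[m]].
Notation RE := (cpart re).
Notation IM := (cpart im).

Lemma mcoeff_emb P k m : (emb P k)@_m = toC (P k)@_m.
Proof. by rewrite ffunE mcoeff_map_mpoly. Qed.

Lemma mcoeff_cpart f F k m : f 0 = 0 -> (cpart f F k)@_m = f (F k)@_m.
Proof.
move=> f0; rewrite ffunE (mcoeff_sum_msupp (g := fun m => f (F k)@_m)) //.
by move/memN_msupp_eq0 ->.
Qed.

Lemma embE F : F = i_ *: emb (IM F) + emb (RE F).
Proof. by apply: pf_eq => k m; rewrite mcoeff_lc !mcoeff_emb !mcoeff_cpart. Qed.

Lemma RE_emb P Q : RE (i_ *: emb Q + emb P) = P.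
Proof. by apply: pf_eq => k m; rewrite mcoeff_cpart // mcoeff_lc !mcoeff_emb. Qed.

Lemma IM_emb P Q : IM (i_ *: emb Q + emb P) = Q.
Proof. by apply: pf_eq => k m; rewrite mcoeff_cpart // mcoeff_lc !mcoeff_emb. Qed.

Lemma emb_lin a P Q : emb (a *: P + Q) = toC a *: emb P + emb Q.
Proof. by apply: pf_eq => k m; rewrite mcoeff_lc !mcoeff_emb mcoeff_lc rmorphD rmorphM. Qed.

Lemma emb0 : emb 0 = 0.
Proof. by have := emb_lin (-1) 0 0; rewrite scaler0 addr0 rmorphN1 scaleN1r addNr. Qed.

Lemma emb_br P Q : br (emb P) (emb Q) = emb (br P Q).
Proof.
have dE (f : {mpoly R[n]}) i : (map_mpoly toC f)^`M(i) = map_mpoly toC f^`M(i).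
  by apply/mpolyP => m; rewrite mcoeff_deriv !mcoeff_map_mpoly mcoeff_deriv raddfMn.
apply/ffunP => k; rewrite !ffunE rmorph_sum; apply: eq_bigr => j _.
by rewrite !ffunE rmorphB !rmorphM !dE.
Qed.

Definition cplx (L : PF R n -> Prop) F := L (RE F) /\ L (IM F).

Lemma cplx_emb L P Q : L P -> L Q -> cplx L (i_ *: emb Q + emb P).
Proof. by move=> LP LQ; rewrite /cplx RE_emb IM_emb. Qed.

Lemma cplxP L F : cplx L F -> exists P Q, [/\ F = i_ *: emb Q + emb P, L P & L Q].
Proof. by move=> [h1 h2]; exists (RE F), (IM F); split=> //; exact: embE. Qed.

Lemma cplx_re (L : PF R n -> Prop) P : L 0 -> (cplx L (emb P) <-> L P).
Proof.
move=> L0; have e : emb P = i_ *: emb 0 + emb P by rewrite emb0 scaler0 add0r.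
by rewrite e /cplx RE_emb IM_emb; split=> [[]|].
Qed.

Lemma cplx_subsp L : subsp L -> subsp (cplx L).
Proof.
move=> sL; split.
  have := cplx_emb (subsp0 sL) (subsp0 sL).
  by rewrite emb0 scaler0 addr0.
move=> z F G /cplxP[P [Q [-> LP LQ]]] /cplxP[P' [Q' [-> LP' LQ']]].
set a := re z; set b := im z.
have -> : z *: (i_ *: emb Q + emb P) + (i_ *: emb Q' + emb P') =
   i_ *: emb (a *: Q + (b *: P + Q')) + emb (a *: P + ((- b) *: Q + P')).
  rewrite !emb_lin [in LHS](complexE z) -/a -/b rmorphN.
  apply: pf_eq => k m; rewrite !mcoeff_lc.
  have -> : - toC b = i_ * i_ * toC b by rewrite ii mulN1r.
  ring.
by apply: cplx_emb; apply: sL.2 => //; apply: sL.2.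
Qed.

Lemma cplx_lie L : pflie L -> pflie (cplx L).
Proof.
move=> hL; split; first exact: cplx_subsp hL.1.
move=> F G /cplxP[P [Q [-> LP LQ]]] /cplxP[P' [Q' [-> LP' LQ']]].
have -> : br (i_ *: emb Q + emb P) (i_ *: emb Q' + emb P') =
    i_ *: emb (br Q P' + br P Q') + emb (br P P' - br Q Q').
  rewrite !linearD !linearZ /= !brDl !brZl !emb_br.
  rewrite -[br P P' - _]scale1r scalerBr.
  have -> : br Q P' + br P Q' = 1 *: br Q P' + br P Q' by rewrite scale1r.
  have -> : 1 *: br P P' - 1 *: br Q Q' = (-1) *: br Q Q' + br P P'.
    by rewrite !scale1r scaleN1r addrC.
  rewrite !emb_lin rmorph1 rmorphN1 scale1r !scalerDr !scalerA ii.
  by rewrite addrACA [X in X + _ = _]addrC addrACA.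
by apply: cplx_emb; [apply: (subspB hL.1)|apply: (subspD hL.1)]; apply: hL.2.
Qed.

Lemma emb_cst (v : 'rV[R]_n) : emb (cst v) = cst (map_mx toC v).
Proof.
by apply: pf_eq => k m; rewrite mcoeff_emb !mcoeff_cst mxE rmorphM rmorph_nat.
Qed.

Lemma emb_lin_mx (A : 'M[R]_n) : emb (lin A) = lin (map_mx toC A).
Proof.
apply: pf_eq => k m; rewrite mcoeff_emb !mcoeff_lin rmorph_sum.
by apply: eq_bigr => i _; rewrite mxE rmorphM rmorph_nat.
Qed.

Lemma hc_emb d P : hc d (emb P) = emb (hc d P).
Proof.
apply: pf_eq => k m; rewrite mcoeff_emb !mcoeff_hc mcoeff_emb.
by case: ifP => _ //; rewrite rmorph0.
Qed.

Lemma mx_complexE p q (A : 'M[C]_(p, q)) :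
  A = i_ *: map_mx toC (map_mx im A) + map_mx toC (map_mx re A).
Proof. by apply/matrixP => i j; rewrite !mxE. Qed.

Lemma cplx_linpart L (A : 'M[R]_n) : L 0 -> linpart L A -> linpart (cplx L) (map_mx toC A).
Proof. by move=> L0 LA; rewrite /linpart -emb_lin_mx; apply/(cplx_re _ L0). Qed.

Lemma cplx_graded L : pfgraded L -> pfgraded (cplx L).
Proof.
move=> gL F d /cplxP[P [Q [-> LP LQ]]].
rewrite linearD linearZ /= !hc_emb; by apply: cplx_emb; apply: gL.
Qed.

Lemma cplx_has_cst L : has_cst L -> has_cst (cplx L).
Proof. by move=> h v; rewrite (mx_complexE v) linearP /= -!emb_cst; apply: cplx_emb. Qed.

Lemma cplx_bounded L N : (forall P, L P -> bounded N P) -> forall F, cplx L F -> bounded N F.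
Proof.
move=> h F /cplxP[P [Q [-> LP LQ]]]; apply/boundedP => k m Nm.
have z S : L S -> (S k)@_m = 0 by move=> /h/boundedP; apply.
by rewrite mcoeff_lc !mcoeff_emb !z // rmorph0 mulr0 addr0.
Qed.

End Parts.

Definition has_cplx_struct n' (M : 'M[R]_n'.+1 -> Prop) :=
  exists J, J *m J = - 1%:M /\ forall A, M A -> A *m J = J *m A.

(** [V x y] says that x + i y lies in a stable complex subspace. If it contains a nonzero real
    vector, it contains all of them and is full; otherwise it is the graph y = J x of a complex
    structure commuting with [M]. *)
Lemma cplx_irr n' (M : 'M[R]_n'.+1 -> Prop) (MC : 'M[C]_n'.+1 -> Prop) :
  (forall A, M A -> MC (map_mx toC A)) -> mxirr M -> ~ has_cplx_struct M -> mxirr MC.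
Proof.
move=> MMC irrM noJ U sU stU [u Uu u0].
pose V (x y : 'rV[R]_n'.+1) := U (i_ *: map_mx toC y + map_mx toC x).
have rot x y : V x y -> V (- y) x.
  move/(subspZ sU i_); rewrite /V scalerDr scalerA ii addrC scaleN1r.
  by rewrite raddfN.
have stV A x y : M A -> V x y -> V (x *m A) (y *m A).
  by move=> MA /(stU _ _ (MMC _ MA)); rewrite /V mulmxDl -scalemxAl !map_mxM.
have linV a x y x' y' : V x y -> V x' y' -> V (a *: x + x') (a *: y + y').
  move=> h h'; have := sU.2 (toC a) _ _ h h'; congr U.
  by rewrite !map_mxD !map_mxZ !scalerDr !scalerA mulrC addrACA.
have V00 : V 0 0 by rewrite /V raddf0 scaler0 addr0; exact: sU.1.
have UV v : V (map_mx re v) (map_mx im v) <-> U v by rewrite /V -mx_complexE.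
clearbody V.
have linV0 a x x' : V x 0 -> V x' 0 -> V (a *: x + x') 0.
  by move=> h h'; have := linV a _ _ _ _ h h'; rewrite scaler0 addr0.
have [h1|h1] := pselect (forall x, V x 0 -> x = 0); last first.
  have [x [Vx x0]] : exists x, V x 0 /\ x != 0.
    by apply: contrapT => hn; apply: h1 => x Vx; apply: contrapT => /eqP x0; apply: hn; exists x.
  have V1 : forall x, V x 0.
    apply: irrM; [by split|by move=> A y MA /(stV _ _ _ MA); rewrite mul0mx|by exists x].
  move=> v; apply/UV; have := linV 1 _ _ _ _ (V1 (map_mx re v)) (rot _ _ (V1 (map_mx im v))).
  by rewrite !scale1r oppr0 addr0 add0r.
exfalso; apply: noJ.
have h2 : forall x, exists y, V x y.
  apply: irrM => [|A x MA [y Vxy]|].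
  - split; first by exists 0.
    by move=> a x x' [y hy] [y' hy']; exists (a *: y + y'); apply: linV.
  - by exists (y *m A); apply: stV.
  have hu := (UV u).2 Uu.
  have [re0'|re0'] := eqVneq (map_mx re u) 0; last first.
    by exists (map_mx re u) => //; exists (map_mx im u).
  exists (- map_mx im u); first by exists (map_mx re u); apply: rot.
  rewrite oppr_eq0; apply: contraNneq u0 => im0'.
  by rewrite (mx_complexE u) re0' im0' !map_mx0 scaler0 addr0.
have [J hJ] := choice h2.
have uniqJ x y : V x y -> y = J x.
  move=> h; apply/eqP; rewrite -subr_eq0 -oppr_eq0; apply/eqP/h1.
  have := linV (-1) _ _ _ _ (hJ x) h; rewrite !scaleN1r addNr addrC.
  by move/rot.
have linJ : linear J by move=> a x y; rewrite -(uniqJ _ _ (linV a _ _ _ _ (hJ x) (hJ y))).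
pose JL : {linear 'rV[R]_n'.+1 -> 'rV[R]_n'.+1} := HB.pack J (GRing.isLinear.Build _ _ _ _ J linJ).
have JE x : x *m lin1_mx JL = J x by rewrite mul_rV_lin1.
exists (lin1_mx JL); split=> [|A MA]; apply: mulmx_row_eq => x.
  rewrite mulmxA !JE mulmxN mulmx1; apply/esym/uniqJ.
  by have := rot _ _ (rot _ _ (rot _ _ (hJ x))); rewrite opprK.
rewrite !mulmxA !JE; apply/esym/uniqJ; exact: stV.
Qed.

Lemma core_maximal_cplx n' (L W : PF R n'.+1 -> Prop) N : pflie L -> pfgraded L -> has_cst L ->
  mxirr (linpart L) -> ~ has_cplx_struct (linpart L) ->
  (exists X, [/\ L X, hom 2 X & X != 0]) -> (forall P, L P -> bounded N P) ->
  pflie W -> (forall P, L P -> W P) -> (forall P, W P -> L P) \/ (forall P, W P).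
Proof.
move=> hL gL VL irrL noJ [X [LX hX X0]] bL hW LW.
have L0 := subsp0 hL.1; have W0 := subsp0 hW.1.
have irrC : mxirr (linpart (cplx L)).
  by apply: cplx_irr noJ => // A; apply: cplx_linpart.
have L1 : exists X, [/\ cplx L X, hom 2 X & X != 0].
  exists (emb X); split; first exact/cplx_re.
    move=> k; apply/dhomogP => m; rewrite mcoeff_msupp mcoeff_emb => h.
    apply: (dhomog_mf (hX k)); rewrite mcoeff_msupp.
    by apply: contraNneq h => ->; rewrite rmorph0.
  apply: contraNneq X0 => e; apply/eqP/pf_eq => k m.
  have := congr1 (fun F : PF C n'.+1 => (F k)@_m) e; rewrite mcoeff_emb !ffunE !mcoeff0.
  by move/eqP; rewrite fmorph_eq0 => /eqP.
have LWC F : cplx L F -> cplx W F by move=> [h1 h2]; split; apply: LW.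
have [h|h] := core_maximal (cplx_lie hL) (cplx_graded gL) (cplx_has_cst VL) irrC L1
  (cplx_bounded bL) (cplx_lie hW) LWC.
  by left=> P WP; apply/(cplx_re _ L0)/h/cplx_re.
by right=> P; apply/(cplx_re _ W0)/h.
Qed.

End Complexification.

(** * Necessity of the conditions *)

Section Jets.
Variables (K : numFieldType) (n : nat).
Implicit Types (P Q X Y : PF K n) (u v w : 'rV[K]_n) (A B : 'M[K]_n).

Lemma cvec_hc0 P : cvec (hc 0 P) = cvec P.
Proof. by apply/rowP => k; rewrite !mxE mcoeff_hc mdeg0. Qed.

Lemma lmat_hc1 P : lmat (hc 1 P) = lmat P.
Proof. by apply/matrixP => i k; rewrite !mxE mcoeff_hc mdeg1. Qed.

Lemma cvec_hom d P : hom d P -> d != 0%N -> cvec P = 0.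
Proof.
move=> hP d0; apply/rowP => k; rewrite !mxE (dhomog_nemf_coeff (hP k)) //=.
by rewrite mdeg0 eq_sym.
Qed.

Lemma br_cst_comm u v X : br (cst u) (br (cst v) X) = br (cst v) (br (cst u) X).
Proof. by rewrite jacobi br_cst_cst br0l add0r. Qed.

Lemma cvec_br X Y : cvec (br X Y) = cvec X *m lmat Y - cvec Y *m lmat X.
Proof.
apply/rowP => k; rewrite !mxE ffunE raddf_sum -sumrB; apply: eq_bigr => j _.
by rewrite !mxE /= mcoeffB !(rmorphM (mcoeff 0%MM)) /= !mcoeff_deriv !mnm0E !add0m !mulr1n.
Qed.

Lemma cvec_br_cst v X : cvec (br (cst v) X) = v *m lmat X.
Proof.
by rewrite cvec_br cstK (lmat_hom (hom_cst v)) // mulmx0 subr0.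
Qed.

(** The last two terms carry the second derivatives. Because of them, a condition on differentials
    defines a subalgebra only when imposed on all iterated derivatives, as in [jet_in]. *)
Lemma lmat_br X Y : lmat (br X Y) = lmat X *m lmat Y - lmat Y *m lmat X
  + lmat (br (cst (cvec X)) Y) - lmat (br (cst (cvec Y)) X).
Proof.
apply: mulmx_row_eq => v.
rewrite -cvec_br_cst jacobi linearD /= (cvec_br (br _ X)) (cvec_br X) !cvec_br_cst.
rewrite !(mulmxBr, mulmxDr) !mulmxA.
have h Z (x : 'rV[K]_n) : v *m lmat (br (cst x) Z) = x *m lmat (br (cst v) Z).
  by rewrite -!cvec_br_cst br_cst_comm.
rewrite !h; set a := _ *m lmat Y; set b := cvec Y *m _; set c := cvec X *m _.
by rewrite addrACA [- b - _]addrC -!addrA; congr (_ + _); rewrite addrCA.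
Qed.

Definition itad (s : seq 'rV[K]_n) X := foldl (fun P u => br (cst u) P) X s.

Lemma itad_lin s a X Y : itad s (a *: X + Y) = a *: itad s X + itad s Y.
Proof. by elim: s X Y => //= u s IH X Y; rewrite linearP IH. Qed.

Lemma itad0 s : itad s 0 = 0.
Proof. by elim: s => //= u s IH; rewrite linear0. Qed.

Lemma itad_mem (L : PF K n -> Prop) s X : pflie L -> (forall u, u \in s -> L (cst u)) ->
  L X -> L (itad s X).
Proof.
move=> hL; elim: s X => //= u s IH X h LX; apply: IH => [v vs|].
  by apply: h; rewrite inE vs orbT.
by apply: hL.2 => //; apply: h; rewrite inE eqxx.
Qed.

(* The field maps U to U, expressed through its Taylor expansion at 0. *)
Definition tangent (U : 'rV[K]_n -> Prop) X :=
  forall s, (forall u, u \in s -> U u) -> U (cvec (itad s X)).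

(** By the Jacobi identity constant fields act as derivations of the bracket; induction reduces the
    claim to the value at 0, which involves only first derivatives along [U]. *)
Lemma tangent_lie U : subsp U -> pflie (tangent U).
Proof.
move=> sU; split.
  split=> [s _|a X Y hX hY s hs]; first by rewrite itad0 linear0; exact: sU.1.
  by rewrite itad_lin linearP; apply: sU.2; [exact: hX|exact: hY].
move=> X Y hX hY s; elim: s X Y hX hY => [|u s IH] X Y hX hY hs.
  have one Z u : tangent U Z -> U u -> U (u *m lmat Z).
    by move=> hZ Uu; rewrite -cvec_br_cst; apply: (hZ [:: u]) => v; rewrite inE => /eqP ->.
  have zero Z : tangent U Z -> U (cvec Z) by move=> hZ; exact: (hZ [::]).
  by rewrite /= cvec_br; apply: (subspB sU); apply: one; auto.
have Uu : U u by apply: hs; rewrite inE eqxx.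
have st Z : tangent U Z -> tangent U (br (cst u) Z).
  move=> hZ t ht; apply: (hZ (u :: t)) => v; rewrite inE => /orP[/eqP -> //|]; exact: ht.
rewrite /= jacobi -[br (br _ _) _]scale1r itad_lin linearP.
by apply: sU.2; apply: IH => //; try exact: st; move=> v vs; apply: hs; rewrite inE vs orbT.
Qed.

(* The differentials of the field at all points lie in M, expressed likewise. *)
Definition jet_in (M : 'M[K]_n -> Prop) X := forall s, M (lmat (itad s X)).

Lemma jet_in_lie M : subsp M -> (forall A B, M A -> M B -> M (A *m B - B *m A)) ->
  pflie (jet_in M).
Proof.
move=> sM hM; split.
  split=> [s|a X Y hX hY s]; first by rewrite itad0 linear0; exact: sM.1.
  by rewrite itad_lin linearP; apply: sM.2; [exact: hX|exact: hY].
have st u Z : jet_in M Z -> jet_in M (br (cst u) Z) by move=> hZ s; exact: (hZ (u :: s)).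
move=> X Y hX hY s; elim: s X Y hX hY => [|u s IH] X Y hX hY.
  rewrite /= lmat_br; apply: (subspB sM); last exact: (st _ _ hX [::]).
  by apply: (subspD sM); [exact: hM (hX [::]) (hY [::])|exact: (st _ _ hY [::])].
rewrite /= jacobi -[br (br _ _) _]scale1r itad_lin linearP.
by apply: sM.2; apply: IH => //; apply: st.
Qed.

Lemma powf_neq0 d (xi : 'cV[K]_n) w : xi != 0 -> w != 0 -> powf d xi w != 0.
Proof.
move=> /cV0Pn[i hi] /rV0Pn[k hk].
apply: contraNneq (mulf_neq0 hk (expf_neq0 d hi)) => e.
have := congr1 (fun P : PF K n => (P k)@_(U_(i) *+ d)) e.
by rewrite !ffunE mcoeffZ mcoeff_ellX mcoeff0 => ->.
Qed.

Lemma hom_powf d (xi : 'cV[K]_n) w : hom d (powf d xi w).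
Proof.
move=> k; rewrite ffunE; apply: rpredZ; elim: d => [|d IH]; first by rewrite expr0 dhomog1.
rewrite exprS -[d.+1]add1n; apply: dhomogM => //.
by apply: rpred_sum => i _; apply: rpredZ; rewrite dhomogX /= mdeg1.
Qed.

Lemma br_cst_powf v d (xi : 'cV[K]_n) w :
  br (cst v) (powf d.+1 xi w) = (d.+1%:R * (v *m xi) 0 0) *: powf d xi w.
Proof.
apply/ffunP => k; rewrite br_cst !ffunE scalerA.
under eq_bigr do rewrite linearZ /= mderiv_ellX !scalerA.
rewrite -scaler_suml mxE mulr_sumr mulr_suml; congr (_ *: _).
by apply: eq_bigr => j _; ring.
Qed.

End Jets.

Section Converse.
Variables (K : numFieldType) (n' N : nat).
Let n := n'.+1.
Implicit Types (P Q X Y : PF K n) (u v w : 'rV[K]_n) (A B : 'M[K]_n).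
Variable L : PF K n -> Prop.
Hypotheses (hL : pflie L) (gL : pfgraded L) (bL : forall P, L P -> bounded N P).
Hypothesis maxL : forall W, pflie W -> (forall P, L P -> W P) ->
  (forall P, W P -> L P) \/ (forall P, W P).

(** Such a [P] is too large in degree to lie in [L], so that [W] is strictly larger than [L]. *)
Lemma maximal_big W d P : pflie W -> (forall P, L P -> W P) -> W P -> (N <= d)%N ->
  hom d P -> P != 0 -> forall Q, W Q.
Proof.
move=> hW LW WP Nd hP P0; case: (maxL hW LW) => // h.
move/eqP: P0; case; rewrite -(hc_hom hP); apply: (hc_bounded _ Nd).
exact/bL/h.
Qed.

Lemma subsp_annihil (U : 'rV[K]_n -> Prop) v : subsp U -> ~ U v ->
  exists xi : 'cV[K]_n, v *m xi != 0 /\ forall u, U u -> u *m xi = 0.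
Proof.
move=> /subsp_rowspace[r [B [_ UB]]] /UB; rewrite submxE => /negP h.
have cE (u : 'rV[K]_n) j : col j (u *m cokermx B) = u *m col j (cokermx B).
  by rewrite !colE -!mulmxA.
have [j hj] : exists j, col j (v *m cokermx B) != 0.
  apply: contrapT => /forallNP hn; move/negP: h; apply; apply/eqP/matrixP => i j.
  have /negP := hn j; rewrite negbK => /eqP/colP/(_ i); rewrite !mxE => ->.
  by [].
exists (col j (cokermx B)); rewrite -cE; split=> // u /UB.
by rewrite submxE -cE => /eqP ->; rewrite col0.
Qed.

Lemma maximal_has_cst : has_cst L.
Proof.
move=> v; apply: contrapT => Lv; pose U u := L (cst u).
have sU : subsp U.
  split=> [|a x y hx hy]; first by rewrite /U linear0; exact: subsp0 hL.1.
  by rewrite /U linearP; apply: hL.1.2.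
have [xi [vxi Uxi]] := subsp_annihil sU Lv.
have xi0 : xi != 0 by apply: contraNneq vxi => ->; rewrite mulmx0.
have v0 : v != 0 by apply: contraNneq vxi => ->; rewrite mul0mx.
(* The field (x xi)^(N+1) v is tangent to [U] because it vanishes on [U], which lies in the kernel
   of [xi]; the exponent exceeds [N] to be positive even for [N = 0]. Tangency of the constant field
   [v] is the contradiction. *)
apply: Lv; have := @maximal_big (tangent U) N.+1 (powf N.+1 xi v) (tangent_lie sU) _ _
  (leqnSn _) (hom_powf _ _ _) (powf_neq0 _ xi0 v0) (cst v) [::].
rewrite /= cstK; apply=> // [P LP s hs|s hs].
  by rewrite /U -cvec_hc0 -hom0P; [apply: gL; exact: itad_mem|exact: hom_hc].
case: s hs => [|u s] hs /=.
  by rewrite (cvec_hom (hom_powf _ _ _)) //; exact: subsp0 sU.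
rewrite br_cst_powf Uxi ?mxE ?mulr0 ?scale0r ?itad0 ?linear0; first exact: subsp0 sU.
by apply: hs; rewrite inE eqxx.
Qed.

Lemma maximal_irr : mxirr (linpart L).
Proof.
have VL := maximal_has_cst; have itL s P : L P -> L (itad s P) by move=> LP; apply: itad_mem.
move=> U sU stU [u0 Uu0 u00] v; apply: contrapT => Uv.
have [xi [vxi Uxi]] := subsp_annihil sU Uv.
pose M A := forall u, U u -> U (u *m A).
have sM : subsp M.
  split=> [u Uu|a A B hA hB u Uu]; first by rewrite mulmx0; exact: subsp0 sU.
  by rewrite mulmxDr -scalemxAr; apply: sU.2; [exact: hA|exact: hB].
have hM A B : M A -> M B -> M (A *m B - B *m A).
  by move=> hA hB u Uu; rewrite mulmxBr !mulmxA; apply: (subspB sU); auto.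
have [al hal] := dot_neq0 u00.
have al0 : al != 0 by apply: contraNneq hal => ->; rewrite dot0r.
(* The witness of large degree is (x al)^N u0, whose derivatives have values in [U]. The field
   [lin (op al v)] sends [u0] to a nonzero multiple of [v], outside [U]. *)
have : jet_in M (lin (op al v)).
  apply: (@maximal_big (jet_in M) N (powf N al u0) (jet_in_lie sM hM)) => //.
  - move=> P LP s u Uu; apply: stU => //; rewrite /linpart -lmat_hc1 -hom1P; last exact: hom_hc.
    exact/gL/itL.
  - move=> s; elim: s N => [|w s IH] [|d] u Uu.
    + by rewrite (lmat_hom (hom_powf _ _ _)) // mulmx0; exact: subsp0 sU.
    + rewrite -cvec_br_cst br_cst_powf linearZ /=; apply: (subspZ sU).
      case: d => [|d]; last by rewrite (cvec_hom (hom_powf _ _ _)) //; exact: subsp0 sU.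
      rewrite (_ : powf 0 al u0 = cst u0) ?cstK //.
      by apply/ffunP => k; rewrite !ffunE expr0 alg_mpolyC.
    + rewrite (_ : itad _ _ = 0) ?linear0 ?mulmx0; first exact: subsp0 sU.
      rewrite /= (_ : br _ _ = 0) ?itad0 // (_ : powf 0 al u0 = cst u0) ?br_cst_cst //.
      by apply/ffunP => k; rewrite !ffunE expr0 alg_mpolyC.
    + rewrite /= br_cst_powf -[_ *: _]addr0 itad_lin itad0 addr0 linearZ -scalemxAr.
      by apply: (subspZ sU); exact: IH.
  - exact: hom_powf.
  - exact: powf_neq0.
move/(_ [::] u0 Uu0); rewrite /= linK row_op => /(subspZE sU hal).
exact: Uv.
Qed.

End Converse.

(** * Quadratic fields and the projective algebra *)

Section QuadraticFields.
Variables (K : numFieldType) (n : nat).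
Implicit Types (P Q X Y : PF K n) (v : 'rV[K]_n) (A : 'M[K]_n) (al be : 'cV[K]_n).

Lemma ell_is_linear : linear (@ell K n).
Proof.
move=> a al be; rewrite /ell scaler_sumr -big_split /=.
by apply: eq_bigr => i _; rewrite !mxE scalerA scalerDl.
Qed.
HB.instance Definition _ := GRing.isLinear.Build K _ _ _ (@ell K n) ell_is_linear.

Lemma ell_homog al : ell al \is 1.-homog.
Proof. by apply: rpred_sum => i _; apply: rpredZ; rewrite dhomogX /= mdeg1. Qed.

Definition smul (f : {mpoly K[n]}) X : PF K n := [ffun k => f * X k].

Lemma smulE f X k : smul f X k = f * X k. Proof. by rewrite ffunE. Qed.

Lemma smul_linear f : linear (smul f).
Proof. by move=> a X Y; apply/ffunP => k; rewrite !ffunE mulrDr scalerAr. Qed.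
HB.instance Definition _ f := GRing.isLinear.Build K _ _ _ (smul f) (smul_linear f).

Lemma smul_smul f g X : smul f (smul g X) = smul (f * g) X.
Proof. by apply/ffunP => k; rewrite !ffunE mulrA. Qed.

Lemma hom_smul d e f X : f \is d.-homog -> hom e X -> hom (d + e) (smul f X).
Proof. by move=> hf hX k; rewrite ffunE; apply: dhomogM. Qed.

Lemma lieD_smul f X g : lieD (smul f X) g = f * lieD X g.
Proof. by rewrite /lieD mulr_sumr; apply: eq_bigr => j _; rewrite ffunE mulrA. Qed.

Lemma lieD_ell X al : lieD X (ell al) = \sum_j al j 0 *: X j.
Proof.
by apply: eq_bigr => j _; rewrite mderiv_ell mulrC mul_mpolyC.
Qed.

Lemma br_smul X f Y : br X (smul f Y) = smul (lieD X f) Y + smul f (br X Y).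
Proof.
by apply/ffunP => k; rewrite [RHS]ffunE !smulE !brE lieD_smul smulE lieDM mulrBr addrA.
Qed.

Definition proj_field al := smul (ell al) (eul K n).

Lemma hom_proj_field al : hom 2 (proj_field al).
Proof. by apply: hom_smul (ell_homog al) (hom_lin _). Qed.

Lemma proj_field_eq0 al : proj_field al = 0 -> (0 < n)%N -> al = 0.
Proof.
move=> h n0; have : ell al = 0.
  have := congr1 (fun P : PF K n => P (Ordinal n0)) h; rewrite /proj_field smulE eulE ffunE => /eqP.
  rewrite mulf_eq0 => /orP[/eqP //|/eqP/mpolyP/(_ U_(Ordinal n0)%MM)].
  by rewrite mcoeffX eqxx mcoeff0 => /eqP; rewrite oner_eq0.
move=> e; apply/colP => i; rewrite mxE.
by have := mcoeff_ellX al 1 i; rewrite !expr1 e mcoeff0 => <-.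
Qed.

Lemma lieD_lin_ell A al : lieD (lin A) (ell al) = ell (A *m al).
Proof.
rewrite lieD_ell /ell; under eq_bigr do rewrite ffunE scaler_sumr.
rewrite exchange_big; apply: eq_bigr => i _; rewrite mxE scaler_suml.
by apply: eq_bigr => j _; rewrite scalerA mulrC.
Qed.

Lemma br_lin_proj A al : br (lin A) (proj_field al) = proj_field (A *m al).
Proof.
rewrite br_smul lieD_lin_ell br_lin_lin mulmx1 mul1mx subrr.
by rewrite !linear0 addr0.
Qed.

Lemma br_proj_proj al be : br (proj_field al) (proj_field be) = 0.
Proof.
rewrite br_smul lieD_smul (lieD_eul (ell_homog be)) scale1r.
rewrite br_anti (br_eul (hom_proj_field al)) -[2%:R]/(1 + 1 : K) addrK scale1r.
by rewrite linearN /= smul_smul mulrC subrr.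
Qed.

(** The infinitesimal projective transformations, an algebra isomorphic to sl(n+1) that contains all
    affine fields. *)
Definition projective X := exists v A al, X = cst v + lin A + proj_field al.

Lemma proj_field_is_linear : linear proj_field.
Proof.
move=> a al be; apply/ffunP => k; rewrite /proj_field [RHS]ffunE [X in _ = X + _]ffunE !smulE.
by rewrite linearP /= mulrDl scalerAl.
Qed.
HB.instance Definition _ := GRing.isLinear.Build K _ _ _ proj_field proj_field_is_linear.

Lemma projective_lie : pflie projective.
Proof.
have s1 : subsp projective.
  split; first by exists 0, 0, 0; rewrite !linear0 !addr0.
  move=> a X Y [v [A [al ->]]] [w [B [be ->]]].
  exists (a *: v + w), (a *: A + B), (a *: al + be).
  by rewrite !linearP /= !scalerDr addrACA; congr (_ + _); rewrite addrACA.
have pc v : projective (cst v) by exists v, 0, 0; rewrite !linear0 !addr0.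
have pl A : projective (lin A) by exists 0, A, 0; rewrite !linear0 addr0 add0r.
have pp al : projective (proj_field al) by exists 0, 0, al; rewrite !linear0 !add0r.
have pcp v al : projective (br (cst v) (proj_field al)).
  by rewrite (@hom1P _ _ (br _ _)) //; apply: (hom_br (hom_cst v) (hom_proj_field al)).
have anti X Y : projective (br X Y) -> projective (br Y X).
  by rewrite br_anti => /(subspN s1); rewrite opprK.
have p0 : projective 0 := s1.1.
split=> // _ _ [v [A [al ->]]] [w [B [be ->]]].
rewrite !brDl !linearD /=; do !apply: (subspD s1) => //.
- by rewrite br_cst_cst.
- by rewrite br_cst_lin.
- by apply: anti; rewrite br_cst_lin.
- by rewrite br_lin_lin.
- by rewrite br_lin_proj.
- exact: anti.
- by apply: anti; rewrite br_lin_proj.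
- by rewrite br_proj_proj.
Qed.

Lemma projective_hom3 X : projective X -> hom 3 X -> X = 0.
Proof.
move=> [v [A [al ->]]] h; rewrite -[LHS](hc_hom h) !linearD /=.
by rewrite (hc_hom_ne (hom_cst v)) // (hc_hom_ne (hom_lin A)) // (hc_hom_ne (hom_proj_field al)) // !addr0.
Qed.

End QuadraticFields.

Section ConverseQuadratic.
Variables (K : numFieldType) (n' N : nat).
Let n := n'.+1.
Variable L : PF K n -> Prop.
Hypotheses (hL : pflie L) (gL : pfgraded L) (bL : forall P, L P -> bounded N P).
Hypothesis maxL : forall W, pflie W -> (forall P, L P -> W P) ->
  (forall P, W P -> L P) \/ (forall P, W P).

(** If [L_1] vanishes, so do the higher components, because constant fields lower the degree. Then
    [L] consists of affine fields and lies in the projective algebra, which has nonzero quadratic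
    fields but no nonzero cubic ones. *)
Lemma maximal_quad : exists X, [/\ L X, hom 2 X & X != 0].
Proof.
apply: contrapT => hn; have VL := maximal_has_cst hL gL bL maxL.
have h2 X : L X -> hom 2 X -> X = 0.
  by move=> LX hX; apply: contrapT => /eqP X0; apply: hn; exists X.
have h d X : L X -> hom d.+2 X -> X = 0.
  elim: d X => [|d IH] X LX hX; first exact: h2.
  by apply: (hom_ne0 hX) => v; apply: IH; [exact: hL.2|exact: (hom_br (hom_cst v) hX)].
have al0 : (const_mx 1 : 'cV[K]_n) != 0.
  by apply/eqP => /colP/(_ 0); rewrite !mxE => /eqP; rewrite oner_eq0.
case: (maxL (projective_lie K n)) => [P LP|W|W].
- rewrite (hc_sum (bL LP)); apply: subsp_sum => [|d _]; first exact: (projective_lie K n).1.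
  have := gL d LP; have := hom_hc d P; case: (d : nat) => [|[|e]] hd Ld.
  + by rewrite (hom0P hd); exists (cvec (hc 0 P)), 0, 0; rewrite !linear0 !addr0.
  + by rewrite (hom1P hd); exists 0, (lmat (hc 1 P)), 0; rewrite !linear0 add0r addr0.
  + by rewrite (h _ _ Ld hd); exact: subsp0 (projective_lie K n).1.
- move/eqP: al0; apply; apply: (@proj_field_eq0 K n) => //; apply: h2; last exact: hom_proj_field.
  by apply: W; exists 0, 0, (const_mx 1); rewrite !linear0 !add0r.
have w0 : (const_mx 1 : 'rV[K]_n) != 0.
  by apply/eqP => /rowP/(_ 0); rewrite !mxE => /eqP; rewrite oner_eq0.
by have /eqP[] := powf_neq0 3 al0 w0; exact: projective_hom3 (W _) (hom_powf _ _ _).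
Qed.

End ConverseQuadratic.

(** * Fields holomorphic for a complex structure *)

Section Holomorphic.
Variables (F : realFieldType) (n : nat) (J : 'M[F]_n).
Hypothesis JJ : J *m J = - 1%:M.
Implicit Types (X Y : PF F n) (v : 'rV[F]_n) (al : 'cV[F]_n).

Definition act X : PF F n := [ffun k => \sum_l J l k *: X l].

Lemma act_is_linear : linear act.
Proof.
move=> a X Y; apply/ffunP => k; rewrite !ffunE scaler_sumr -big_split /=.
by apply: eq_bigr => l _; rewrite !ffunE scalerDr !scalerA mulrC.
Qed.
HB.instance Definition _ := GRing.isLinear.Build F _ _ _ act act_is_linear.

Lemma act_act X : act (act X) = - X.
Proof.
apply/ffunP => k; rewrite !ffunE.
under eq_bigr do rewrite ffunE scaler_sumr.
rewrite exchange_big /=.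
under eq_bigr => l _.
  under eq_bigr do rewrite scalerA mulrC.
  rewrite -scaler_suml (_ : \sum_i _ = (J *m J) l k); last by rewrite mxE.
  rewrite JJ !mxE.
  over.
rewrite (bigD1 k) //= eqxx big1 ?addr0 ?scaleN1r // => l lk.
by rewrite (negPf lk) oppr0 scale0r.
Qed.

Lemma act_smul f X : act (smul f X) = smul f (act X).
Proof.
apply/ffunP => k; rewrite !ffunE mulr_sumr.
by apply: eq_bigr => l _; rewrite ffunE scalerAr.
Qed.

Lemma br_cst_act v X : br (cst v) (act X) = act (br (cst v) X).
Proof.
apply/ffunP => k; rewrite br_cst -lieD_cst ffunE linear_sum.
by rewrite ffunE; apply: eq_bigr => l _; rewrite linearZ /= br_cst -lieD_cst.
Qed.

Lemma cvec_act X : cvec (act X) = cvec X *m J.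
Proof.
apply/rowP => k; rewrite !mxE ffunE raddf_sum.
by apply: eq_bigr => l _; rewrite !mxE /= mcoeffZ mulrC.
Qed.

(** These are the Cauchy-Riemann equations for [J]. *)
Definition hol X := forall v, br (cst (v *m J)) X = act (br (cst v) X).

Lemma hol_lmat X : hol X -> lmat X *m J = J *m lmat X.
Proof.
move=> hX; apply: mulmx_row_eq => v.
by rewrite !mulmxA -!cvec_br_cst hX cvec_act.
Qed.

Lemma hol_itad s X : hol X -> hol (itad s X).
Proof.
elim: s X => //= u s IH X hX; apply: IH => v.
by rewrite br_cst_comm hX br_cst_act br_cst_comm.
Qed.

(* Multiplication by the complex-valued linear form al - i (al o J). *)
Definition cmul al X := smul (ell al) X - smul (ell (J *m al)) (act X).

Lemma br_cst_cmul v al X : br (cst v) (cmul al X) =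
  ((v *m al) 0 0) *: X - ((v *m J *m al) 0 0) *: act X + cmul al (br (cst v) X).
Proof.
have cE be Y : smul (lieD (cst v) (ell be)) Y = ((v *m be) 0 0) *: Y.
  apply/ffunP => k; rewrite !ffunE lieD_ell -mul_mpolyC; congr (_ * _).
  rewrite mxE rmorph_sum; apply: eq_bigr => j _; rewrite ffunE.
  by rewrite -mul_mpolyC mulrC rmorphM.
rewrite linearB /= !br_smul !cE br_cst_act mulmxA /cmul.
by rewrite opprD addrACA.
Qed.

Lemma act_cmul al X : act (cmul al X) = cmul al (act X).
Proof. by rewrite linearB /= !act_smul. Qed.

Lemma hol_cmul al X : hol X -> hol (cmul al X).
Proof.
move=> hX v; rewrite !br_cst_cmul hX linearD linearB !linearZ /= act_act act_cmul.
have -> : (v *m J *m J *m al) 0 0 = - (v *m al) 0 0.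
  by rewrite -[v *m J *m J]mulmxA JJ mulmxN mulmx1 mulNmx [LHS]mxE.
by rewrite scaleNr !scalerN !opprK; congr (_ + _); rewrite addrC.
Qed.

Lemma hom_act d X : hom d X -> hom d (act X).
Proof. by move=> hX k; rewrite ffunE; apply: rpred_sum => l _; apply: rpredZ. Qed.

Lemma hom_cmul d al X : hom d X -> hom d.+1 (cmul al X).
Proof.
move=> hX; rewrite /cmul; apply: (subspB (hom_subsp F n d.+1)); apply: (hom_smul (d := 1)); rewrite ?ell_homog //.
exact: hom_act.
Qed.

(** Multiplication by the conjugate linear form gives [(f ^+ 2 + g ^+ 2) X = 0], and the sum of
    squares is a nonzero polynomial over an ordered field. *)
Lemma cmul_eq0 al X : al != 0 -> cmul al X = 0 -> X = 0.
Proof.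
move=> al0 /subr0_eq h; set f := ell al in h; set g := ell (J *m al) in h.
have h2 : smul (f ^+ 2 + g ^+ 2) X = 0.
  have hJ : smul f (act X) = - smul g X.
    by rewrite -act_smul h act_smul act_act linearN.
  apply/ffunP => k; have := congr1 (fun P : PF F n => P k) (congr1 (smul f) h).
  rewrite !smul_smul [f * g]mulrC -[smul (g * f) _]smul_smul hJ !ffunE => e.
  rewrite mulrDl !expr2 e; ring.
have /cV0Pn[i hi] := al0.
have fg0 : f ^+ 2 + g ^+ 2 != 0.
  apply: contraNneq hi => /mpolyP/(_ (U_(i) *+ 2)%MM).
  rewrite mcoeffD !mcoeff_ellX mcoeff0 => /eqP.
  by rewrite paddr_eq0 ?sqr_ge0 // !sqrf_eq0 => /andP[].
apply/ffunP => k; have := congr1 (fun P : PF F n => P k) h2.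
by rewrite !ffunE => /eqP; rewrite mulf_eq0 (negPf fg0) => /eqP.
Qed.

Lemma hol_exists d : (0 < n)%N -> exists X, [/\ hol X, hom d X & X != 0].
Proof.
move=> n0; have al0 : (const_mx 1 : 'cV[F]_n) != 0.
  by apply/eqP => /colP/(_ (Ordinal n0)); rewrite !mxE => /eqP; rewrite oner_eq0.
elim: d => [|d [X [hX dX X0]]]; last first.
  exists (cmul (const_mx 1) X); split; [exact: hol_cmul|exact: hom_cmul|].
  by apply: contraNneq X0 => /(cmul_eq0 al0) ->.
exists (cst (const_mx 1)); split; [|exact: hom_cst|].
  by move=> v; rewrite !br_cst_cst linear0.
apply/eqP => h; have := cstK (const_mx 1 : 'rV[F]_n); rewrite h linear0.
by move/rowP/(_ (Ordinal n0)); rewrite !mxE => /esym/eqP; rewrite oner_eq0.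
Qed.

End Holomorphic.

Section ConverseComplex.
Variables (F : realFieldType) (n' N : nat).
Let n := n'.+1.
Variable L : PF F n -> Prop.
Hypotheses (hL : pflie L) (gL : pfgraded L) (bL : forall P, L P -> bounded N P).
Hypothesis maxL : forall W, pflie W -> (forall P, L P -> W P) ->
  (forall P, W P -> L P) \/ (forall P, W P).

Lemma maximal_no_cplx_struct : ~ has_cplx_struct (linpart L).
Proof.
have VL := maximal_has_cst hL gL bL maxL.
move=> [J [JJ hJ]]; pose M A := A *m J = J *m A.
have sM : subsp M.
  split=> [|a A B hA hB]; first by rewrite /M mulmx0 mul0mx.
  by rewrite /M mulmxDl mulmxDr -scalemxAl -scalemxAr hA hB.
have hM A B : M A -> M B -> M (A *m B - B *m A).
  by rewrite /M mulmxBl mulmxBr !mulmxA => hA hB; rewrite -hA -hB -!mulmxA hA hB.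
have [X [hX dX X0]] := hol_exists JJ N (ltn0Sn n').
have LM P : L P -> jet_in M P.
  move=> LP s; apply: hJ; rewrite /linpart -lmat_hc1 -hom1P; last exact: hom_hc.
  by apply: gL; apply: itad_mem.
have XM : jet_in M X by move=> s; apply: hol_lmat; apply: hol_itad.
have all A : M A.
  have := maximal_big bL maxL (jet_in_lie sM hM) LM XM (leqnn _) dX X0 (lin A) [::].
  by rewrite /= linK.
pose w : 'rV[F]_n := delta_mx 0 0.
have w0 : w != 0 by apply/eqP => /rowP/(_ 0); rewrite !mxE => /eqP; rewrite oner_eq0.
have [al hal] := dot_neq0 w0; set c := dot w al in hal.
(* A matrix commuting with all rank one matrices is scalar; its square cannot be -1 over an ordered
   field. *)
have [k wJ] : exists k, forall v : 'rV[F]_n, v *m J = k *: v.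
  exists (dot (w *m J) al / c) => v; have := congr1 (mulmx w) (all (op al v)).
  rewrite (mulmxA w (op al v)) (mulmxA w J) !row_op -scalemxAl => e.
  by rewrite mulrC -scalerA -e scalerA mulVf ?scale1r.
have := congr1 (mulmx w) JJ; rewrite mulmxA wJ -scalemxAl wJ scalerA mulmxN mulmx1.
move/eqP; rewrite -subr_eq0 opprK -[X in _ + X]scale1r -scalerDl scaler_eq0 (negPf w0) orbF.
by rewrite -expr2 paddr_eq0 ?sqr_ge0 // oner_eq0 andbF.
Qed.

End ConverseComplex.

(** * Coordinates *)

Section Evaluation.
Variables (K : numFieldType) (n : nat).
Implicit Types (f g : {mpoly K[n]}).

Lemma mpoly_alg_ind (P : {mpoly K[n]} -> Prop) : (forall c, P c%:MP) -> (forall i, P 'X_i) ->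
  (forall f g, P f -> P g -> P (f + g)) -> (forall f g, P f -> P g -> P (f * g)) ->
  forall f, P f.
Proof.
move=> hC hX hD hM f; rewrite [f]mpolyE.
elim/big_ind: _ => [||m _]; [by rewrite -mpolyC0|exact: hD|].
rewrite -mul_mpolyC; apply: (hM) => //; rewrite mpolyXE_id.
elim/big_ind: _ => [||i _]; [by rewrite -mpolyC1|exact: hM|].
by elim: (m i) => [|d IH]; rewrite ?expr0 ?exprS -?mpolyC1 //; apply: (hM).
Qed.

Lemma poly_vanish (p : {poly K}) : (forall t, p.[t] = 0) -> p = 0.
Proof.
move=> h; apply/eqP; apply: contraT => p0.
have := @max_poly_roots _ p [seq i%:R | i <- iota 0 (size p)] p0.
rewrite size_map size_iota ltnn; apply.
  by apply/allP => x _; apply/rootP; exact: h.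
rewrite map_inj_uniq ?iota_uniq // => i j /eqP; by rewrite eqr_nat => /eqP.
Qed.

(** On each coordinate line [f] is a one-variable polynomial with infinitely many roots; so its
    partial derivatives vanish as functions, and by induction as polynomials. Then [f] is
    constant. *)
Lemma mpoly_vanish f : (forall x, f.@[x] = 0) -> f = 0.
Proof.
move: {2}(msize f) (leqnn (msize f)) => N; elim: N f => [|N IH] f hN h.
  by apply/eqP; rewrite -msize_poly_eq0 -leqn0.
have d0 i : f^`M(i) = 0.
  apply: IH => [|x]; first exact: msize_mderiv.
  pose hv t j := x j + (j == i)%:R * t.
  (* Restriction to the line through [x] in direction [i], a ring morphism that exchanges the
     partial derivative with the ordinary one. *)
  pose G : {mpoly K[n]} -> {poly K} :=
    mmap polyC (fun j => (x j)%:P + (j == i)%:R *: 'X).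
  have GE t g : (G g).[t] = g.@[hv t].
    elim/mpoly_alg_ind: g => [c|j|g1 g2 e1 e2|g1 g2 e1 e2].
    - by rewrite /G mmapC hornerC mevalC.
    - by rewrite /G mmapX mmap1U !hornerE mevalXU.
    - by rewrite /G rmorphD hornerD -/(G g1) -/(G g2) e1 e2 mevalD.
    - by rewrite /G rmorphM hornerM -/(G g1) -/(G g2) e1 e2 mevalM.
  have GD g : (G g)^`() = G g^`M(i).
    elim/mpoly_alg_ind: g => [c|j|g1 g2 e1 e2|g1 g2 e1 e2].
    - by rewrite mderivC /G mmapC derivC rmorph0.
    - by rewrite mderivXU /G mmapX mmap1U derivD derivC add0r derivZ derivX alg_polyC !rmorph_nat.
    - by rewrite mderivD /G !rmorphD /= derivD -/(G g1) -/(G g2) e1 e2.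
    - by rewrite mderivM /G !rmorphD !rmorphM /= derivM -/(G g1) -/(G g2) e1 e2.
  have G0 : G f = 0 by apply: poly_vanish => t; rewrite GE.
  have := GE 0 f^`M(i); rewrite -GD G0 deriv0 horner0 => ->.
  by apply: meval_eq => j; rewrite /hv mulr0 addr0.
have := mderiv_eq0 d0; move/msize1_polyC => e.
by have h0 := h (fun=> 0); rewrite {1}e mevalC in h0; rewrite e h0 mpolyC0.
Qed.

End Evaluation.

Section Transfer.
Variables (K : numFieldType) (E : vectType K) (n' : nat).
Let n := n'.+1.
Variables (e : n.-tuple E) (he : basis_of fullv e).
Implicit Types (P Q : PF K n) (L W : set (E -> E)) (X Y : E -> E).
Let phi := vfield_of e.

Lemma vfield_inj P Q : phi P = phi Q -> P = Q.
Proof.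
move=> h; apply/ffunP => j; apply/eqP; rewrite -subr_eq0; apply/eqP/mpoly_vanish => x.
have fe : free e by exact: basis_free he.
have := congr1 (fun X => coord e j (X (\sum_(i < n) x i *: e`_i))) h.
rewrite /phi /vfield_of !coord_sum_free // mevalB => h'; apply/eqP; rewrite subr_eq0; apply/eqP.
rewrite (@meval_eq _ _ _ (fun i => coord e i (\sum_(i < n) x i *: e`_i))) => [|i]; last first.
  by rewrite coord_sum_free.
rewrite h'; apply: meval_eq => i; by rewrite coord_sum_free.
Qed.

Lemma vfield_lin a P Q : phi (a *: P + Q) = a *: phi P + phi Q.
Proof.
apply/funext => v; rewrite /phi /vfield_of /=.
have -> : (a *: vfield_of e P + vfield_of e Q) v = a *: vfield_of e P v + vfield_of e Q v by [].
rewrite scaler_sumr -big_split /=; apply: eq_bigr => j _.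
by rewrite !ffunE mevalD mevalZ scalerDl scalerA.
Qed.

Lemma vfield0 : phi 0 = 0.
Proof. by have := vfield_lin (-1) 0 0; rewrite scaler0 addr0 scaleN1r addNr. Qed.

Lemma vfield_sum I (r : seq I) (p : pred I) (F : I -> PF K n) :
  phi (\sum_(i <- r | p i) F i) = \sum_(i <- r | p i) phi (F i).
Proof.
elim/big_rec2: _ => [|i X P _ <-]; first exact: vfield0.
by have := vfield_lin 1 (F i) P; rewrite !scale1r.
Qed.

Lemma coefs_vfield P : coefs e (phi P) = P.
Proof.
by apply/vfield_inj/esym; apply: (@xgetPex _ 0 [set Q | phi P = phi Q]); exists P.
Qed.

Lemma bracket_vfield P Q : bracket e (phi P) (phi Q) = phi (br P Q).
Proof. by rewrite /bracket !coefs_vfield. Qed.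

Definition pre L P := L (phi P).

Lemma pre_lie L : is_subalgebra e L -> pflie (pre L).
Proof.
move=> [_ [L0 LL] Lb]; split; first split; first by rewrite /pre vfield0.
  by move=> a P Q LP LQ; rewrite /pre vfield_lin; apply: LL.
by move=> P Q LP LQ; rewrite /pre -bracket_vfield; apply: Lb.
Qed.

Lemma image_subalgebra (W : PF K n -> Prop) : pflie W -> is_subalgebra e [set phi P | P in W].
Proof.
move=> hW; split.
- by move=> _ [P _ <-]; exists P.
- split; first by exists 0; [exact: hW.1.1|exact: vfield0].
  by move=> a _ _ [P WP <-] [Q WQ <-]; exists (a *: P + Q); [exact: hW.1.2|exact: vfield_lin].
- by move=> _ _ [P WP <-] [Q WQ <-]; exists (br P Q); [exact: hW.2|rewrite bracket_vfield].
Qed.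

Definition pf_maximal (L : PF K n -> Prop) := forall W : PF K n -> Prop, pflie W -> (forall P, L P -> W P) ->
  (forall P, W P -> L P) \/ (forall P, W P).

Lemma maximalE L : is_subalgebra e L -> is_maximal e L <-> pf_maximal (pre L).
Proof.
move=> hL; split=> [mL W hW LW|mL L' hL' LL'].
  have LL' : L `<=` [set phi P | P in W].
    by move=> X LX; have [sV _ _] := hL; have [P eP] := sV _ LX; exists P => //; apply: LW; rewrite /pre /phi -eP.
  have inj P : [set phi P | P in W] (phi P) -> W P by move=> [Q WQ /vfield_inj <-].
  have [eL|eV] := mL _ (image_subalgebra hW) LL'.
    by left=> P WP; rewrite /pre -eL; exists P.
  by right=> P; apply: inj; rewrite eV; exists P.
have [sV _ _] := hL; have [sV' _ _] := hL'.
have [h|h] := mL _ (pre_lie hL') (fun P LP => LL' _ LP).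
  left; apply/seteqP; split=> // X L'X; have [P eP] := sV' _ L'X.
  by rewrite eP; apply: h; rewrite /pre /phi -eP.
right; apply/seteqP; split=> // X [P eP]; rewrite eP; exact: h.
Qed.

Lemma componentE L p X :
  component e L p X <-> exists P, [/\ X = phi P, hom (absz (p + 1)) P & pre L P].
Proof.
split=> [[LX [P hP eP]]|[P [-> hP LP]]]; last by split=> //; exists P.
by exists P; split=> //; rewrite /pre /phi -eP.
Qed.

Lemma component_vfield L p P : component e L p (phi P) <-> hom (absz (p + 1)) P /\ pre L P.
Proof.
rewrite componentE; split=> [[Q [/vfield_inj -> hQ LQ]]//|[hP LP]].
by exists P.
Qed.

Lemma graded_pre L k : is_subalgebra e L -> is_graded_upto e L k ->
  pfgraded (pre L) /\ exists N, forall P, pre L P -> bounded N P.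
Proof.
move=> hL gL; set N := absz (k + 2).
have dec P : pre L P -> exists F : nat -> PF K n,
    [/\ P = \sum_(d < N) F d, forall d, (d < N)%N -> hom d (F d) & forall d, (d < N)%N -> pre L (F d)].
  move=> LP; move: (LP : L (phi P)); rewrite {1}gL => -[Y hY eY].
  have hY' d : (d < N)%N -> [/\ Y d = phi (coefs e (Y d)), hom d (coefs e (Y d)) & pre L (coefs e (Y d))].
    move=> dN; have /componentE[Q [eQ hQ LQ]] := hY d dN.
    by rewrite subrK /= in hQ; rewrite eQ coefs_vfield.
  exists (fun d => coefs e (Y d)); split=> [|d /hY'[]//|d /hY'[]//].
  apply: vfield_inj; rewrite vfield_sum eY; apply: eq_bigr => d _.
  by have [] := hY' d (ltn_ord d).
split; last first.
  exists N => P /dec[F [-> hF _]]; apply: subsp_sum => [|d _]; first exact: bounded_subsp.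
  by apply: bounded_mono (ltn_ord d) (hom_bounded (hF d (ltn_ord d))).
have sL := (pre_lie hL).1.
move=> P d /dec[F [-> hF LF]]; rewrite linear_sum; apply: subsp_sum => // i _ /=.
have [di|di] := eqVneq d i; last by rewrite (hc_hom_ne (hF i (ltn_ord i))) //; exact: sL.1.
by rewrite di (hc_hom (hF i (ltn_ord i))); exact: LF.
Qed.

Lemma has_cstE L : component e L (-1) = Vect_deg e (-1) <-> has_cst (pre L).
Proof.
split=> [h v|h].
  suff /component_vfield[] : component e L (-1) (phi (cst v)) by [].
  by rewrite h; exists (cst v) => //; exact: hom_cst.
apply/seteqP; split=> [X []//|X [P hP ->]].
by split; [rewrite (hom0P hP); exact: h|exists P].
Qed.

Lemma quadE L : is_subalgebra e L -> component e L 1 <> [set 0] <->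
  exists P, [/\ pre L P, hom 2 P & P != 0].
Proof.
move=> hL; split=> [h|[P [LP hP P0]] h].
  apply: contrapT => hn; apply: h; apply/seteqP; split=> [X /componentE[P [-> hP LP]]|_ ->].
    have -> : P = 0 by apply: contrapT => /eqP P0; apply: hn; exists P.
    by rewrite vfield0.
  rewrite -vfield0; apply/component_vfield; split; last exact: (pre_lie hL).1.1.
  exact: (hom_subsp K n 2).1.
have : component e L 1 (phi P) by apply/component_vfield.
by rewrite h /= -vfield0 => /vfield_inj/eqP; rewrite (negPf P0).
Qed.

Lemma bracket_lin_cst A v : bracket e (phi (lin A)) (phi (cst v)) = phi (cst (- (v *m A))).
Proof. by rewrite bracket_vfield br_lin_cst linearN. Qed.

Lemma pcst_lin a v w : phi (cst (a *: v + w)) = a *: phi (cst v) + phi (cst w).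
Proof. by rewrite linearP vfield_lin. Qed.

Lemma pcstN v : phi (cst (- v)) = - phi (cst v).
Proof. by have := pcst_lin (-1) v 0; rewrite linear0 vfield0 !addr0 !scaleN1r. Qed.

Lemma component0 L X : component e L 0 X <-> exists2 A, X = phi (lin A) & linpart (pre L) A.
Proof.
rewrite componentE; split=> [[P [-> hP LP]]|[A -> LA]].
  by rewrite (hom1P hP) in LP *; exists (lmat P).
by exists (lin A); split=> //; exact: hom_lin.
Qed.

Lemma componentN1 L X : has_cst (pre L) -> component e L (-1) X <-> exists v, X = phi (cst v).
Proof.
move=> VL; rewrite componentE; split=> [[P [-> hP LP]]|[v ->]].
  by exists (cvec P); rewrite -hom0P.
by exists (cst v); split; [|exact: hom_cst|exact: VL].
Qed.

Lemma irreducibleE L : has_cst (pre L) ->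
  is_irreducible_rep e (component e L 0) (component e L (-1)) <-> mxirr (linpart (pre L)).
Proof.
move=> VL; split=> [[_ irr] U sU stU [v Uv v0] w|irr].
  have [|||e0|eV] := irr [set phi (cst u) | u in U].
  - split; first by exists 0; [exact: sU.1|rewrite linear0 vfield0].
    move=> a _ _ [x Ux <-] [y Uy <-]; exists (a *: x + y); first exact: sU.2.
    by rewrite linearP vfield_lin.
  - by move=> _ [u Uu <-]; apply/(componentN1 _ VL); exists u.
  - move=> _ _ /component0[A -> LA] [u Uu <-]; rewrite bracket_lin_cst.
    by exists (- (u *m A)) => //; apply: subspN => //; exact: stU.
  - have : [set phi (cst u) | u in U] (phi (cst v)) by exists v.
    rewrite e0 /= -vfield0 => /vfield_inj h; have := cstK v.
    by rewrite h linear0 => /esym/eqP; rewrite (negPf v0).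
  have : component e L (-1) (phi (cst w)) by apply/(componentN1 _ VL); exists w.
  by rewrite -eV => -[u Uu /vfield_inj/(congr1 (@cvec K n))]; rewrite !cstK => <-.
split=> [h|W sW WV stW].
  have : component e L (-1) (phi (cst (const_mx 1))).
    by apply/(componentN1 _ VL); exists (const_mx 1).
  rewrite h /= -vfield0 => /vfield_inj/(congr1 (@cvec K n)); rewrite cstK linear0.
  by move/rowP/(_ 0); rewrite !mxE => /eqP; rewrite oner_eq0.
pose U v := W (phi (cst v)).
have sU : subsp U.
  split; first by rewrite /U linear0 vfield0; exact: sW.1.
  by move=> a x y Ux Uy; rewrite /U linearP vfield_lin; exact: sW.2.
have stU A v : linpart (pre L) A -> U v -> U (v *m A).
  move=> LA Uv; rewrite -[_ *m _]opprK; apply: subspN => //; rewrite /U -bracket_lin_cst.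
  by apply: stW => //; apply/component0; exists A.
have [[v [Uv v0]]|hn] := pselect (exists v, U v /\ v != 0).
  right; apply/seteqP; split=> // X /(componentN1 _ VL)[w ->].
  by apply: (irr U sU stU) => //; exists v.
left; apply/seteqP; split=> [X WX|_ ->]; last exact: sW.1.
have /(componentN1 _ VL)[v eX] := WV _ WX; rewrite eX /=.
have -> : v = 0 by apply: contrapT => /eqP v0; apply: hn; exists v; rewrite /U -eX.
by rewrite linear0 vfield0.
Qed.

Lemma complex_structureE L : has_cst (pre L) ->
  (exists J, is_complex_structure e (component e L 0) (component e L (-1)) J) <->
  has_cplx_struct (linpart (pre L)).
Proof.
move=> VL; have V v : component e L (-1) (phi (cst v)).
  by apply/(componentN1 _ VL); exists v.
split=> [[J [JV Jlin JJ Jbr]]|[J [JJ hJ]]].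
  pose j v := cvec (coefs e (J (phi (cst v)))).
  have jE v : J (phi (cst v)) = phi (cst (j v)).
    by have /(componentN1 _ VL)[w ew] := JV _ (V v); rewrite /j ew coefs_vfield cstK.
  have cinj v w : phi (cst v) = phi (cst w) -> v = w.
    by move/vfield_inj/(congr1 (@cvec K n)); rewrite !cstK.
  have linj : linear j.
    by move=> a v w; apply: cinj; rewrite -jE !pcst_lin Jlin // !jE.
  pose jl : {linear 'rV[K]_n -> 'rV[K]_n} := HB.pack j (GRing.isLinear.Build _ _ _ _ j linj).
  have jlE x : x *m lin1_mx jl = j x by rewrite mul_rV_lin1.
  exists (lin1_mx jl); split=> [|A LA]; apply: mulmx_row_eq => v.
    by rewrite mulmxA !jlE mulmxN mulmx1; apply: cinj; rewrite -!jE JJ // pcstN.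
  rewrite !mulmxA !jlE; apply: oppr_inj; apply: cinj.
  have LA' : component e L 0 (phi (lin A)) by apply/component0; exists A.
  have := Jbr _ _ LA' (V v); rewrite jE !bracket_lin_cst => ->.
  by rewrite jE -[j (- _)]/(jl (- _)) (linearN jl).
pose JJ' X := phi (cst (cvec (coefs e X) *m J)).
have JE v : JJ' (phi (cst v)) = phi (cst (v *m J)) by rewrite /JJ' coefs_vfield cstK.
exists JJ'; split=> [X _|a X Y|X|X Y].
- exact: V.
- move=> /(componentN1 _ VL)[v ->] /(componentN1 _ VL)[w ->].
  by rewrite -pcst_lin !JE mulmxDl -scalemxAl pcst_lin.
- by move=> /(componentN1 _ VL)[v ->]; rewrite !JE -mulmxA JJ mulmxN mulmx1 pcstN.
move=> /component0[A -> LA] /(componentN1 _ VL)[v ->].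
by rewrite JE !bracket_lin_cst JE mulNmx -!mulmxA hJ.
Qed.

End Transfer.

(** The parameter [NC] stands for the condition that depends on the field: it is void in the complex
    case and excludes complex structures in the real one. *)
Lemma maximal_iff (K : numFieldType) (E : vectType K) (n' : nat) (e : n'.+1.-tuple E)
    (he : basis_of fullv e) (L : set (E -> E)) (hL : is_subalgebra e L) (k : int)
    (hgr : is_graded_upto e L k) (NC : ('M[K]_n'.+1 -> Prop) -> Prop) :
  (forall L' N, pflie L' -> pfgraded L' -> (forall P, L' P -> bounded N P) ->
     pf_maximal L' -> NC (linpart L')) ->
  (forall (L' W : PF K n'.+1 -> Prop) N, pflie L' -> pfgraded L' -> has_cst L' ->
     mxirr (linpart L') -> NC (linpart L') -> (exists X, [/\ L' X, hom 2 X & X != 0]) ->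
     (forall P, L' P -> bounded N P) -> pflie W -> (forall P, L' P -> W P) ->
     (forall P, W P -> L' P) \/ (forall P, W P)) ->
  is_maximal e L <->
  [/\ component e L (-1) = Vect_deg e (-1),
      is_irreducible_rep e (component e L 0) (component e L (-1)),
      component e L 1 <> [set 0] & NC (linpart (pre e L))].
Proof.
move=> conv core; have [gL [N bL]] := graded_pre he hL hgr; have hL' := pre_lie he hL.
rewrite (maximalE he hL); split=> [mL|[/(has_cstE he) VL irr /(quadE he hL) L1 nc] W hW LW].
  have VL := maximal_has_cst hL' gL bL mL.
  split; first exact/has_cstE.
  - apply/(irreducibleE he VL). exact (maximal_irr hL' gL bL mL).
  - apply/(quadE he hL). exact (maximal_quad hL' gL bL mL).
  - exact: conv bL mL.
by apply: (core _ _ _ hL' gL VL _ nc L1 bL hW LW); apply/(irreducibleE he VL).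
Qed.

Theorem theorem1 (R : realType) (s : scalar_kind)
    (E : vectType (scalars R s)) (n : nat) (hn : (1 <= n)%N)
    (e : n.-tuple E) (he : basis_of fullv e)
    (L : set (E -> E)) (hL : is_subalgebra e L)
    (k : int) (hk : -1 <= k) (hgr : is_graded_upto e L k) :
  is_maximal e L <->
  [/\ component e L (-1) = Vect_deg e (-1),
      is_irreducible_rep e (component e L 0) (component e L (-1)),
      component e L 1 <> [set 0]
    & s = RealScalars ->
      ~ exists J : (E -> E) -> (E -> E),
          is_complex_structure e (component e L 0) (component e L (-1)) J].
Proof.
case: n hn e he L hL hgr => // n' _ e he L hL hgr.
case: s E e he L hL hgr => E e he L hL hgr; last first.
  have [|L' W N hL' gL VL irr _ |h1 h2] := @maximal_iff R[i] E n' e he L hL k hgr (fun=> True).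
  - by [].
  - exact (core_maximal hL' gL VL irr).
  by split=> [/h1[a b c _]|[a b c _]]; [split|exact: h2].
have [L' N hL' gL bL mL|L' W N|h1 h2] :=
  @maximal_iff R E n' e he L hL k hgr (fun M => ~ has_cplx_struct M).
- exact: maximal_no_cplx_struct hL' gL bL mL.
- apply: (@core_maximal_cplx R R[i] (real_complex R) 'i%C (@complex.Re R) (@complex.Im R)).
  + by move=> z; rewrite addrC; exact: complexE.
  + by move=> a b; rewrite /= !mul0r mul1r subr0 add0r.
  + by move=> a b; rewrite /= mul0r mul1r add0r addr0.
  + by have := @sqr_i R; rewrite expr2.
have cE VL := complex_structureE he (L := L) VL.
split=> [/h1[a b c d]|[a b c d]].
  by split=> // _ /(cE ((has_cstE he L).1 a)).
apply: h2; split=> // /(cE ((has_cstE he L).1 a)); exact: d.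
Qed.
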